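(* If $R=\bigoplus_{g} R_g$ is a finite-dimensional real graded division algebra with $\dim R_e=4$, then $R$ is equivalent to exactly one of the following: (1) $\mathbb{H}\otimes\mathcal{D}(\chi)\otimes\mathbb{R}G$, where $\chi$ can be even or odd and $G$ is a finite abelian group; (2) $\mathbb{H}\otimes\mathcal{C}(2^m;-1)\otimes\mathcal{D}(\chi)\otimes\mathbb{R}G$, where $m\ge1$, $\chi$ is even and $G$ is a finite abelian group; (3) $\mathbb{H}\otimes\mathbb{H}^{(4)}\otimes\mathcal{D}(\chi)\otimes\mathbb{R}G$, where $\chi$ is even and $G$ is a finite abelian group. Here $\chi$ may be empty when it is even. ''Exactly one'' means that the item of the list, the number $m$ (in item (2)), the isomorphism class of $G$ and the characteristic $\chi$ are uniquely determined, where characteristics are regarded as the same if they differ by a permutation of the quadruples, by interchanging $(k,k;1,-1)$ and $(k,k;-1,1)$, or by replacing a quadruple $(1,1;-1,1)$ or $(1,1;1,-1)$ by $(1,1;1,1)$.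
   Context: A $G$-graded real algebra $R=\bigoplus_{g\in G}R_g$ ($G$ an abelian group with identity $e$, $R_gR_h\subset R_{gh}$, $R$ associative and unital with identity element $I$) is a graded division algebra if every nonzero homogeneous element is invertible. The support $\{g:R_g\ne0\}$ is always assumed to be all of $G$, so $G$ is finite when $R$ is finite-dimensional. A $G$-graded division algebra $R$ and a $G'$-graded division algebra $R'$ are equivalent if there are an isomorphism of $\mathbb R$-algebras $\varphi:R\to R'$ and a group isomorphism $\alpha:G\to G'$ with $\varphi(R_g)=R'_{\alpha(g)}$ for all $g\in G$. Tensor products over $\mathbb R$ of a $G_1$-graded and a $G_2$-graded algebra are graded by $G_1\times G_2$ via $(R_1\otimes R_2)_{(g_1,g_2)}=(R_1)_{g_1}\otimes(R_2)_{g_2}$. The natural grading of the group algebra $\mathbb RG$ is $(\mathbb RG)_g=\mathbb Rg$. $\mathbb H$ is the quaternion algebra with trivial grading (by the trivial group). Basic algebras. For $n>1$ and $\varepsilon=\pm1$, $\mathcal C(n;\varepsilon)$ is the real algebra generated by $x$ with defining relation $x^n=\varepsilon I$, graded by the cyclic group of order $n$ with generator $g$, $\deg x=g$. For $k,\ell\ge1$ and $\mu,\nu=\pm1$, $\mathcal D(2^k,2^\ell;\mu,\nu)$ is the real algebra with generators $u,v$ and defining relations $u^{2^k}=\mu I$, $v^{2^\ell}=\nu I$, $uv=-vu$, graded by $(g)_{2^k}\times(h)_{2^\ell}$ (product of cyclic groups of orders $2^k,2^\ell$ with generators $g,h$), $\deg u=g$, $\deg v=h$. $\mathbb H^{(4)}=\mathcal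 D(2,2;-1,-1)$ is the quaternion algebra with its $\mathbb Z_2\times\mathbb Z_2$-grading with components $\langle1\rangle,\langle i\rangle,\langle j\rangle,\langle k\rangle$. A characteristic is a finite sequence $\chi=\{(k_1,\ell_1;\mu_1,\nu_1),\dots,(k_s,\ell_s;\mu_s,\nu_s)\}$ with natural numbers $1\le k_i\le\ell_i$ and signs $\mu_i,\nu_i=\pm1$, and $\mathcal D(\chi)=\mathcal D(2^{k_1},2^{\ell_1};\mu_1,\nu_1)\otimes\cdots\otimes\mathcal D(2^{k_s},2^{\ell_s};\mu_s,\nu_s)$ (equal to $\mathbb R$ if $\chi$ is empty). $\chi$ is even if none of the $\mu_i,\nu_i$ equals $-1$, or if exactly one of them equals $-1$ and it occurs in a quadruple $(1,1;-1,1)$ or $(1,1;1,-1)$. $\chi$ is odd if exactly one of the $\mu_i,\nu_i$ equals $-1$ and it does not occur in a quadruple $(1,1;-1,1)$ or $(1,1;1,-1)$. *)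

(* Defs.v *)
From HB Require Import structures.
From mathcomp Require Import all_boot all_order all_algebra all_fingroup all_field.
From mathcomp Require Import reals.

Set Implicit Arguments.
Unset Strict Implicit.
Unset Printing Implicit Defensive.

Import GRing.Theory.
Local Open Scope ring_scope.

(* Abelian groups are written additively (zmodType); the identity e is 0.     *)

(* A = \bigoplus_(g : G) V g. For infinite G, directness means directness of  *)
(* all finite subfamilies; as A is finite-dimensional, the whole sum is       *)
(* exhausted by finitely many components.                                     *)
Definition is_grading (F : fieldType) (G : zmodType) (A : falgType F)
    (V : G -> {vspace A}) : Prop :=
  [/\ exists s : seq G, (\sum_(g <- s) V g)%VS = fullv,
      forall s : seq G, uniq s -> directv (\sum_(g <- s) V g)
    & forall g h : G, (V g * V h <= V (g + h)%R)%VS].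

Definition graded_division (F : fieldType) (G : zmodType) (A : falgType F)
    (V : G -> {vspace A}) : Prop :=
  [/\ is_grading V,
      forall (g : G) (x : A), x \in V g -> x != 0 -> x \is a GRing.unit
    & forall g : G, V g != 0%VS].

(* Raw data: that the components form a grading is not part of the record.    *)
Record gralg (F : fieldType) := Gralg {
  gr_grp : zmodType;
  gr_alg : falgType F;
  gr_comp : gr_grp -> {vspace gr_alg} }.
Arguments gr_comp {F} X g : rename.

Definition gr_equiv (F : fieldType) (X Y : gralg F) : Prop :=
  exists (phi : 'AHom(gr_alg X, gr_alg Y))
         (alpha : {additive gr_grp X -> gr_grp Y}),
    [/\ bijective phi, bijective alpha
      & forall g, (phi @: gr_comp X g)%VS = gr_comp Y (alpha g)].

(* Relative to the bases (e_i) of A and (f_j) of B given by vbasis, M         *)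
(* stands for \sum_(i, j) M i j *: (e_i (x) f_j).                             *)
Definition tens (F : fieldType) (A B : falgType F) : Type :=
  'M[F]_(\dim {:A}, \dim {:B}).

HB.instance Definition _ (F : fieldType) (A B : falgType F) :=
  Vector.on (tens A B).

Section Tensor.
Variables (F : fieldType) (A B : falgType F).
Implicit Types (a : A) (b : B).

Let e (i : 'I_(\dim {:A})) : A := (vbasis {:A})`_i.
Let f (j : 'I_(\dim {:B})) : B := (vbasis {:B})`_j.

Definition pure a b : tens A B :=
  \matrix_(i, j) (coord (vbasis {:A}) i a * coord (vbasis {:B}) j b).

Definition tens_mul (M N : tens A B) : tens A B :=
  \sum_i \sum_j \sum_k \sum_l (M i j * N k l) *: pure (e i * e k) (f j * f l).

Lemma pureDl a a' b : pure (a + a') b = pure a b + pure a' b.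
Proof. by apply/matrixP=> i j; rewrite !mxE linearD mulrDl. Qed.

Lemma pureDr a b b' : pure a (b + b') = pure a b + pure a b'.
Proof. by apply/matrixP=> i j; rewrite !mxE linearD mulrDr. Qed.

Lemma pureZl c a b : pure (c *: a) b = c *: pure a b.
Proof. by apply/matrixP=> i j; rewrite !mxE linearZ /= mulrA. Qed.

Lemma pureZr c a b : pure a (c *: b) = c *: pure a b.
Proof. by apply/matrixP=> i j; rewrite !mxE linearZ /= mulrCA. Qed.

Lemma pure_suml I (r : seq I) (P : pred I) (g : I -> A) b :
  pure (\sum_(i <- r | P i) g i) b = \sum_(i <- r | P i) pure (g i) b.
Proof. by apply/matrixP=> i j; rewrite summxE mxE linear_sum mulr_suml; apply: eq_bigr => k _; rewrite mxE. Qed.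

Lemma pure_sumr I (r : seq I) (P : pred I) a (g : I -> B) :
  pure a (\sum_(i <- r | P i) g i) = \sum_(i <- r | P i) pure a (g i).
Proof. by apply/matrixP=> i j; rewrite summxE mxE linear_sum mulr_sumr; apply: eq_bigr => k _; rewrite mxE. Qed.

Let eE a : a = \sum_i coord (vbasis {:A}) i a *: e i.
Proof. exact: coord_vbasis (memvf a). Qed.

Let fE b : b = \sum_j coord (vbasis {:B}) j b *: f j.
Proof. exact: coord_vbasis (memvf b). Qed.

Let pure_e i j : pure (e i) (f j) = delta_mx i j.
Proof.
apply/matrixP=> k l; rewrite !mxE /e /f.
rewrite !coord_free ?(basis_free (vbasisP _)) // -natrM mulnb.
by rewrite eq_sym [j == l]eq_sym.
Qed.

Lemma tens_sum_pure (M : tens A B) :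
  M = \sum_i \sum_j M i j *: pure (e i) (f j).
Proof.
rewrite {1}[M]matrix_sum_delta.
by do 2!apply: eq_bigr => ? _; rewrite pure_e.
Qed.

Let mulDl : left_distributive tens_mul +%R.
Proof.
move=> M N P; rewrite /tens_mul -big_split; apply: eq_bigr => i _ /=.
rewrite -big_split; apply: eq_bigr => j _ /=.
rewrite -big_split; apply: eq_bigr => k _ /=.
rewrite -big_split; apply: eq_bigr => l _ /=.
by rewrite mxE mulrDl scalerDl.
Qed.

Let mulDr : right_distributive tens_mul +%R.
Proof.
move=> M N P; rewrite /tens_mul -big_split; apply: eq_bigr => i _ /=.
rewrite -big_split; apply: eq_bigr => j _ /=.
rewrite -big_split; apply: eq_bigr => k _ /=.
rewrite -big_split; apply: eq_bigr => l _ /=.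
by rewrite mxE mulrDr scalerDl.
Qed.

Let mulZl c M N : tens_mul (c *: M) N = c *: tens_mul M N.
Proof.
rewrite /tens_mul scaler_sumr; apply: eq_bigr => i _ /=.
rewrite scaler_sumr; apply: eq_bigr => j _ /=.
rewrite scaler_sumr; apply: eq_bigr => k _ /=.
rewrite scaler_sumr; apply: eq_bigr => l _ /=.
by rewrite mxE scalerA mulrA.
Qed.

Let mulZr c M N : tens_mul M (c *: N) = c *: tens_mul M N.
Proof.
rewrite /tens_mul scaler_sumr; apply: eq_bigr => i _ /=.
rewrite scaler_sumr; apply: eq_bigr => j _ /=.
rewrite scaler_sumr; apply: eq_bigr => k _ /=.
rewrite scaler_sumr; apply: eq_bigr => l _ /=.
by rewrite mxE scalerA mulrCA.
Qed.

Let mul0l N : tens_mul 0 N = 0.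
Proof. by have := mulZl 0 0 N; rewrite !scale0r. Qed.

Let mul0r N : tens_mul N 0 = 0.
Proof. by have := mulZr 0 N 0; rewrite !scale0r. Qed.

Let mul_suml I (r : seq I) (P : pred I) (g : I -> tens A B) N :
  tens_mul (\sum_(i <- r | P i) g i) N = \sum_(i <- r | P i) tens_mul (g i) N.
Proof. exact: (big_morph (tens_mul^~ N) (fun x y => mulDl x y N) (mul0l N)). Qed.

Let mul_sumr I (r : seq I) (P : pred I) (g : I -> tens A B) N :
  tens_mul N (\sum_(i <- r | P i) g i) = \sum_(i <- r | P i) tens_mul N (g i).
Proof. exact: (big_morph (tens_mul N) (mulDr N) (mul0r N)). Qed.

Lemma tens_mul_pure a b a' b' :
  tens_mul (pure a b) (pure a' b') = pure (a * a') (b * b').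
Proof.
rewrite {2}[a]eE {2}[a']eE {2}[b]fE {2}[b']fE.
rewrite mulr_suml pure_suml; apply: eq_bigr => i _.
rewrite mulr_suml pure_sumr; apply: eq_bigr => j _.
rewrite mulr_sumr pure_suml; apply: eq_bigr => k _.
rewrite mulr_sumr pure_sumr; apply: eq_bigr => l _.
rewrite -!scalerAl -!scalerAr !pureZl !pureZr !scalerA !mxE.
congr (_ *: _); rewrite -!mulrA; congr (_ * _).
exact: mulrCA.
Qed.

Lemma tens_ind (P : tens A B -> Prop) :
  (forall a b, P (pure a b)) -> (forall M N, P M -> P N -> P (M + N)) ->
  forall M, P M.
Proof.
move=> Pp PD M; have P0 : P 0.
  by rewrite -(scale0r (pure 0 0)) -pureZl.
rewrite (tens_sum_pure M); do 2!apply: big_ind => // ? _.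
by rewrite -pureZl.
Qed.

Let mulA : associative tens_mul.
Proof.
move=> M N P; elim/tens_ind: M => [a b|M M' IH IH']; last by rewrite !mulDl IH IH'.
elim/tens_ind: N => [a' b'|N N' IH IH']; last by rewrite mulDr !mulDl mulDr IH IH'.
elim/tens_ind: P => [a'' b''|P P' IH IH']; last by rewrite !mulDr IH IH'.
by rewrite !tens_mul_pure !mulrA.
Qed.

Let mul1l : left_id (pure 1 1) tens_mul.
Proof.
elim/tens_ind=> [a b|M N IM IN]; first by rewrite tens_mul_pure !mul1r.
by rewrite mulDr IM IN.
Qed.

Let mul1r' : right_id (pure 1 1) tens_mul.
Proof.
elim/tens_ind=> [a b|M N IM IN]; first by rewrite tens_mul_pure !mulr1.
by rewrite mulDl IM IN.
Qed.

Let one_neq0 : pure 1 1 != 0.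
Proof.
have nz (V : falgType F) : exists i, coord (vbasis {:V}) i 1 != 0.
  apply/existsP; apply: contra_neqT (oner_neq0 V) => /existsPn v0.
  rewrite (coord_vbasis (memvf (1 : V))) big1 // => i _.
  by have /negPn/eqP-> := v0 i; rewrite scale0r.
have [i i0] := nz A; have [j j0] := nz B.
apply/eqP => /matrixP/(_ i j)/eqP; rewrite !mxE mulf_eq0.
by rewrite (negPf i0) (negPf j0).
Qed.

HB.instance Definition _ := GRing.Zmodule_isNzRing.Build (tens A B)
  mulA mul1l mul1r' mulDl mulDr one_neq0.
HB.instance Definition _ := GRing.Lmodule_isLalgebra.Build F (tens A B)
  (fun c M N => esym (mulZl c M N)).
HB.instance Definition _ := GRing.Lalgebra_isAlgebra.Build F (tens A B)
  (fun c M N => esym (mulZr c M N)).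
HB.instance Definition _ := Algebra_isFalgebra.Build F (tens A B).

Lemma pureM a b a' b' : pure a b * pure a' b' = pure (a * a') (b * b').
Proof. exact: tens_mul_pure. Qed.

Lemma pure1 : pure 1 1 = 1.
Proof. by []. Qed.

Definition tensv (U : {vspace A}) (V : {vspace B}) : {vspace tens A B} :=
  <<[seq pure a b | a <- vbasis U, b <- vbasis V]>>%VS.

End Tensor.

Definition gr_tens (F : fieldType) (X Y : gralg F) : gralg F :=
  @Gralg F (gr_grp X * gr_grp Y)%type (tens (gr_alg X) (gr_alg Y))
    (fun g => tensv (gr_comp X g.1) (gr_comp Y g.2)).

HB.instance Definition _ (T U : finZmodType) := Finite.on (T * U)%type.

Record cocycle (F : fieldType) (T : finZmodType) := Cocycle {
  cocf :> T -> T -> F;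
  coc0l : forall t, cocf 0 t = 1;
  coc0r : forall t, cocf t 0 = 1;
  cocA : forall r s t, cocf r s * cocf (r + s) t = cocf s t * cocf r (s + t) }.

(* The algebra with basis (tbasis t) for t : T, and product                   *)
(* tbasis s * tbasis t = c s t *: tbasis (s + t).                             *)
Definition twisted (F : fieldType) (T : finZmodType) (c : cocycle F T) : Type :=
  {ffun T -> F^o}.

HB.instance Definition _ (F : fieldType) (T : finZmodType) (c : cocycle F T) :=
  Vector.on (twisted c).

Section Twisted.
Variables (F : fieldType) (T : finZmodType) (c : cocycle F T).
Implicit Types (a b d : twisted c).

Definition tbasis (t : T) : twisted c := [ffun x => (x == t)%:R].

Definition twisted_mul a b : twisted c :=
  [ffun z => \sum_s a s * b (z - s) * c s (z - s)].

Let mulDl : left_distributive twisted_mul +%R.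
Proof.
move=> a b d; apply/ffunP=> z; rewrite !ffunE -big_split; apply: eq_bigr => s _.
by rewrite ffunE !mulrDl.
Qed.

Let mulDr : right_distributive twisted_mul +%R.
Proof.
move=> a b d; apply/ffunP=> z; rewrite !ffunE -big_split; apply: eq_bigr => s _.
by rewrite ffunE mulrDr !mulrDl.
Qed.

Let mulZl k a b : k *: twisted_mul a b = twisted_mul (k *: a) b.
Proof.
apply/ffunP=> z; rewrite !ffunE scaler_sumr; apply: eq_bigr => s _.
by rewrite ffunE -!mulrA.
Qed.

Let mulZr k a b : k *: twisted_mul a b = twisted_mul a (k *: b).
Proof.
apply/ffunP=> z; rewrite !ffunE scaler_sumr; apply: eq_bigr => s _.
by rewrite ffunE /GRing.scale /= -!mulrA mulrCA.
Qed.

Let mulA : associative twisted_mul.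
Proof.
move=> a b d; apply/ffunP=> z; rewrite !ffunE.
under eq_bigr => r _ do rewrite ffunE mulr_sumr mulr_suml.
under [RHS]eq_bigr => s _ do rewrite ffunE !mulr_suml.
rewrite [RHS]exchange_big; apply: eq_bigr => r _ /=.
rewrite [RHS](reindex_inj (addrI r)); apply: eq_bigr => s _ /=.
rewrite [r + s]addrC addrK [s + r]addrC opprD !addrA.
have := cocA c r s (z - r - s); rewrite [s + (_ - _)]addrC subrK => E.
rewrite -!mulrA; congr (_ * (_ * _)).
by rewrite [RHS]mulrCA [RHS](_ : _ = d (z - r - s) * (c r s * c (r + s) (z - r - s)))
  // E.
Qed.

Let mul1l : left_id (tbasis 0) twisted_mul.
Proof.
move=> a; apply/ffunP=> z; rewrite ffunE (bigD1 0) //= big1 => [|s s0].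
  by rewrite ffunE eqxx subr0 coc0l mul1r mulr1 addr0.
by rewrite ffunE (negPf s0) !mul0r.
Qed.

Let mul1r' : right_id (tbasis 0) twisted_mul.
Proof.
move=> a; apply/ffunP=> z; rewrite ffunE (bigD1 z) //= big1 => [|s s0].
  by rewrite ffunE subrr eqxx coc0r !mulr1 addr0.
by rewrite ffunE subr_eq0 eq_sym (negPf s0) mulr0 mul0r.
Qed.

Let one_neq0 : tbasis 0 != 0.
Proof. by apply/eqP => /ffunP/(_ 0)/eqP; rewrite !ffunE eqxx oner_eq0. Qed.

HB.instance Definition _ := GRing.Zmodule_isNzRing.Build (twisted c)
  mulA mul1l mul1r' mulDl mulDr one_neq0.
HB.instance Definition _ := GRing.Lmodule_isLalgebra.Build F (twisted c) mulZl.
HB.instance Definition _ := GRing.Lalgebra_isAlgebra.Build F (twisted c) mulZr.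
HB.instance Definition _ := Algebra_isFalgebra.Build F (twisted c).

Lemma tbasis0 : tbasis 0 = 1.
Proof. by []. Qed.

Lemma tbasisM s t : tbasis s * tbasis t = c s t *: tbasis (s + t).
Proof.
apply/ffunP=> z; rewrite !ffunE (bigD1 s) //= big1 => [|r r0]; last first.
  by rewrite ffunE (negPf r0) !mul0r.
rewrite !ffunE eqxx mul1r addr0 subr_eq [t + s]addrC.
by have [->|_] := eqVneq z (s + t); rewrite ?mul0r /GRing.scale /= ?mulr0 //
  addrC addKr mul1r mulr1.
Qed.

Lemma twisted_sum a : a = \sum_t a t *: tbasis t.
Proof.
apply/ffunP=> z; rewrite sum_ffunE (bigD1 z) //= big1 => [|s s0].
  by rewrite !ffunE eqxx addr0 /GRing.scale /= mulr1.
by rewrite !ffunE eq_sym (negPf s0) /GRing.scale /= mulr0.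
Qed.

Definition gr_twisted : gralg F :=
  @Gralg F T (twisted c) (fun t => <[tbasis t]>%VS).

Lemma twisted_lift (B : algType F) (h : T -> B) :
    h 0 = 1 -> (forall s t, h s * h t = c s t *: h (s + t)) ->
  exists f : {lrmorphism twisted c -> B}, forall t, f (tbasis t) = h t.
Proof.
move=> h0 hM; pose f a : B := \sum_t (a t : F) *: h t.
have fb t : f (tbasis t) = h t.
  rewrite /f (bigD1 t) //= big1 => [|s st]; rewrite ffunE ?eqxx ?scale1r ?addr0 //.
  by rewrite (negPf st) scale0r.
have flin : linear f.
  move=> k a b; rewrite /f scaler_sumr -big_split; apply: eq_bigr => t _ /=.
  by rewrite !ffunE scalerDl scalerA.
have fM a b : f (a * b) = f a * f b.
  pose fl : {linear twisted c -> B} :=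
    HB.pack f (GRing.isLinear.Build F (twisted c) B *:%R f flin).
  have fE x : f x = fl x by [].
  rewrite [in LHS](twisted_sum a) [in LHS](twisted_sum b) mulr_suml.
  rewrite fE linear_sum [in RHS]/f mulr_suml; apply: eq_bigr => s _.
  rewrite mulr_sumr linear_sum mulr_sumr; apply: eq_bigr => t _.
  rewrite -!scalerAl -!scalerAr tbasisM !linearZ /= fb.
  by rewrite hM !scalerA [a s * _]mulrC.
pose fr : {lrmorphism twisted c -> B} :=
  HB.pack f (GRing.isLinear.Build F (twisted c) B *:%R f flin)
    (GRing.isMonoidMorphism.Build (twisted c) B f (conj (etrans (fb 0) h0) fM)).
by exists fr.
Qed.

Lemma twisted_ext (B : algType F) (f g : {lrmorphism twisted c -> B}) :
  (forall t, f (tbasis t) = g (tbasis t)) -> f =1 g.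
Proof.
move=> fg a; rewrite (twisted_sum a) !linear_sum; apply: eq_bigr => t _.
by rewrite !linearZ /= fg.
Qed.

End Twisted.

Definition gr_trivial (F : fieldType) (A : falgType F) : gralg F :=
  @Gralg F 'I_1 A (fun _ => fullv).

Definition grp_cocycle (F : fieldType) (G : finZmodType) : cocycle F G :=
  @Cocycle F G (fun _ _ => 1) (fun _ => erefl) (fun _ => erefl)
    (fun _ _ _ => erefl).

Definition gr_grpalg (F : fieldType) (G : finZmodType) : gralg F :=
  gr_twisted (grp_cocycle F G).

Definition carry (p : nat) (i j : 'I_p.+1) : bool := (p < i + j)%N.

Section Carry.
Variable p : nat.
Implicit Types i j k : 'I_p.+1.

Lemma carryE i j : (i + j = (i + j)%R + carry i j * p.+1)%N.
Proof.
have := ltn_ord i; have := ltn_ord j; rewrite /carry /= => hj hi.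
have [h|h] := ltnP p (i + j); last by rewrite modn_small // addn0.
rewrite mul1n -[in X in (X %% _)%N](subnK h) modnDr modn_small ?subnK //.
by rewrite ltn_subLR // -addSn leq_add // ltnW.
Qed.

Lemma carry0l i : carry 0 i = false.
Proof. by apply/negbTE; rewrite -leqNgt add0n -ltnS. Qed.

Lemma carry0r i : carry i 0 = false.
Proof. by apply/negbTE; rewrite -leqNgt addn0 -ltnS. Qed.

Lemma carryA i j k :
  (carry i j + carry (i + j)%R k = carry j k + carry i (j + k)%R)%N.
Proof.
apply/eqP; rewrite -(eqn_pmul2r (ltn0Sn p)) !mulnDl.
rewrite -(eqn_add2l (i + j + k : 'I_p.+1)%R) [X in X == _]addnA.
have -> : ((i + j + k : 'I_p.+1)%R + carry i j * p.+1 + carry (i + j)%R k * p.+1 = i + j + k)%N.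
  by rewrite addnAC -carryE addnAC -carryE.
rewrite [(carry j k * _ + _)%N]addnC addnA.
rewrite -[X in _ == (nat_of_ord X + _ + _)%N]addrA -carryE.
by rewrite -[X in _ == X]addnA -carryE addnA.
Qed.

Lemma exprD_carry (F : fieldType) (B : algType F) (x : B) (e : F) i j :
  x ^+ p.+1 = e%:A -> x ^+ i * x ^+ j = e ^+ carry i j *: x ^+ (i + j)%R.
Proof.
move=> xe; rewrite -exprD carryE exprD; case: carry.
  by rewrite mul1n xe -scalerAr mulr1 expr1.
by rewrite mul0n !expr0 mulr1 scale1r.
Qed.

End Carry.

Lemma expr_ord (B : pzRingType) p (x : B) (h : 'I_p.+2 -> B) :
    h 0 = 1 -> (forall i : 'I_p.+2, (i < p.+1)%N -> x * h i = h (1 + i)) ->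
  (forall i : 'I_p.+2, x ^+ i = h i) /\ x ^+ p.+2 = x * h ord_max.
Proof.
move=> h0 hS; have hX (i : 'I_p.+2) : x ^+ i = h i.
  case: i; elim=> [|i IH] lti /=; first by rewrite expr0 -h0; congr h; apply/val_inj.
  rewrite exprS (IH (ltnW lti)) hS //; congr h; apply/val_inj.
  by rewrite /= modn_small.
by split=> //; rewrite exprS -hX.
Qed.

Lemma carry1 p (i : 'I_p.+2) : carry 1 i = (i == ord_max).
Proof.
by have := ltn_ord i; rewrite /carry -val_eqE /= add1n ltnS eqn_leq ltnS => ->.
Qed.

Section Cyclic.
Variables (F : fieldType) (n : nat) (eps : F).

Definition C_fun (i j : 'Z_n) : F := eps ^+ carry i j.

Fact C_fun0l t : C_fun 0 t = 1. Proof. by rewrite /C_fun carry0l. Qed.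
Fact C_fun0r t : C_fun t 0 = 1. Proof. by rewrite /C_fun carry0r. Qed.
Fact C_funA r s t : C_fun r s * C_fun (r + s) t = C_fun s t * C_fun r (s + t).
Proof. by rewrite /C_fun -!exprD carryA. Qed.

Definition C_cocycle := Cocycle C_fun0l C_fun0r C_funA.

(* C(n; eps), for n > 1 only ('Z_0 and 'Z_1 have two elements); x ^+ i is     *)
(* tbasis _ i, see C_xX, and C_rel, C_universal give the presentation.        *)
Definition gr_C : gralg F := gr_twisted C_cocycle.

Definition C_x : twisted C_cocycle := tbasis C_cocycle 1.

Let C_pow : (forall i : 'Z_n, C_x ^+ i = tbasis C_cocycle i) /\
  C_x ^+ (Zp_trunc n).+2 = eps%:A.
Proof.
have [|i lti|hX ->] := @expr_ord _ _ C_x (tbasis C_cocycle).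
- exact: tbasis0.
- by rewrite tbasisM /= /C_fun carry1 -val_eqE /= ltn_eqF ?expr0 ?scale1r.
split=> //; rewrite tbasisM /= /C_fun carry1 eqxx expr1.
by rewrite (_ : 1 + _ = 0) ?tbasis0 //; apply/val_inj; rewrite /= add1n modnn.
Qed.

Lemma C_xX (i : 'Z_n) : C_x ^+ i = tbasis C_cocycle i.
Proof. by case: C_pow. Qed.

Lemma C_rel : (1 < n)%N -> C_x ^+ n = eps%:A.
Proof. by move=> n1; have [_] := C_pow; rewrite Zp_cast. Qed.

Lemma C_universal (B : algType F) (x : B) : (1 < n)%N -> x ^+ n = eps%:A ->
  exists f : {lrmorphism twisted C_cocycle -> B},
    f C_x = x /\ forall g : {lrmorphism twisted C_cocycle -> B}, g C_x = x -> g =1 f.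
Proof.
move=> n1 xn; have [||f fE] := @twisted_lift _ _ C_cocycle B (fun i => x ^+ i).
- exact: expr0.
- by move=> i j; rewrite (@exprD_carry _ _ _ x eps) ?Zp_cast.
have fx : f C_x = x by rewrite fE -[RHS]expr1 /= modn_small.
exists f; split=> // g gx; apply: twisted_ext => t.
rewrite -C_xX; transitivity (x ^+ t); first by rewrite -gx; exact: rmorphXn.
by rewrite -fx; exact/esym/rmorphXn.
Qed.

End Cyclic.

Definition D_grp (k l : nat) : finZmodType :=
  FinRing.Zmodule.clone ('Z_(2 ^ k) * 'Z_(2 ^ l))%type _.

Section Quaternionic.
Variables (F : fieldType) (k l : nat) (mu nu : F).

Let ord_even m : ~~ odd (Zp_trunc (2 ^ m)).+2.
Proof.
case: m => [//|m]; rewrite Zp_cast ?oddX //.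
by rewrite -{1}(expn0 2) ltn_exp2l.
Qed.

(* u ^ i v ^ j u ^ i' v ^ j' = (-1) ^ (j i') u ^ (i + i') v ^ (j + j').       *)
Definition D_fun (s t : 'Z_(2 ^ k) * 'Z_(2 ^ l)) : F :=
  (-1) ^+ (s.2 * t.1)%N * mu ^+ carry s.1 t.1 * nu ^+ carry s.2 t.2.

Fact D_fun0l t : D_fun 0 t = 1.
Proof. by rewrite /D_fun !carry0l mul0n !mulr1. Qed.

Fact D_fun0r t : D_fun t 0 = 1.
Proof. by rewrite /D_fun !carry0r muln0 !mulr1. Qed.

Let sgnD m (i j : 'Z_(2 ^ m)) : odd (i + j)%R = odd i (+) odd j.
Proof. by rewrite -oddD (carryE i j) oddD oddM (negPf (ord_even m)) andbF addbF. Qed.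

Fact D_funA r s t : D_fun r s * D_fun (r + s) t = D_fun s t * D_fun r (s + t).
Proof.
have E1 := congr1 (fun m => mu ^+ m) (carryA r.1 s.1 t.1).
have E2 := congr1 (fun m => nu ^+ m) (carryA r.2 s.2 t.2).
have E3 : (-1) ^+ (r.2 * s.1)%N * (-1) ^+ ((r + s)%R.2 * t.1)%N =
    (-1) ^+ (s.2 * t.1)%N * (-1) ^+ (r.2 * (s + t)%R.1)%N :> F.
  rewrite -!exprD -signr_odd -[RHS]signr_odd !oddD !oddM !sgnD.
  by do 4![case: odd].
have mACA a b c a' b' c' :
    a * b * c * (a' * b' * c') = a * a' * (b * b') * (c * c') :> F.
  by rewrite mulrACA [a * b * _]mulrACA.
rewrite /D_fun !mACA; congr (_ * _ * _); first exact: E3.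
  by rewrite -!exprD; exact: E1.
by rewrite -!exprD; exact: E2.
Qed.

Definition D_cocycle :=
  @Cocycle F (D_grp k l) D_fun D_fun0l D_fun0r D_funA.

(* D(2^k, 2^l; mu, nu), for k, l > 0 only; u ^+ i * v ^+ j is                 *)
(* tbasis _ (i, j), see D_uvX, and D_rel, D_universal give the presentation.  *)
Definition gr_D : gralg F := gr_twisted D_cocycle.

Definition D_u : twisted D_cocycle := tbasis D_cocycle (1, 0).
Definition D_v : twisted D_cocycle := tbasis D_cocycle (0, 1).

Let D_powu : (forall i : 'Z_(2 ^ k), D_u ^+ i = tbasis D_cocycle (i, 0)) /\
  D_u ^+ (Zp_trunc (2 ^ k)).+2 = mu%:A.
Proof.
have [|i lti|hX ->] := @expr_ord _ _ D_u (fun i => tbasis D_cocycle (i, 0)).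
- exact: tbasis0.
- rewrite tbasisM /= /D_fun /= carry1 ?carry0l -val_eqE /= ltn_eqF //.
  by rewrite mul0n !mulr1 scale1r; congr tbasis; congr pair; rewrite addr0.
split=> //; rewrite tbasisM /= /D_fun /= carry1 ?carry0l eqxx mul0n mulr1 mul1r.
rewrite -tbasis0; congr (_ *: tbasis _ _); congr pair; rewrite ?addr0 //.
by apply/val_inj; rewrite /= add1n modnn.
Qed.

Let D_powv : (forall i : 'Z_(2 ^ l), D_v ^+ i = tbasis D_cocycle (0, i)) /\
  D_v ^+ (Zp_trunc (2 ^ l)).+2 = nu%:A.
Proof.
have [|i lti|hX ->] := @expr_ord _ _ D_v (fun i => tbasis D_cocycle (0, i)).
- exact: tbasis0.
- rewrite tbasisM /= /D_fun /= carry1 ?carry0l -val_eqE /= ltn_eqF //.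
  by rewrite muln0 !mulr1 scale1r; congr tbasis; congr pair; rewrite addr0.
split=> //; rewrite tbasisM /= /D_fun /= carry1 ?carry0l eqxx muln0 mulr1 mul1r.
rewrite -tbasis0; congr (_ *: tbasis _ _); congr pair; rewrite ?addr0 //.
by apply/val_inj; rewrite /= add1n modnn.
Qed.

Lemma D_uvX (i : 'Z_(2 ^ k)) (j : 'Z_(2 ^ l)) :
  D_u ^+ i * D_v ^+ j = tbasis D_cocycle (i, j).
Proof.
rewrite D_powu.1 D_powv.1 tbasisM /= /D_fun /= ?carry0l ?carry0r mul0n !mulr1 scale1r.
by congr tbasis; congr pair; rewrite ?addr0 ?add0r.
Qed.

Let exp2_gt1 m : (0 < m)%N -> (1 < 2 ^ m)%N.
Proof. by move=> m0; rewrite -{1}(expn0 2) ltn_exp2l. Qed.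

Lemma D_rel : (0 < k)%N -> (0 < l)%N ->
  [/\ D_u ^+ (2 ^ k) = mu%:A, D_v ^+ (2 ^ l) = nu%:A & D_u * D_v = - (D_v * D_u)].
Proof.
move=> k0 l0; have [_] := D_powu; have [_] := D_powv; rewrite !Zp_cast ?exp2_gt1 //.
move=> -> ->; split=> //.
rewrite !tbasisM /= /D_fun /= ?carry0l ?carry0r !modn_small // !mulr1 expr0 scale1r.
by rewrite expr1 scaleN1r opprK; congr tbasis; congr pair; rewrite ?addr0 ?add0r.
Qed.

Lemma D_universal (B : algType F) (u v : B) : (0 < k)%N -> (0 < l)%N ->
    u ^+ (2 ^ k) = mu%:A -> v ^+ (2 ^ l) = nu%:A -> u * v = - (v * u) ->
  exists f : {lrmorphism twisted D_cocycle -> B},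
    [/\ f D_u = u, f D_v = v
      & forall g : {lrmorphism twisted D_cocycle -> B},
          g D_u = u -> g D_v = v -> g =1 f].
Proof.
move=> k0 l0 uk vl uv.
have vu1 i : v * u ^+ i = (-1) ^+ i *: (u ^+ i * v).
  elim: i => [|i IH]; first by rewrite !expr0 mul1r mulr1 scale1r.
  rewrite [u ^+ _]exprSr mulrA IH -scalerAl.
  rewrite -[_ * v * u]mulrA -[v * u]opprK -uv mulrN scalerN.
  by rewrite mulrA [(-1) ^+ _.+1]exprS mulN1r scaleNr.
have vu i j : v ^+ j * u ^+ i = (-1) ^+ (j * i)%N *: (u ^+ i * v ^+ j).
  elim: j => [|j IH]; first by rewrite !expr0 mul1r mulr1 scale1r.
  rewrite exprS -mulrA IH -scalerAr [v * (u ^+ i * _)]mulrA vu1 -scalerAl scalerA.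
  by rewrite -[_ * v * _]mulrA -exprD addnC -mulSn.
have [||f fE] := @twisted_lift _ _ D_cocycle B (fun t => u ^+ t.1 * v ^+ t.2).
- by rewrite !expr0 mulr1.
- move=> s t; rewrite mulrA -[_ * _ * u ^+ _]mulrA vu -scalerAr -scalerAl.
  have -> : u ^+ s.1 * (u ^+ t.1 * v ^+ s.2) * v ^+ t.2 =
      (u ^+ s.1 * u ^+ t.1) * (v ^+ s.2 * v ^+ t.2) by rewrite !mulrA.
  rewrite (@exprD_carry _ _ _ u mu) ?Zp_cast ?exp2_gt1 //.
  rewrite (@exprD_carry _ _ _ v nu) ?Zp_cast ?exp2_gt1 //.
  by rewrite -scalerAl -scalerAr !scalerA.
have fu : f D_u = u by rewrite fE /= modn_small // expr1 expr0 mulr1.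
have fv : f D_v = v by rewrite fE /= modn_small // expr1 expr0 mul1r.
exists f; split=> // g gu gv; apply: twisted_ext => -[i j].
have hom (h : {lrmorphism twisted D_cocycle -> B}) : h D_u = u -> h D_v = v ->
    h (tbasis D_cocycle (i, j)) = u ^+ i * v ^+ j.
  move=> <- <-; rewrite -D_uvX; transitivity (h (D_u ^+ i) * h (D_v ^+ j)).
    exact: rmorphM.
  by congr (_ * _); exact: rmorphXn.
by rewrite (hom g) ?(hom f).
Qed.

End Quaternionic.

(* The quaternion algebra is D(2, 2; -1, -1) with its own grading forgotten.  *)
Definition gr_H (F : fieldType) : gralg F := gr_trivial (gr_alg (gr_D 1 1 (-1 : F) (-1))).

Definition gr_H4 (F : fieldType) : gralg F := gr_D 1 1 (-1) (-1).

(* (k, l, b, b') stands for (k, l; mu, nu) with mu = (-1) ^ b, nu = (-1) ^ b'; *)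
(* so "true" is the sign -1.                                                  *)
Definition quadruple : Type := (nat * nat * bool * bool)%type.

Definition is_characteristic (chi : seq quadruple) : bool :=
  all (fun q => let: (k, l, _, _) := q in (1 <= k <= l)%N) chi.

Definition num_minus (chi : seq quadruple) : nat :=
  (\sum_(q <- chi) let: (_, _, b, b') := q in b + b')%N.

Definition special (q : quadruple) : bool :=
  q \in [:: (1, 1, true, false); (1, 1, false, true)]%N.

(* When there is exactly one -1, it lies in every special quadruple.          *)
Definition even_chi (chi : seq quadruple) : bool :=
  is_characteristic chi &&
  ((num_minus chi == 0%N) || (num_minus chi == 1%N) && has special chi).

Definition odd_chi (chi : seq quadruple) : bool :=
  [&& is_characteristic chi, num_minus chi == 1%N & ~~ has special chi].

Inductive same_chi : seq quadruple -> seq quadruple -> Prop :=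
| same_perm chi chi' : perm_eq chi chi' -> same_chi chi chi'
| same_swap k chi :
    same_chi ((k, k, false, true) :: chi) ((k, k, true, false) :: chi)
| same_special q chi :
    special q -> same_chi (q :: chi) ((1, 1, false, false)%N :: chi)
| same_sym chi chi' : same_chi chi chi' -> same_chi chi' chi
| same_trans chi1 chi2 chi3 :
    same_chi chi1 chi2 -> same_chi chi2 chi3 -> same_chi chi1 chi3.

Definition gr_quadruple (F : fieldType) (q : quadruple) : gralg F :=
  let: (k, l, b, b') := q in gr_D k l ((-1) ^+ b) ((-1) ^+ b').

Fixpoint gr_chi (F : fieldType) (chi : seq quadruple) : gralg F :=
  match chi with
  | [::] => gr_trivial F^o
  | [:: q] => gr_quadruple F q
  | q :: chi' => gr_tens (gr_quadruple F q) (gr_chi F chi')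
  end.

Inductive item : Type :=
| Item1 of seq quadruple & finZmodType
| Item2 of nat & seq quadruple & finZmodType
| Item3 of seq quadruple & finZmodType.

Definition item_ok (p : item) : bool :=
  match p with
  | Item1 chi _ => even_chi chi || odd_chi chi
  | Item2 m chi _ => (1 <= m)%N && even_chi chi
  | Item3 chi _ => even_chi chi
  end.

Local Notation "X '(x)' Y" := (gr_tens X Y) (at level 40, left associativity).

Definition item_alg (F : fieldType) (p : item) : gralg F :=
  match p with
  | Item1 chi G => gr_H F (x) gr_chi F chi (x) gr_grpalg F G
  | Item2 m chi G =>
      gr_H F (x) gr_C (2 ^ m) (-1) (x) gr_chi F chi (x) gr_grpalg F G
  | Item3 chi G => gr_H F (x) gr_H4 F (x) gr_chi F chi (x) gr_grpalg F G
  end.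

Definition zmod_iso (G G' : zmodType) : Prop :=
  exists f : {additive G -> G'}, bijective f.

Definition same_item (p p' : item) : Prop :=
  match p, p' with
  | Item1 chi G, Item1 chi' G' => same_chi chi chi' /\ zmod_iso G G'
  | Item2 m chi G, Item2 m' chi' G' =>
      [/\ m = m', same_chi chi chi' & zmod_iso G G']
  | Item3 chi G, Item3 chi' G' => same_chi chi chi' /\ zmod_iso G G'
  | _, _ => False
  end.

(* Main.v *)
Require Import Defs.
From HB Require Import structures.
From mathcomp Require Import all_boot all_order all_algebra all_fingroup all_field.
From mathcomp Require Import reals.
From mathcomp Require Import cyclic nilpotent abelian complex ring.

Set Implicit Arguments.
Unset Strict Implicit.
Unset Printing Implicit Defensive.

Import Order.TTheory GRing.Theory Num.Theory.
Local Open Scope ring_scope.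

(** Reduction to signs. The identity component is a division algebra of
    dimension 4 over a real closed field, hence the quaternions H
    (division_quaternions). Every component contains a nonzero x_g that commutes
    with H (exists_central), the component is H x_g, and x_g is unique up to a
    real factor because the centre of H is the field of scalars. If the factor
    is chosen so that x_g ^ n = 1 or -1, where n is the order of the group, then
    x_s x_t = c(s, t) x_(s + t) with c(s, t) = 1 or -1 (graded_model). So the
    graded algebra is H tensored with the group algebra twisted by a cocycle c
    with values in the signs; such a c on a finite abelian group is called a
    twist below.

    Two functions describe a twist: beta(s, t) = c(s, t) c(t, s), a
    bimultiplicative commutation sign, and mu(t) = c(t, t), the sign of the
    square of x_t, where t runs through the elements with 2 t = 0. From here on
    signs are written additively, so that 1 stands for -1 in statements on the
    values of beta and mu. Both are invariants of the graded algebra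
    (model_unique), and they determine it (model_qiso): the quotient of two
    cocycles with the same beta and mu is symmetric, so it describes an abelian
    extension E of the group by {1, z}; equality of mu says that z is not a
    square in E, hence some character of E with values in the signs is
    nontrivial at z, and this exhibits the quotient as a coboundary
    (sym_coboundary). The theorem therefore becomes a statement on triples (T,
    beta, mu), where the algebras of the list correspond to orthogonal sums of
    explicit small triples.

    Existence (twist_normalizable). Summands are split off by induction on the
    order of T. The tool is that a homomorphism from a subgroup B of T to Z/N
    extends to T if it vanishes on the intersection of B and N T (char_ext): a
    complement of the subgroup generated by g, h is the common kernel of
    homomorphisms phi, psi to Z/2^k, Z/2^l which reduce modulo 2 to beta(-, h)
    and beta(g, -) (split_D). If mu vanishes, one takes for g, h noncommuting
    elements of the least possible 2-power orders, and only factors D(2^k, 2^l;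
    1, 1) and a group algebra arise (plus_normal_form). In general, a hyperbolic
    plane in the 2-torsion is split off first as D(2, 2; 1, 1). If there is none
    but the 2-torsion does not commute, then mu is 1 exactly off the radical of
    the 2-torsion, one plane is H^(4), and mu vanishes on its complement. If the
    2-torsion commutes, mu is a character on it; if this character is
    nontrivial, take the largest m with mu(2^m t) = 1 for some t of order
    2^(m+1). If such a t can be chosen central it generates a factor C(2^(m+1);
    -1) whose complement, the kernel of an extension of mu, has trivial mu.
    Otherwise y -> mu(2^m y) is a commutation y -> beta(y, s) on the elements of
    order dividing 2^(m+1), by duality (comm_dual), and an s of least order and
    a suitable t span the only factor with a minus sign.

    Uniqueness (tw_item_inj). Exponential sums of beta and mu over torsion
    subgroups are multiplicative for orthogonal sums. Those of beta alone give
    the ranks of beta between torsion subgroups, and second differences of these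
    ranks count the factors D(2^k, 2^l; -, -). Those involving mu separate the
    three items, give m, and give the orders of the generator with the minus
    sign and of its partner. The group G is recovered from the sizes of its
    torsion subgroups. *)

(** * Sign cocycles on finite abelian groups *)

(** A cocycle with values in the signs, written additively: true stands for -1.
    It is the same as a central extension of the group by a group of order two.
    *)
Record twist := Twist {
  tw_grp :> finZmodType;
  tw_sgn : tw_grp -> tw_grp -> bool;
  tw_sgn00 : tw_sgn 0 0 = false;
  tw_sgnA : forall r s t,
    tw_sgn r s (+) tw_sgn (r + s) t = tw_sgn s t (+) tw_sgn r (s + t) }.

(** Lifts of x and y to the central extension commute up to this sign. *)
Definition comm (S : twist) (x y : S) : bool := tw_sgn x y (+) tw_sgn y x.
(** The square of a lift of x; it only matters for x *+ 2 = 0, and then it does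
    not depend on the lift. *)
Definition sq (S : twist) (x : S) : bool := tw_sgn x x.
Arguments comm {S} x y : simpl never.
Arguments sq {S} x : simpl never.

Section TwistTheory.
Variable S : twist.
Implicit Types x y z : S.

Lemma tw_sgn0l x : tw_sgn 0 x = false.
Proof. by have := tw_sgnA 0 0 x; rewrite !add0r tw_sgn00; case: tw_sgn. Qed.

Lemma tw_sgn0r x : tw_sgn x 0 = false.
Proof. by have := tw_sgnA x 0 0; rewrite !addr0 tw_sgn00; case: tw_sgn. Qed.

Lemma commC x y : comm x y = comm y x.
Proof. exact: addbC. Qed.

Lemma commxx x : comm x x = false.
Proof. exact: addbb. Qed.

Lemma comm0l x : comm 0 x = false.
Proof. by rewrite /comm tw_sgn0l tw_sgn0r. Qed.

Lemma commDl x y z : comm (x + y) z = comm x z (+) comm y z.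
Proof.
have := tw_sgnA x y z; have := tw_sgnA x z y; have := tw_sgnA z x y.
rewrite /comm [y + z]addrC [z + x]addrC.
by do 9![case: tw_sgn].
Qed.

Lemma commDr x y z : comm x (y + z) = comm x y (+) comm x z.
Proof. by rewrite !(commC x) commDl. Qed.

Lemma comm0r x : comm x 0 = false.
Proof. by rewrite commC comm0l. Qed.

Lemma commMnl x y n : comm (x *+ n) y = odd n && comm x y.
Proof.
elim: n => [|n IH]; first by rewrite mulr0n comm0l.
by rewrite mulrS commDl IH /=; case: odd; case: comm.
Qed.

Lemma commMnr x y n : comm x (y *+ n) = odd n && comm x y.
Proof. by rewrite commC commMnl commC. Qed.

Lemma commNl x y : comm (- x) y = comm x y.
Proof.
have: comm (- x + x) y = false by rewrite addNr comm0l.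
by rewrite commDl; case: comm; case: comm.
Qed.

(** The quadratic form property of mu: (u v) (u v) = (u u) (v v) [v, u] in the
    central extension. *)
Lemma sqD x y : x *+ 2 = 0 -> y *+ 2 = 0 ->
  sq (x + y) = sq x (+) sq y (+) comm x y.
Proof.
rewrite !mulr2n => x2 y2.
have := tw_sgnA x y (x + y); have := tw_sgnA y y x.
rewrite [y + (x + y)]addrCA y2 addr0 tw_sgn0l [y + x]addrC.
rewrite /sq /comm; by do 6![case: tw_sgn].
Qed.

Lemma sq0 : sq (0 : S) = false.
Proof. exact: tw_sgn00. Qed.

End TwistTheory.

(** Isomorphism of the data (T, beta, mu). The cocycle itself is not compared,
    so that cohomologous cocycles are identified. *)
Definition qiso (S S' : twist) : Prop :=
  exists f : {additive S -> S'}, [/\ bijective f,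
    forall x y, comm (f x) (f y) = comm x y
  & forall x, x *+ 2 = 0 -> sq (f x) = sq x].

Lemma additive_of (U V : zmodType) (f : U -> V) :
  {morph f : x y / x + y} -> exists g : {additive U -> V}, g =1 f.
Proof.
move=> fD; have f0 : f 0 = 0.
  by apply: (addrI (f 0)); rewrite -fD !addr0.
have fB : {morph f : x y / x - y}.
  by move=> x y /=; apply: (addIr (f y)); rewrite -fD !subrK.
exists (HB.pack f (GRing.isZmodMorphism.Build U V f fB) : {additive U -> V}).
by [].
Qed.

Lemma bij_eq1 (U V : Type) (f g : U -> V) : bijective f -> f =1 g -> bijective g.
Proof. by move=> fb fg; apply: eq_bij fb _ fg. Qed.

Lemma qisoI (S S' : twist) (f : S -> S') :
    {morph f : x y / x + y} -> bijective f ->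
    (forall x y, comm (f x) (f y) = comm x y) ->
    (forall x, x *+ 2 = 0 -> sq (f x) = sq x) -> qiso S S'.
Proof.
move=> fD fb fc fs; have [g gf] := additive_of fD.
exists g; split=> [|x y|x x2]; rewrite ?gf; auto.
exact: bij_eq1 fb (fsym gf).
Qed.

Lemma qiso_refl S : qiso S S.
Proof. by apply: (@qisoI S S id) => //; exists id. Qed.

Lemma qiso_sym S S' : qiso S S' -> qiso S' S.
Proof.
move=> [f [[g fK gK] fc fs]]; apply: (@qisoI _ _ g).
- by move=> x y; apply: (can_inj fK); rewrite raddfD !gK.
- by exists f.
- by move=> x y; rewrite -fc !gK.
- move=> x x2; rewrite -fs ?gK //; apply: (can_inj fK).
  by rewrite raddfMn gK raddf0.
Qed.

Lemma qiso_trans S2 S1 S3 : qiso S1 S2 -> qiso S2 S3 -> qiso S1 S3.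
Proof.
move=> [f [fb fc fs]] [g [gb gc gs]]; apply: (@qisoI _ _ (g \o f)).
- by move=> x y /=; rewrite !raddfD.
- exact: bij_comp.
- by move=> x y; rewrite /= gc fc.
- by move=> x x2; rewrite /= gs ?fs // -raddfMn x2 raddf0.
Qed.

Section Prod.
Variables S1 S2 : twist.

Definition prod_grp : finZmodType := FinRing.Zmodule.clone (S1 * S2)%type _.
Definition prod_sgn (x y : S1 * S2) : bool :=
  tw_sgn x.1 y.1 (+) tw_sgn x.2 y.2.

Fact prod_sgn00 : prod_sgn 0 0 = false.
Proof. by rewrite /prod_sgn !tw_sgn00. Qed.

Fact prod_sgnA r s t :
  prod_sgn r s (+) prod_sgn (r + s) t = prod_sgn s t (+) prod_sgn r (s + t).
Proof.
have := tw_sgnA r.1 s.1 t.1; have := tw_sgnA r.2 s.2 t.2.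
by rewrite /prod_sgn /=; do 8![case: tw_sgn].
Qed.

Definition tw_prod : twist := @Twist prod_grp prod_sgn prod_sgn00 prod_sgnA.

Lemma comm_prod (x y : tw_prod) : comm x y = comm x.1 y.1 (+) comm x.2 y.2.
Proof. by rewrite /comm /= /prod_sgn; do 4![case: tw_sgn]. Qed.

Lemma sq_prod (x : tw_prod) : sq x = sq x.1 (+) sq x.2.
Proof. by []. Qed.

End Prod.

Lemma prod_mulrn (U V : zmodType) (x : U * V) n : x *+ n = (x.1 *+ n, x.2 *+ n).
Proof. by elim: n => [|n IH]; rewrite ?mulr0n // !mulrS IH. Qed.

Definition tw_triv (G : finZmodType) : twist :=
  @Twist G (fun _ _ => false) erefl (fun _ _ _ => erefl).

Lemma tw_prod_iso S1 S1' S2 S2' : qiso S1 S1' -> qiso S2 S2' ->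
  qiso (tw_prod S1 S2) (tw_prod S1' S2').
Proof.
move=> [f [[f' fK f'K] fc fs]] [g [[g' gK g'K] gc gs]].
apply: (@qisoI (tw_prod S1 S2) (tw_prod S1' S2') (fun x => (f x.1, g x.2))).
- by move=> x y; congr pair; rewrite /= raddfD.
- by exists (fun x => (f' x.1, g' x.2)) => -[x y] /=; rewrite ?fK ?gK ?f'K ?g'K.
- by move=> x y; rewrite !comm_prod fc gc.
- by move=> x; rewrite prod_mulrn => -[x2 y2]; rewrite !sq_prod fs ?gs.
Qed.

Lemma tw_prodA S1 S2 S3 :
  qiso (tw_prod S1 (tw_prod S2 S3)) (tw_prod (tw_prod S1 S2) S3).
Proof.
apply: (@qisoI (tw_prod S1 (tw_prod S2 S3)) (tw_prod (tw_prod S1 S2) S3)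
  (fun x => ((x.1, x.2.1), x.2.2))) => //.
- by exists (fun x => (x.1.1, (x.1.2, x.2))) => [[x [y z]]|[[x y] z]].
- by move=> x y; rewrite !comm_prod addbA.
- by move=> x _; rewrite !sq_prod addbA.
Qed.

Lemma tw_prodC S1 S2 : qiso (tw_prod S1 S2) (tw_prod S2 S1).
Proof.
apply: (@qisoI (tw_prod S1 S2) (tw_prod S2 S1) (fun x => (x.2, x.1))) => //.
- by exists (fun x => (x.2, x.1)) => -[].
- by move=> x y; rewrite !comm_prod addbC.
- by move=> x _; rewrite !sq_prod addbC.
Qed.

Notation tw1 := (tw_triv 'I_1).

Lemma tw_prod1 S : qiso (tw_prod tw1 S) S.
Proof.
apply: (@qisoI (tw_prod tw1 S) S (fun x => x.2)) => //.
by exists (fun x => (0, x)) => [[x y]|//]; rewrite [x]ord1.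
Qed.

Section Kernel.
Variables (T P : finZmodType) (q : {additive T -> P}).

Definition ker_pred := [pred x : T | q x == 0].
Fact ker_zmod_closed : zmod_closed ker_pred.
Proof.
split=> [|x y]; rewrite !inE ?raddf0 // raddfB => /eqP-> /eqP->.
by rewrite subr0.
Qed.
HB.instance Definition _ := GRing.isZmodClosed.Build T ker_pred ker_zmod_closed.

Record ker := Ker { ker_val : T; _ : ker_val \in ker_pred }.
HB.instance Definition _ := [isSub for ker_val].
HB.instance Definition _ := [Finite of ker by <:].
HB.instance Definition _ := [SubChoice_isSubZmodule of ker by <:].

Lemma ker_valP (x : ker) : q (ker_val x) = 0.
Proof. by case: x => x /= /eqP. Qed.

End Kernel.

Lemma ker_valD (T P : finZmodType) (q : {additive T -> P}) :
  {morph @ker_val T P q : x y / x + y}.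
Proof. exact: (raddfD (val : ker q -> T)). Qed.

Lemma ker_valMn (T P : finZmodType) (q : {additive T -> P}) (x : ker q) n :
  ker_val (x *+ n) = ker_val x *+ n.
Proof. exact: (raddfMn (val : ker q -> T)). Qed.

Section KerTwist.
Variables (S : twist) (P : finZmodType) (q : {additive S -> P}).
Definition ker_grp : finZmodType := FinRing.Zmodule.clone (ker q) _.
Fact ker_sgnA (r s t : ker q) : 
  tw_sgn (ker_val r) (ker_val s) (+) tw_sgn (ker_val (r + s)) (ker_val t) =
  tw_sgn (ker_val s) (ker_val t) (+) tw_sgn (ker_val r) (ker_val (s + t)).
Proof. by rewrite !ker_valD tw_sgnA. Qed.
Definition tw_ker : twist := @Twist ker_grp
  (fun x y => tw_sgn (ker_val x) (ker_val y)) (tw_sgn00 S) ker_sgnA.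
End KerTwist.

(** When q \o p is injective it permutes the finite group P, so T is the sum of
    the image of p and of the kernel of q. Surjectivity is obtained by counting:
    T embeds into P * ker q. *)
Lemma split_bij (T P : finZmodType) (p : P -> T) (q : {additive T -> P}) :
    {morph p : x y / x + y} -> (forall x, q (p x) = 0 -> x = 0) ->
  bijective (fun z : P * ker q => p z.1 + ker_val z.2).
Proof.
move=> pD qpI; have [p' p'E] := additive_of pD.
have inj : injective (q \o p').
  apply: raddf_inj => x /=; rewrite p'E; exact: qpI.
have [r rK Kr] := injF_bij inj.
apply: inj_card_bij.
  move=> [x y] [x' y'] /= E; have xx : x = x'.
    apply: inj; move/(congr1 q): E; rewrite /= !p'E !raddfD.
    by rewrite !ker_valP !addr0.
  move: E; rewrite xx => /addrI E; congr pair; exact: val_inj.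
pose F (t : T) : P * ker q :=
  (r (q t), insubd (0 : ker q) (t - p' (r (q t)))).
have Fi : injective F.
  have h t : ker_val (F t).2 = t - p' (r (q t)).
    rewrite /F /= insubdK // inE raddfB subr_eq0 eq_sym; apply/eqP.
    exact: Kr.
  move=> t t' E; have e1 := congr1 fst E; have e2 := congr1 (fun z => ker_val z.2) E.
  by move: e2; rewrite !h; rewrite /F /= in e1; rewrite e1 => /addIr.
exact: leq_card Fi.
Qed.

(** * Extension of homomorphisms to cyclic groups *)

Section CharExt.
Variables (T : finZmodType) (N : nat).
Hypothesis N1 : (1 < N)%N.
Implicit Types G : {set T * 'Z_N}.

Let ker0 G := [forall a, ((0, a) \in G) ==> (a == 0)].
Let closed G := (0 \in G) && [forall z in G, forall z' in G, z - z' \in G].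

Let closedP G : reflect (0 \in G /\ forall z z', z \in G -> z' \in G -> z - z' \in G) (closed G).
Proof.
apply: (iffP andP) => -[-> GB]; split=> //.
  by move=> z z' zG z'G; move/forall_inP: GB => /(_ z zG)/forall_inP/(_ z' z'G).
by apply/forall_inP => z zG; apply/forall_inP => z' z'G; apply: GB.
Qed.

Let ZpN (a : 'Z_N) : a *+ N = 0.
Proof. by rewrite -mulr_natr pchar_Zp ?mulr0. Qed.

Let mulrnE (a : 'Z_N) n : (a *+ n)%N = ((a * n) %% N)%N :> nat.
Proof.
by rewrite Zp_mulrn /= [X in (_ %% X)%N]Zp_cast.
Qed.

(** The group Z/N is injective among the abelian groups of exponent N. A
    homomorphism on a subgroup is given by its graph, a subgroup G of T * Z/N,
    and the hypothesis says that it vanishes on the multiples of N. After these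
    have been adjoined, a maximal subgroup that contains G and meets 0 * Z/N
    trivially is the graph of a homomorphism on T. *)
Lemma char_ext G : 0 \in G -> (forall z z', z \in G -> z' \in G -> z - z' \in G) ->
    (forall t a, (t *+ N, a) \in G -> a = 0) ->
  exists phi : {additive T -> 'Z_N}, forall z, z \in G -> phi z.1 = z.2.
Proof.
move=> G0 GB GN.
pose G1 := [set z.1 + (z.2 *+ N, 0) | z in setX G [set: T]].
have G1P z : reflect (exists2 y, y \in G & exists t, z = y + (t *+ N, 0)) (z \in G1).
  apply: (iffP imsetP) => [[[y t]]|[y yG [t ->]]].
    by rewrite inE => /andP[/= yG _] ->; exists y => //; exists t.
  by exists (y, t); rewrite ?inE ?yG.
have cG1 : closed G1.
  apply/closedP; split.
    by apply/G1P; exists 0 => //; exists 0; rewrite mul0rn addr0.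
  move=> z z' /G1P[y yG [t ->]] /G1P[y' yG' [t' ->]].
  apply/G1P; exists (y - y'); first exact: GB.
  exists (t - t'); rewrite mulrnBl opprD addrACA; congr (_ + _).
  by congr pair; rewrite subr0.
have kG1 : ker0 G1.
  apply/forallP => a; apply/implyP => /G1P[[x b] yG [t [/= xt ->]]].
  rewrite addr0; apply/eqP; apply: (GN (- t)).
  by rewrite mulNrn; move/eqP: xt; rewrite eq_sym addr_eq0 => /eqP <-.
pose good G := closed G && ker0 G.
(* A maximal subgroup above the graph that still meets 0 * Z/N trivially. *)
have [H /maxsetP[/andP[/closedP[H0 HB] kH] Hmax] G1H] :
  {H | maxset good H & G1 \subset H} by apply: maxset_exists; rewrite /good cG1.
have HN z : z \in H -> - z \in H by move=> zH; rewrite -sub0r HB.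
have HD z z' : z \in H -> z' \in H -> z + z' \in H.
  by move=> zH z'H; rewrite -[z']opprK HB ?HN.
have HM z n : z \in H -> z *+ n \in H.
  by move=> zH; elim: n => [|n IH]; rewrite ?mulr0n // mulrS HD.
have NH t : (t *+ N, 0) \in H.
  by apply: (subsetP G1H); apply/G1P; exists 0 => //; exists t; rewrite add0r.
have kH0 a : (0, a) \in H -> a = 0 by move=> h; apply/eqP; apply: implyP (forallP kH a) h.
have Htot x : exists a, (x, a) \in H.
  have exn : exists n, (0 < n)%N && [exists a, (x *+ n, a) \in H].
    by exists N; rewrite ltnW //=; apply/existsP; exists 0.
  case: (ex_minnP exn) => n /andP[n0 /existsP[a xna]] nmin.
  have ndvd m b : (x *+ m, b) \in H -> (n %| m)%N.
    move=> xmb; rewrite /dvdn; apply/negPn/negP; rewrite -lt0n => mn0.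
    have := ltn_pmod m n0; rewrite ltnNge => /negP[]; apply: nmin.
    rewrite mn0; apply/existsP; exists (b - a *+ (m %/ n)).
    have := HB _ _ xmb (HM _ (m %/ n)%N xna).
    rewrite prod_mulrn /= => h; congr (_ \in H): h; congr pair.
    rewrite {1}(divn_eq m n) mulrnDr -mulrnA [(_ * n)%N]mulnC.
    by rewrite addrC addKr.
  have nN := ndvd _ _ (NH x).
  have aN : a *+ (N %/ n) = 0.
    apply: kH0; have := HB _ _ (HM _ (N %/ n)%N xna) (NH x).
    rewrite prod_mulrn /= -mulrnA mulnC divnK // => h.
    by congr (_ \in H): h; congr pair; rewrite ?subrr ?subr0.
  have na : (n %| a)%N.
    move/(congr1 (@nat_of_ord _)): aN; rewrite mulrnE /= => /eqP.
    have Ngt : (0 < N %/ n)%N by rewrite divn_gt0 // dvdn_leq // ltnW.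
    rewrite -[X in (_ %% X)%N](divnK nN) mulnC -/(dvdn _ _).
    by rewrite dvdn_pmul2l.
  (* The value a at x *+ n is divisible by n, as n divides N and (N / n) a = 0;
     its quotient d is the value at x. *)
  pose d : 'Z_N := (a %/ n)%:R.
  have dn : d *+ n = a.
    by rewrite -[_ *+ n]mulr_natr -natrM divnK // natr_Zp.
  pose w : T * 'Z_N := (x, d).
  have wn : w *+ n \in H by rewrite prod_mulrn dn.
  have wN : w *+ N \in H by rewrite prod_mulrn ZpN NH.
  pose K := [set z | [exists i : 'I_N, z - w *+ i \in H]].
  have KP z : reflect (exists m, z - w *+ m \in H) (z \in K).
    rewrite inE; apply: (iffP existsP) => -[m zm]; first by exists m.
    have mN : (m %% N < N)%N by rewrite ltn_mod ltnW.
    exists (Ordinal mN) => /=.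
    have -> : z - w *+ (m %% N) = z - w *+ m + w *+ N *+ (m %/ N).
      rewrite {2}(divn_eq m N) mulrnDr -mulrnA [(N * _)%N]mulnC opprD.
      by rewrite -[RHS]addrA; congr (_ + _); rewrite addrAC addNr add0r.
    exact: HD _ _ zm (HM _ (m %/ N)%N wN).
  have HK : H \subset K.
    by apply/subsetP => z zH; apply/KP; exists 0; rewrite mulr0n subr0.
  have gK : good K.
    apply/andP; split.
      apply/closedP; split; first exact: subsetP HK _ H0.
      move=> z z' /KP[m zm] /KP[m' zm']; apply/KP; exists (m + m' * N.-1)%N.
      have -> : z - z' - w *+ (m + m' * N.-1) = z - w *+ m - (z' - w *+ m') - w *+ N *+ m'.
        rewrite -mulrnA; have -> : (N * m' = m' * N.-1 + m')%N by rewrite -mulnSr prednK ?(ltnW N1) // mulnC.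
        rewrite !mulrnDr !opprD !opprK.
        rewrite -!addrA; congr (_ + _); rewrite [RHS]addrCA; congr (_ + _).
        by congr (_ + _); rewrite addrCA subrr addr0.
      exact: HB _ _ (HB _ _ zm zm') (HM _ m' wN).
    apply/forallP => b; apply/implyP => /KP[m bm]; apply/eqP.
    have xm : (x *+ m, d *+ m - b) \in H.
      have -> : (x *+ m, d *+ m - b) = - ((0, b) - w *+ m).
        by rewrite opprB prod_mulrn; congr pair; rewrite subr0.
      exact: HN.
    have /dvdnP[e me] := ndvd _ _ xm.
    have := HD _ _ bm (HM _ e wn); rewrite -mulrnA mulnC -me addrNK.
    exact: kH0.
  have KE := Hmax K gK HK; exists d; rewrite -KE; apply/KP; exists 1%N.
  by rewrite mulr1n subrr.
pose f x := xchoose (Htot x).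
have fH x : (x, f x) \in H by exact: (xchooseP (Htot x)).
have fu x a : (x, a) \in H -> f x = a.
  move=> xa; apply/eqP; rewrite -subr_eq0; apply/eqP; apply: kH0.
  by have := HB _ _ (fH x) xa => h; congr (_ \in H): h; congr pair; rewrite subrr.
have [phi phiE] : exists g : {additive T -> 'Z_N}, g =1 f.
  apply: additive_of => x y; apply: fu; exact: (HD _ _ (fH x) (fH y)).
exists phi => -[x a] xa; rewrite phiE; apply: fu; apply: (subsetP G1H).
by apply/G1P; exists (x, a) => //; exists 0; rewrite mul0rn addr0.
Qed.

End CharExt.

(** * Cyclic 2-groups, lifting and duality *)

Lemma exp2_gt1 k : (1 < 2 ^ k.+1)%N.
Proof. by rewrite -{1}(expn0 2) ltn_exp2l. Qed.

Section Z2.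
Variable k : nat.
Notation Z := 'Z_(2 ^ k.+1).
Implicit Types a b : Z.

Lemma Z2_card : (Zp_trunc (2 ^ k.+1)).+2 = (2 ^ k.+1)%N.
Proof. exact: Zp_cast (exp2_gt1 k). Qed.

Lemma Z2_val_nat n : (n%:R : Z) = (n %% 2 ^ k.+1)%N :> nat.
Proof. by rewrite val_Zp_nat // exp2_gt1. Qed.

Lemma Z2_valD a b : (a + b)%R = ((a + b) %% 2 ^ k.+1)%N :> nat.
Proof. by rewrite /= [X in (_ %% X)%N]Z2_card. Qed.

Lemma Z2_valMn a n : (a *+ n)%R = ((a * n) %% 2 ^ k.+1)%N :> nat.
Proof. by rewrite Zp_mulrn /= [X in (_ %% X)%N]Z2_card. Qed.

Lemma odd_mod2X n : odd (n %% 2 ^ k.+1) = odd n.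
Proof. by rewrite {2}(divn_eq n (2 ^ k.+1)) oddD oddM oddX andbF. Qed.

Lemma Z2_odd_nat n : odd (n%:R : Z) = odd n.
Proof. by rewrite Z2_val_nat odd_mod2X. Qed.

Lemma Z2_oddD a b : odd (a + b)%R = odd a (+) odd b.
Proof. by rewrite Z2_valD odd_mod2X oddD. Qed.

Lemma Z2_oddMn a n : odd (a *+ n)%R = odd n && odd a.
Proof. by rewrite Z2_valMn odd_mod2X oddM andbC. Qed.

Lemma Z2_exp a : a *+ (2 ^ k.+1) = 0.
Proof. by apply/ord_inj; rewrite Z2_valMn modnMl. Qed.

Definition Z2half : Z := (2 ^ k)%:R.

Lemma Z2half_val : Z2half = (2 ^ k)%N :> nat.
Proof. by rewrite Z2_val_nat modn_small // ltn_exp2l. Qed.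

Lemma Z2half_neq0 : Z2half != 0.
Proof. apply/eqP => E; have := Z2half_val; rewrite E => /esym/eqP.
by rewrite expn_eq0. Qed.

Lemma Z2_mul_half a : a *+ (2 ^ k) = Z2half *+ odd a.
Proof.
apply/ord_inj; rewrite [LHS]Z2_valMn [RHS]Z2_valMn Z2half_val.
rewrite -{1}(odd_double_half a) mulnDl -muln2 -mulnA -expnS addnC modnMDl.
by rewrite mulnC.
Qed.

Lemma Z2_half2 : Z2half *+ 2 = 0.
Proof. by apply/ord_inj; rewrite Z2_valMn Z2half_val -expnSr modnn. Qed.

Lemma Z2_tors2 a : a *+ 2 = 0 -> a = Z2half *+ (a != 0).
Proof.
move=> /(congr1 (@nat_of_ord _)); rewrite Z2_valMn /= => /eqP.
rewrite -/(dvdn _ _) [X in (X %| _)%N]expnSr dvdn_pmul2r // => /dvdnP[c ac].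
apply/ord_inj; rewrite Z2_valMn Z2half_val -val_eqE /= ac.
have := ltn_ord a; rewrite [X in (_ < X)%N]Z2_card ac [X in (_ < X)%N]expnS.
rewrite ltn_pmul2r ?expn_gt0 // => {ac}; move: (c) => [|[|//]] _.
  by rewrite mul0n muln0 mod0n.
by rewrite mul1n -lt0n expn_gt0 muln1 modn_small // ltn_exp2l.
Qed.

Lemma Z2_odd_tors2 a : a *+ 2 = 0 -> odd a = (k == 0)%N && (a != 0).
Proof.
move=> /Z2_tors2 {1}->; rewrite Z2_oddMn Z2_odd_nat oddX orbF.
by case: (a != 0); rewrite ?andbT ?andbF.
Qed.

Lemma Z2half_inj (b b' : bool) : Z2half *+ b = Z2half *+ b' -> b = b'.
Proof.
by case: b b' => -[] //; rewrite mulr1n mulr0n => /eqP;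
  rewrite ?[0 == _]eq_sym (negPf Z2half_neq0).
Qed.

Lemma Z2half_add (b b' : bool) : Z2half *+ b + Z2half *+ b' = Z2half *+ (b (+) b').
Proof.
by case: b b' => -[]; rewrite ?mulr1n ?mulr0n ?addr0 ?add0r // -mulr2n Z2_half2.
Qed.

End Z2.

Arguments Z2half {k}.

(** A homomorphism f to Z/2 that vanishes on the 2^k-torsion lifts to Z/2^(k+1):
    extend the homomorphism 2^k x -> 2^k f(x) from 2^k T to T. *)
Lemma char_lift (T : finZmodType) k (f : T -> bool) :
    {morph f : x y / x + y >-> x (+) y} ->
    (forall x, x *+ (2 ^ k) = 0 -> f x = false) ->
  exists phi : {additive T -> 'Z_(2 ^ k.+1)}, forall x, odd (phi x) = f x.
Proof.
move=> fD fk.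
pose G := [set (x *+ (2 ^ k), Z2half *+ f x) | x : T] : {set T * 'Z_(2 ^ k.+1)}.
have f0 : f 0 = false by have := fD 0 0; rewrite addr0; case: (f 0).
have fN x : f (- x) = f x.
  by have := fD x (- x); rewrite subrr f0; case: (f x); case: (f _).
have f2 n x : f (x *+ n) = odd n && f x.
  elim: n => [|n IH]; first by rewrite mulr0n.
  by rewrite mulrS fD IH /=; case: (odd n); case: (f x).
have [|||phi phiE] := @char_ext T _ (exp2_gt1 k) G.
- by apply/imsetP; exists 0 => //; rewrite mul0rn f0 mulr0n.
- move=> _ _ /imsetP[x _ ->] /imsetP[y _ ->]; apply/imsetP; exists (x - y) => //.
  rewrite mulrnBl fD fN -Z2half_add; congr pair; congr (_ + _).
  by case: (f y) => //=; rewrite ?mulr0n ?oppr0 // mulr1n; apply/eqP;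
    rewrite eq_sym -addr_eq0 -mulr2n Z2_half2.
- move=> t a /imsetP[x _ [tx ->]]; suff -> : f x = false by [].
  have := fk (x - t *+ 2); rewrite mulrnBl -mulrnA -expnS tx subrr.
  by rewrite fD fN f2 addbF; apply.
exists phi => x; apply: (@Z2half_inj k).
have /= := phiE (x *+ (2 ^ k), Z2half *+ f x); rewrite raddfMn Z2_mul_half; apply.
by apply/imsetP; exists x.
Qed.

Lemma sum_sign0 (T : finZmodType) (B : pred T) (f : T -> bool) x0 :
    (forall x, B (x0 + x) = B x) -> (forall x, B x -> f (x0 + x) = ~~ f x) ->
  \sum_(x | B x) (-1) ^+ f x = 0 :> int.
Proof.
move=> B0 f0; set s := \sum_(x | _) _.
suff /eqP: s = - s by rewrite eq_sym eqNr => /eqP.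
rewrite {1}/s (reindex_inj (addrI x0)) /= -sumrN.
by apply: eq_big => // x; rewrite B0 => /f0->; case: (f x).
Qed.

Lemma tors_shift (T : zmodType) (N : nat) (x0 x : T) :
  x0 *+ N = 0 -> ((x0 + x) *+ N == 0) = (x *+ N == 0).
Proof. by move=> x0N; rewrite mulrnDl x0N add0r. Qed.

Section Duality.
Variables (S : twist) (M N : nat) (la : S -> bool).
Hypothesis laD : forall x y, x *+ M = 0 -> y *+ M = 0 -> la (x + y) = la x (+) la y.

(** Duality between torsion subgroups. Let t and s range over the M-torsion and
    the N-torsion. If the character la were none of the characters comm _ s, the
    double sum of (-1) ^ (la t + comm t s) would vanish, as all the inner sums
    over t do. Summed over s first, it is a sum of nonnegative terms and the
    term t = 0 is positive, since by hypothesis la is trivial on every t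
    orthogonal to the N-torsion. *)
Lemma comm_dual :
    (forall t, t *+ M = 0 -> (forall s, s *+ N = 0 -> comm t s = false) ->
      la t = false) ->
  exists2 s : S, s *+ N = 0 & forall t, t *+ M = 0 -> la t = comm t s.
Proof.
move=> la0.
have [/existsP[s /andP[/eqP sN /forallP h]]|nex] := boolP [exists s : S,
    (s *+ N == 0) && [forall t, (t *+ M == 0) ==> (la t == comm t s)]].
  by exists s => // t tM; apply/eqP; apply: (implyP (h t)); rewrite tM.
exfalso; pose X : int := \sum_(s : S | s *+ N == 0) \sum_(t : S | t *+ M == 0)
  (-1) ^+ (la t (+) comm t s).
have: X = 0.
  apply: big1 => s /eqP sN; move: nex; rewrite negb_exists => /forallP/(_ s).
  rewrite sN eqxx /= negb_forall => /existsP[t0]; rewrite negb_imply.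
  case/andP=> /eqP t0M t0s; apply: (sum_sign0 (x0 := t0)) => x.
    exact: tors_shift.
  move=> /eqP xM; rewrite laD // commDl; move: t0s.
  by case: (la t0); case: comm; case: (la x); case: comm.
apply/eqP; rewrite gt_eqF // /X exchange_big /= (bigD1 0) ?mul0rn //=.
apply: ltr_wpDr.
  apply: sumr_ge0 => t /andP[/eqP tM _].
  have [/forallP h|] := boolP [forall s : S, (s *+ N == 0) ==> ~~ comm t s].
    apply: sumr_ge0 => s sN; rewrite la0 //; last first.
      by move=> s' s'N; apply/negbTE; apply: (implyP (h s')); rewrite s'N.
    by rewrite (negbTE (implyP (h s) sN)).
  rewrite negb_forall => /existsP[s0]; rewrite negb_imply negbK.
  case/andP=> /eqP s0N ts0; rewrite (sum_sign0 (x0 := s0)) // => s.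
    exact: tors_shift.
  by rewrite commDr ts0 => _; case: (la t); case: comm.
rewrite (bigD1 0) ?mul0rn //=; apply: ltr_wpDr.
  apply: sumr_ge0 => s _; rewrite comm0l la0 ?mul0rn // => s' _.
  exact: comm0l.
by rewrite comm0l la0 ?mul0rn // => s' _; exact: comm0l.
Qed.

End Duality.

(** * The standard twists and splitting *)

(** The cocycle identities for signs are read off in the rational numbers, so
    that the sign cocycles below are those of the algebras C and D. *)
Lemma sign_cocycle (T : finZmodType) (d : cocycle rat T) (c : T -> T -> bool) :
    (forall s t, d s t = (-1) ^+ c s t) ->
  c 0 0 = false /\
  forall r s t, c r s (+) c (r + s) t = c s t (+) c r (s + t).
Proof.
move=> dc; split=> [|r s t]; apply: (@signr_inj rat); last first.
  by rewrite !signr_addb -!dc cocA.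
by rewrite -dc coc0l.
Qed.

Section StandardTwists.

Definition C_sgn n (i j : 'Z_n) : bool := carry i j.

Lemma C_sgnE (F : fieldType) n (i j : 'Z_n) :
  C_fun (-1 : F) i j = (-1) ^+ C_sgn i j.
Proof. by []. Qed.

Definition C_sgn_cocycle n := sign_cocycle (d := C_cocycle n (-1)) (@C_sgnE _ n).

Definition tw_C n : twist :=
  Twist (proj1 (C_sgn_cocycle n)) (proj2 (C_sgn_cocycle n)).

Variables (k l : nat) (b b' : bool).

Definition D_sgn (s t : 'Z_(2 ^ k) * 'Z_(2 ^ l)) : bool :=
  odd (s.2 * t.1)%N (+) (b && carry s.1 t.1) (+) (b' && carry s.2 t.2).

Lemma D_sgnE (F : fieldType) s t :
  D_fun ((-1) ^+ b : F) ((-1) ^+ b') s t = (-1) ^+ D_sgn s t.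
Proof.
by rewrite /D_fun /D_sgn !signr_addb signr_odd -!exprM !mulnb.
Qed.

Definition D_sgn_cocycle := sign_cocycle (d := D_cocycle k l _ _) (@D_sgnE _).

Definition tw_D : twist := Twist (tw_grp := D_grp k l)
  (proj1 D_sgn_cocycle) (proj2 D_sgn_cocycle).

End StandardTwists.

Definition tw_quad (q : quadruple) : twist :=
  let: (k, l, b, b') := q in tw_D k l b b'.

Fixpoint tw_chi (chi : seq quadruple) : twist :=
  match chi with
  | [::] => tw1
  | [:: q] => tw_quad q
  | q :: chi' => tw_prod (tw_quad q) (tw_chi chi')
  end.

Definition tw_item (p : item) : twist :=
  match p with
  | Item1 chi G => tw_prod (tw_prod tw1 (tw_chi chi)) (tw_triv G)
  | Item2 m chi G =>
      tw_prod (tw_prod (tw_prod tw1 (tw_C (2 ^ m))) (tw_chi chi)) (tw_triv G)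
  | Item3 chi G =>
      tw_prod (tw_prod (tw_prod tw1 (tw_D 1 1 true true)) (tw_chi chi)) (tw_triv G)
  end.

Lemma pair_eq0 (U V : zmodType) (x : U) (y : V) : (x, y) = 0 -> x = 0 /\ y = 0.
Proof. by move=> E; have := congr1 fst E; have := congr1 snd E. Qed.

Lemma carryC p (i j : 'I_p.+1) : carry i j = carry j i.
Proof. by rewrite /carry addnC. Qed.

Lemma carry_tors2 p (i : 'I_p.+2) : i *+ 2 = 0 -> carry i i = (i != 0).
Proof.
move=> i2; have := carryE i i; rewrite -mulr2n i2 -val_eqE /= add0n.
by case: carry; case: (nat_of_ord i) => [|n] //=.
Qed.

Lemma comm_C n (i j : tw_C n) : comm i j = false.
Proof. by rewrite /comm /= /C_sgn carryC addbb. Qed.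

Lemma sq_C n (i : tw_C n) : i *+ 2 = 0 -> sq i = (i != 0).
Proof. exact: carry_tors2. Qed.

Lemma comm_D k l b b' (x y : tw_D k l b b') :
  comm x y = odd (x.2 * y.1)%N (+) odd (y.2 * x.1)%N.
Proof.
rewrite /comm /= /D_sgn (carryC x.1) (carryC x.2).
by do 2![case: odd]; do 2![case: (_ && _)].
Qed.

Lemma sq_D k l b b' (x : tw_D k l b b') : x *+ 2 = 0 ->
  sq x = odd (x.2 * x.1)%N (+) (b && (x.1 != 0)) (+) (b' && (x.2 != 0)).
Proof.
case: x => x1 x2; rewrite prod_mulrn => /pair_eq0/=[h1 h2].
by rewrite /sq /= /D_sgn /= !carry_tors2.
Qed.

(** A summand P with a retraction whose kernel is orthogonal to it splits off
    orthogonally. *)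
Lemma split_qiso (S P : twist) (p : P -> S) (q : {additive S -> P}) :
    {morph p : x y / x + y} -> (forall x, q (p x) = 0 -> x = 0) ->
    (forall x y, comm (p x) (p y) = comm x y) ->
    (forall x, x *+ 2 = 0 -> sq (p x) = sq x) ->
    (forall x y, q y = 0 -> comm (p x) y = false) ->
  qiso (tw_prod P (tw_ker q)) S.
Proof.
move=> pD qpI pc ps pq.
have [p' p'E] := additive_of pD.
apply: (@qisoI (tw_prod P (tw_ker q)) S (fun z => p z.1 + ker_val z.2)).
- by move=> [x y] [x' y']; rewrite /= pD addrACA; congr (_ + _); exact: ker_valD.
- exact: split_bij.
- move=> [x y] [x' y']; rewrite comm_prod /= !commDl !commDr pc pq ?ker_valP //.
  by rewrite (commC (ker_val y)) (pq x') ?ker_valP //= addbF.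
- move=> [x y]; rewrite prod_mulrn => /pair_eq0/=[x2 y2].
  have px2 : p x *+ 2 = 0 by rewrite -p'E -raddfMn x2 raddf0.
  have yy2 : ker_val y *+ 2 = 0.
    exact: etrans (esym (ker_valMn y 2)) (congr1 (@ker_val _ _ _) y2).
  by rewrite /= sqD // pq ?ker_valP // addbF ps.
Qed.

Lemma mulrn_ZD (T : zmodType) k (g : T) (i j : 'Z_(2 ^ k.+1)) :
  g *+ (2 ^ k.+1) = 0 -> g *+ (i + j)%R = g *+ i + g *+ j.
Proof.
move=> gk; rewrite Z2_valD -mulrnDr {2}(divn_eq (i + j) (2 ^ k.+1)).
by rewrite mulrnDr mulnC mulrnA gk mul0rn add0r.
Qed.

Lemma mulrn_half (T : zmodType) k (g : T) (e : bool) :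
  g *+ (@Z2half k *+ e)%R = g *+ (2 ^ k) *+ e.
Proof. by case: e; rewrite ?mulr1n ?mulr0n // Z2half_val. Qed.

Lemma tors2_inj (P Q : zmodType) (f : {additive P -> Q}) n :
    (forall x : P, x *+ (2 ^ n) = 0) ->
    (forall x, x *+ 2 = 0 -> f x = 0 -> x = 0) ->
  forall x, f x = 0 -> x = 0.
Proof.
move=> Pn f2 x fx; have := Pn x; elim: n {Pn} x fx => [|n IH] x fx; first by [].
rewrite expnS mulrnA => xn; apply: f2 => //; apply: IH => //.
by rewrite raddfMn fx mul0rn.
Qed.

Lemma split_C (S : twist) m (t : S) (phi : {additive S -> 'Z_(2 ^ m.+1)}) :
    t *+ (2 ^ m.+1) = 0 -> odd (phi t) -> sq (t *+ (2 ^ m)) ->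
    (forall x, comm t x = false) ->
  qiso (tw_prod (tw_C (2 ^ m.+1)) (@tw_ker S 'Z_(2 ^ m.+1) phi)) S.
Proof.
move=> tm pt st tc.
pose p (i : 'Z_(2 ^ m.+1)) := t *+ i.
have pD : {morph p : x y / x + y} by move=> i j; apply: mulrn_ZD.
have [p' p'E] := additive_of pD.
apply: (@split_qiso S (tw_C (2 ^ m.+1)) p phi) => //.
- move=> x fx; apply: (@tors2_inj _ _ (phi \o p' : {additive _ -> _}) m.+1).
  + exact: Z2_exp.
  + move=> y /Z2_tors2; set e := y != 0 => ->.
    rewrite /= p'E /p mulrn_half !raddfMn Z2_mul_half pt => h.
    by suff -> : e = false by []; exact: (@Z2half_inj m e false).
  + by rewrite /= p'E.
- by move=> i j; rewrite comm_C commMnl tc andbF.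
- move=> i i2; rewrite (sq_C i2) /p; have := Z2_tors2 i2.
  by case: eqP => [->|_ ->]; rewrite ?mulr0n ?sq0 // mulrn_half st.
- by move=> i y _; rewrite commMnl tc andbF.
Qed.

(** The retraction is (phi, psi). Its restriction to the subgroup of g and h is
    injective because it is so on the elements of order two, where its matrix is
    triangular: phi h is even, so phi kills 2^l h as k <= l. *)
Lemma split_D (S : twist) k l (g h : S)
    (phi : {additive S -> 'Z_(2 ^ k.+1)}) (psi : {additive S -> 'Z_(2 ^ l.+1)}) :
    (k <= l)%N -> g *+ (2 ^ k.+1) = 0 -> h *+ (2 ^ l.+1) = 0 -> comm g h ->
    (forall x, odd (phi x) = comm x h) -> (forall x, odd (psi x) = comm g x) ->
  exists q : {additive S -> D_grp k.+1 l.+1}, (forall x, q x = (phi x, psi x)) /\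
    qiso (tw_prod (tw_D k.+1 l.+1 (sq (g *+ (2 ^ k))) (sq (h *+ (2 ^ l))))
                  (tw_ker q)) S.
Proof.
move=> kl gk hl gh phiE psiE.
set b := sq _; set b' := sq _.
have [q qE] : exists q : {additive S -> D_grp k.+1 l.+1}, q =1 fun x => (phi x, psi x).
  by apply: additive_of => x y; congr pair; rewrite raddfD.
exists q; split=> //.
pose p (x : D_grp k.+1 l.+1) : S := g *+ x.1 + h *+ x.2.
have pD : {morph p : x y / x + y}.
  by move=> x y; rewrite /p /= !mulrn_ZD // addrACA.
have [p' p'E] := additive_of pD.
have tors (x : D_grp k.+1 l.+1) : x *+ 2 = 0 ->
  p x = g *+ (2 ^ k) *+ (x.1 != 0) + h *+ (2 ^ l) *+ (x.2 != 0).
  case: x => i j; rewrite prod_mulrn => /pair_eq0/=[i2 j2]; rewrite /p /=.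
  by rewrite {1}(Z2_tors2 i2) {1}(Z2_tors2 j2) !mulrn_half.
apply: (@split_qiso S (tw_D k.+1 l.+1 b b') p q) => //.
(* It is enough to see that q \o p' is injective on the 2-torsion. *)
- move=> x fx; apply: (@tors2_inj _ _ (q \o p' : {additive _ -> _}) l.+1).
  + move=> [i j]; rewrite prod_mulrn /= Z2_exp; congr pair.
    by rewrite -(subnK (kl : (k.+1 <= l.+1)%N)) expnD mulnC mulrnA Z2_exp mul0rn.
  + move=> y y2; rewrite /= p'E qE tors // !raddfD !raddfMn.
    have := y2; case: y {y2} => i j; rewrite prod_mulrn /= => /pair_eq0/=[i2 j2].
    have phih : phi h *+ (2 ^ l) = 0.
      by rewrite -(subnK kl) expnD mulnC mulrnA Z2_mul_half phiE commxx !mul0rn.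
    rewrite phih mul0rn addr0 !Z2_mul_half phiE gh psiE gh !mulr1n => /pair_eq0.
    move=> [/(@Z2half_inj _ _ false)/negbFE/eqP->]; rewrite eqxx mulr0n add0r.
    by move=> /(@Z2half_inj _ _ false)/negbFE/eqP->.
  + by rewrite /= p'E.
- move=> [i j] [i' j']; rewrite comm_D /p /= !commDl !commDr !commMnl !commMnr.
  rewrite !commxx gh commC gh !oddM.
  by do 4![case: (odd _)].
- move=> [i j] x2; rewrite sq_D // tors // /= sqD.
  + have := x2; rewrite prod_mulrn => /pair_eq0/=[i2 j2] /=.
    have i2' := @Z2_odd_tors2 k i i2; have j2' := @Z2_odd_tors2 l j j2.
    rewrite oddM i2' j2' !commMnl !commMnr gh -/b -/b' !oddX.
    have sqMb (x : S) (e : bool) : sq (x *+ e) = e && sq x.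
      by case: e; rewrite ?mulr0n ?sq0.
    have [[e eE] [e' e'E]] : (exists e, e = (i != 0)) /\ (exists e, e = (j != 0)).
      by split; eexists.
    rewrite !sqMb -/b -/b' -!eE -!e'E orbF.
    move: {i2' j2' i2 j2 eE e'E} (k == 0)%N (l == 0)%N (b) (b').
    by case: e; case: e'; do 4!case.
  + by rewrite -!mulrnA mulnCA -expnSr mulrnA mulrnAC gk mul0rn.
  + by rewrite -!mulrnA mulnCA -expnSr mulrnA mulrnAC hl mul0rn.
- move=> [i j] y; rewrite qE => /pair_eq0/=[py qy]; rewrite /p /= commDl !commMnl.
  by rewrite -psiE qy (commC h) -phiE py !andbF.
Qed.

(** * Normal form of the twists without minus signs *)

Lemma mulrn_card (T : finZmodType) (x : T) : x *+ #|T| = 0.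
Proof. by rewrite -FinRing.zmodXgE -cardsT (@expg_cardG _ [set: T]%G) ?inE. Qed.

Lemma tors_logn (T : finZmodType) (x : T) a :
  x *+ (2 ^ a) = 0 -> x *+ (2 ^ logn 2 #|T|) = 0.
Proof.
rewrite -!FinRing.zmodXgE => /eqP; rewrite -[0]/(1%g : T) -order_dvdn.
move=> /(dvdn_pfactor _ _ (isT : prime 2))[e _ oe].
apply/eqP; rewrite -order_dvdn oe dvdn_exp2l // -pfactor_dvdn //; last first.
  by rewrite (cardD1 0).
by rewrite -oe -cardsT (@order_dvdG _ [set: T]%G) ?inE.
Qed.

(** An odd multiple of x commutes with y as x does. *)
Lemma comm_2part (S : twist) (x y : S) : comm x y ->
  exists2 g, g *+ (2 ^ logn 2 #|S|) = 0 & comm g y.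
Proof.
move=> xy; exists (x *+ (#|S|`_(2^'))%N).
  by rewrite -mulrnA -p_part mulnC partnC ?mulrn_card // (cardD1 0).
rewrite commMnl xy andbT.
by have := part_pnat (2^')%N #|S|; rewrite -odd_2'nat.
Qed.

Lemma qiso_card S S' : qiso S S' -> #|S| = #|S'|.
Proof. by move=> [f [fb _ _]]; exact: bij_eq_card fb. Qed.

Lemma card_tw_prod S S' : #|tw_prod S S'| = (#|S| * #|S'|)%N.
Proof. exact: card_prod. Qed.

Lemma card_tw_gt0 (S : twist) : (0 < #|S|)%N.
Proof. by rewrite (cardD1 0). Qed.

Lemma split_card_lt S S1 S2 : qiso (tw_prod S1 S2) S -> (1 < #|S1|)%N ->
  (#|S2| < #|S|)%N.
Proof.
by move=> /qiso_card <- S11; rewrite card_tw_prod ltn_Pmull ?card_tw_gt0.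
Qed.

Lemma card_tw_D k l b b' : (1 < #|tw_D k l b b'|)%N.
Proof. by rewrite card_prod !card_ord. Qed.

Lemma tw_prodCA S1 S2 S3 :
  qiso (tw_prod S1 (tw_prod S2 S3)) (tw_prod S2 (tw_prod S1 S3)).
Proof.
apply: qiso_trans (tw_prodA _ _ _) _; apply: qiso_trans (qiso_sym (tw_prodA _ _ _)).
exact: tw_prod_iso (tw_prodC _ _) (qiso_refl _).
Qed.

Lemma tw_chi_cons q chi :
  qiso (tw_prod (tw_quad q) (tw_chi chi)) (tw_chi (q :: chi)).
Proof.
case: chi => [|q' chi]; last exact: qiso_refl.
exact: qiso_trans (tw_prodC _ _) (tw_prod1 _).
Qed.

Lemma tw_item1E chi G :
  qiso (tw_prod (tw_chi chi) (tw_triv G)) (tw_item (Item1 chi G)).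
Proof. exact: tw_prod_iso (qiso_sym (tw_prod1 _)) (qiso_refl _). Qed.

(** The shape in which the summands are produced by splitting, against the one
    in which the list associates them. *)
Lemma tw_item23E S chi (G : finZmodType) :
  qiso (tw_prod S (tw_prod (tw_chi chi) (tw_triv G)))
       (tw_prod (tw_prod (tw_prod tw1 S) (tw_chi chi)) (tw_triv G)).
Proof.
apply: qiso_trans (tw_prodA _ _ _) _.
apply: tw_prod_iso (qiso_refl _); apply: tw_prod_iso (qiso_refl _).
exact: qiso_sym (tw_prod1 _).
Qed.

Definition add_quad q p :=
  match p with
  | Item1 chi G => Item1 (q :: chi) G
  | Item2 m chi G => Item2 m (q :: chi) G
  | Item3 chi G => Item3 (q :: chi) G
  end.

Lemma tw_item_add q p :
  qiso (tw_prod (tw_quad q) (tw_item p)) (tw_item (add_quad q p)).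
Proof.
have chiE chi G : qiso (tw_prod (tw_quad q) (tw_prod (tw_chi chi) (tw_triv G)))
    (tw_prod (tw_chi (q :: chi)) (tw_triv G)).
  apply: qiso_trans (tw_prodA _ _ _) _.
  exact: tw_prod_iso (tw_chi_cons _ _) (qiso_refl _).
have refl := qiso_refl.
have item23 S' chi G : qiso (tw_prod (tw_quad q)
      (tw_prod (tw_prod (tw_prod tw1 S') (tw_chi chi)) (tw_triv G)))
    (tw_prod (tw_prod (tw_prod tw1 S') (tw_chi (q :: chi))) (tw_triv G)).
  apply: qiso_trans (tw_item23E _ _ _).
  apply: qiso_trans (tw_prod_iso (refl _) (chiE _ _)).
  apply: qiso_trans (tw_prodCA _ _ _).
  exact: tw_prod_iso (refl _) (qiso_sym (tw_item23E _ _ _)).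
case: p => [chi G|m chi G|chi G]; [|exact: item23|exact: item23].
apply: qiso_trans (tw_item1E (q :: chi) G).
apply: qiso_trans (chiE _ _).
exact: tw_prod_iso (refl _) (qiso_sym (tw_item1E _ _)).
Qed.

Definition plus_chi (chi : seq quadruple) : bool :=
  all (fun q => let: (k, l, b, b') := q in [&& 1 <= k, k <= l, ~~ b & ~~ b']%N) chi.

Lemma plus_chiP chi : plus_chi chi ->
  [/\ is_characteristic chi, num_minus chi = 0%N & has special chi = false].
Proof.
elim: chi => [|[[[k l] b] b'] chi IH] /=; first by rewrite /num_minus big_nil.
move=> /andP[/and4P[k1 kl nb nb']] /IH[h1 h2 h3].
rewrite /is_characteristic /= k1 kl /=; split=> //.
  by rewrite /num_minus big_cons -/(num_minus chi) h2 (negPf nb) (negPf nb').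
rewrite h3 orbF /special !inE !xpair_eqE (negPf nb) (negPf nb') /=.
by rewrite !andbF.
Qed.

Lemma plus_even chi : plus_chi chi -> even_chi chi.
Proof. by move=> /plus_chiP[h1 h2 _]; rewrite /even_chi h1 h2 eqxx. Qed.

Lemma even_chi_add chi :
  even_chi chi -> even_chi ((1%N, 1%N, false, false) :: chi).
Proof. by rewrite /even_chi /num_minus !big_cons /= !add0n. Qed.

Lemma odd_chi_add chi :
  odd_chi chi -> odd_chi ((1%N, 1%N, false, false) :: chi).
Proof. by rewrite /odd_chi /num_minus !big_cons /= !add0n. Qed.

Section Minimal.
Variable S : twist.

(** The order 2^(k+1) of g is the least 2-power order of an element outside the
    radical, and the order of h is the least possible for a partner of such an
    element; in particular k <= l, as h is outside the radical too. *)
Lemma minimal_noncommuting_pair (x y : S) : comm x y -> exists k l (g h : S),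
  [/\ (k <= l)%N, g *+ (2 ^ k.+1) = 0, h *+ (2 ^ l.+1) = 0, comm g h
   & (forall x, x *+ (2 ^ k) = 0 -> comm x h = false) /\
     (forall x, x *+ (2 ^ l) = 0 -> comm g x = false)].
Proof.
move=> xy.
pose Q k l := [exists g : S, exists h : S,
  [&& g *+ (2 ^ k) == 0, h *+ (2 ^ l) == 0 & comm g h]].
have QP k l : reflect (exists g h : S,
    [/\ g *+ (2 ^ k) = 0, h *+ (2 ^ l) = 0 & comm g h]) (Q k l).
  apply: (iffP existsP) => -[g]; last first.
    by move=> [h [/eqP gk /eqP hl gh]]; exists g; apply/existsP; exists h; apply/and3P.
  by move=> /existsP[h /and3P[/eqP gk /eqP hl gh]]; exists g, h.
pose K := logn 2 #|S|.
have Q2 (g h : S) : comm g h -> exists2 h', h' *+ (2 ^ K) = 0 & comm g h'.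
  by rewrite commC => /comm_2part[h' h'K h'g]; exists h'; [exact: h'K | rewrite commC].
have QK : exists k, Q k K.
  have [g gK gy] := comm_2part xy; have [h hK gh] := Q2 _ _ gy.
  by exists K; apply/QP; exists g, h.
case: (ex_minnP QK) => k Qk kmin.
have Qk' : exists l, Q k l by exists K.
case: (ex_minnP Qk') => l Ql lmin.
have k0 a (g h : S) : g *+ (2 ^ a) = 0 -> comm g h -> (k <= a)%N.
  move=> ga gh; apply: kmin; apply/QP; have [h' h'K gh'] := Q2 _ _ gh.
  by exists g, h'.
have nz (g : S) : g *+ (2 ^ 0) = 0 -> g = 0 by [].
have [g [h [gk hl gh]]] := QP _ _ Ql.
case: k gk {kmin Qk Qk' Ql} lmin k0 => [|k] gk lmin k0.
  by move: gh; rewrite (nz _ gk) comm0l.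
case: l hl lmin => [|l] hl lmin; first by move: gh; rewrite (nz _ hl) comm0r.
exists k, l, g, h; split=> //.
  by apply: (k0 _ h g hl); rewrite commC.
split=> z zk; apply/negbTE/negP => c.
  by have := k0 _ _ _ zk c; rewrite ltnn.
have: Q k.+1 l by apply/QP; exists g, z.
by move=> /lmin; rewrite ltnn.
Qed.

End Minimal.

Lemma commDr_morph (S : twist) (g : S) : {morph comm g : x y / x + y >-> x (+) y}.
Proof. by move=> x y; rewrite commDr. Qed.
Lemma commDl_morph (S : twist) (h : S) :
  {morph (fun x => comm x h) : x y / x + y >-> x (+) y}.
Proof. by move=> x y; rewrite commDl. Qed.

Lemma ker_tors2 (S : twist) (P : finZmodType) (q : {additive S -> P}) (y : tw_ker q) :
  y *+ 2 = 0 -> ker_val y *+ 2 = 0.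
Proof.
move=> y2; exact: etrans (esym (ker_valMn y 2)) (congr1 (@ker_val _ _ _) y2).
Qed.

Lemma plus_normal_form (S : twist) : (forall x : S, x *+ 2 = 0 -> sq x = false) ->
  exists chi G, plus_chi chi /\ qiso (tw_prod (tw_chi chi) (tw_triv G)) S.
Proof.
have [n] := ubnP #|S|; elim: n S => // n IH S Sn Splus.
have [/existsP[x /existsP[y xy]]|nc] := boolP [exists x : S, exists y, comm x y].
  have [k [l [g [h [kl gk hl gh [ming minh]]]]]] := minimal_noncommuting_pair xy.
  have [phi phiE] := char_lift (commDl_morph h) ming.
  have [psi psiE] := char_lift (commDr_morph g) minh.
  have [q [qE iso]] := split_D kl gk hl gh phiE psiE.
  have [|y' y'2|chi [G [pchi chiE]]] := IH (tw_ker q).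
  - exact: leq_trans (split_card_lt iso (card_tw_D _ _ _ _)) Sn.
  - exact: Splus (ker_tors2 y'2).
  exists ((k.+1, l.+1, false, false) :: chi), G; split; first by rewrite /= ltnS kl.
  apply: qiso_trans iso; rewrite !Splus; last 2 first.
  - by rewrite -mulrnA -expnSr.
  - by rewrite -mulrnA -expnSr.
  apply: qiso_trans (tw_prod_iso (qiso_refl _) chiE).
  apply: qiso_trans (qiso_sym (tw_prodA _ _ _)).
  exact: tw_prod_iso (qiso_sym (tw_chi_cons _ _)) (qiso_refl _).
exists [::], S; split=> //; apply: qiso_trans (tw_prod1 _) _.
apply: (@qisoI (tw_triv S) S id) => //; first by exists id.
  move=> x y; transitivity false; last by [].
  apply/negbTE; apply: contraNN nc => xy.
  by apply/existsP; exists x; apply/existsP; exists y.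
Qed.

(** * Normal form in general *)

Definition normalizable (S : twist) : Prop :=
  exists p : item, item_ok p /\ qiso (tw_item p) S.

Lemma normalizable_iso S S' : normalizable S -> qiso S S' -> normalizable S'.
Proof.
by move=> [p [pok pS]] SS'; exists p; split=> //; apply: qiso_trans SS'.
Qed.

Lemma normalizable_chi S chi (G : finZmodType) : even_chi chi || odd_chi chi ->
  qiso (tw_prod (tw_chi chi) (tw_triv G)) S -> normalizable S.
Proof.
move=> pchi; apply: normalizable_iso; exists (Item1 chi G); split=> //.
exact: qiso_sym (tw_item1E _ _).
Qed.

Section Hyperbolic.
Variables (S : twist) (g h : S).
Hypotheses (g2 : g *+ 2 = 0) (h2 : h *+ 2 = 0) (gh : comm g h).

(** In the 2-torsion no lifting is needed: beta(-, h) and beta(g, -) already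
    have values in Z/2. *)
Lemma split_plane : exists q : {additive S -> D_grp 1 1},
  (forall x, q x = 0 -> comm x h = false /\ comm g x = false) /\
  qiso (tw_prod (tw_D 1 1 (sq g) (sq h)) (tw_ker q)) S.
Proof.
have t1 (f : S -> bool) : {morph f : x y / x + y >-> x (+) y} ->
    forall x, x *+ (2 ^ 0) = 0 -> f x = false.
  move=> fD x x0; rewrite [x]x0; have := fD 0 0; rewrite addr0; by case: (f 0).
have [phi phiE] := char_lift (commDl_morph h) (t1 _ (commDl_morph h)).
have [psi psiE] := char_lift (commDr_morph g) (t1 _ (commDr_morph g)).
have [q [qE iso]] := split_D (leqnn 0) g2 h2 gh phiE psiE.
exists q; split=> // x; rewrite qE => /pair_eq0[px qx].
by rewrite -phiE px -psiE qx.
Qed.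

End Hyperbolic.

Section Elliptic.
Variable S : twist.
Hypothesis nohyp : forall g h : S, g *+ 2 = 0 -> h *+ 2 = 0 -> comm g h ->
  sq g || sq h.

(** If mu vanishes at g, it vanishes at h or at g + h for every h not commuting
    with g, so there would be a hyperbolic plane. *)
Lemma nohyp_sq (g h : S) : g *+ 2 = 0 -> h *+ 2 = 0 -> comm g h -> sq g.
Proof.
move=> g2 h2 gh; apply/negPn/negP => sg.
have := nohyp g2 h2 gh; rewrite (negPf sg) /= => sh.
have gh2 : (g + h) *+ 2 = 0 by rewrite mulrnDl g2 h2 addr0.
have := nohyp g2 gh2; rewrite commDr commxx gh sqD // gh sh (negPf sg) /=.
by move=> /(_ isT).
Qed.

(** For y in the complement of the plane, g + y still fails to commute with h,
    so mu(g + y) = mu(g), whence mu(y) = 0. *)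
Lemma normalizable_elliptic (g h : S) :
  g *+ 2 = 0 -> h *+ 2 = 0 -> comm g h -> normalizable S.
Proof.
move=> g2 h2 gh; have [q [qE iso]] := split_plane g2 h2 gh.
have sg := nohyp_sq g2 h2 gh.
have sh : sq h by apply: nohyp_sq h2 g2 _; rewrite commC.
have [|chi [G [pchi chiE]]] := @plus_normal_form (tw_ker q).
  move=> y y2; have yy2 := ker_tors2 y2; have [yh yg] := qE _ (ker_valP y).
  have gy2 : (g + ker_val y) *+ 2 = 0 by rewrite mulrnDl g2 yy2 addr0.
  have := @nohyp_sq (g + ker_val y) h gy2 h2.
  rewrite commDl gh yh sqD // yg sg => /(_ isT).
  by rewrite addbF /sq /=; case: tw_sgn.
exists (Item3 chi G); split; first exact: plus_even.
apply: qiso_trans iso; rewrite sg sh.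
apply: qiso_trans (tw_prod_iso (qiso_refl _) chiE).
exact: qiso_sym (tw_item23E _ _ _).
Qed.

End Elliptic.

Section Linear.
Variable S : twist.
Hypothesis comm2 : forall x y : S, x *+ 2 = 0 -> y *+ 2 = 0 -> comm x y = false.

Definition halfsq m (x : S) := sq (x *+ (2 ^ m)).

Lemma tors_half m (x : S) : x *+ (2 ^ m.+1) = 0 -> x *+ (2 ^ m) *+ 2 = 0.
Proof. by rewrite -mulrnA -expnSr. Qed.

Lemma halfsqD m (x y : S) : x *+ (2 ^ m.+1) = 0 -> y *+ (2 ^ m.+1) = 0 ->
  halfsq m (x + y) = halfsq m x (+) halfsq m y.
Proof.
move=> /tors_half xm /tors_half ym.
by rewrite /halfsq mulrnDl sqD // comm2 // addbF.
Qed.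

Variables (m : nat) (t0 : S).
Hypotheses (t0m : t0 *+ (2 ^ m.+1) = 0) (st0 : halfsq m t0).
Hypothesis mmax : forall n (t : S), t *+ (2 ^ n.+1) = 0 -> halfsq n t -> (n <= m)%N.

(** The character phi extends mu from the 2-torsion to T, with values in
    Z/2^(m+1); such an extension exists by the maximality of m. It is odd at t,
    so t generates a complement of its kernel, on which mu is trivial. *)
Lemma normalizable_central (t : S) :
  t *+ (2 ^ m.+1) = 0 -> halfsq m t -> (forall x, comm t x = false) ->
  normalizable S.
Proof.
move=> tm st tc.
pose G := [set (x, Z2half *+ sq x) | x : S & x *+ 2 == 0] : {set S * 'Z_(2 ^ m.+1)}.
have [|||phi phiE] := @char_ext S _ (exp2_gt1 m) G.
- by apply/imsetP; exists 0; rewrite ?inE ?mul0rn // sq0.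
- move=> _ _ /imsetP[x x2 ->] /imsetP[y y2 ->]; rewrite !inE in x2 y2.
  have ny2 : (- y) *+ 2 = 0 by rewrite mulNrn (eqP y2) oppr0.
  have ye : - y = y by apply/eqP; rewrite eq_sym -addr_eq0 -mulr2n.
  apply/imsetP; exists (x - y).
    by rewrite inE mulrnDl ny2 (eqP x2) addr0.
  rewrite sqD ?(eqP x2) // comm2 ?(eqP x2) // addbF ye -Z2half_add.
  congr pair; first by rewrite /= ye.
  congr (_ + _); case: (sq y) => /=.
    by rewrite mulr1n; apply/eqP; rewrite eq_sym -addr_eq0 -mulr2n Z2_half2.
  by rewrite mulr0n oppr0.
- move=> x a /imsetP[y]; rewrite inE => /eqP y2 [xy ->].
  suff -> : sq y = false by [].
  apply/negbTE/negP => sy; have := @mmax m.+1 x; rewrite /halfsq xy sy ltnn.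
  by rewrite expnSr mulrnA xy y2 => /(_ erefl isT).
have phi2 x : x *+ 2 = 0 -> phi x = Z2half *+ sq x.
  move=> x2; apply: (phiE (x, _)); apply/imsetP; exists x => //.
  by rewrite inE x2.
have pt : odd (phi t).
  apply: (@Z2half_inj m _ true); rewrite -Z2_mul_half -raddfMn phi2.
    by rewrite -/(halfsq m t) st.
  exact: tors_half.
have iso := split_C tm pt st tc.
have [|chi [H [pchi chiE]]] := @plus_normal_form (@tw_ker S 'Z_(2 ^ m.+1) phi).
  move=> y y2; have yy2 := ker_tors2 y2; have := phi2 _ yy2.
  rewrite ker_valP => /esym; exact: (@Z2half_inj m _ false).
exists (Item2 m.+1 chi H); split; first by rewrite /= plus_even.
apply: qiso_trans iso.
apply: qiso_trans (tw_prod_iso (qiso_refl _) chiE).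
exact: qiso_sym (tw_item23E _ _ _).
Qed.

(** The subgroup 2^m S + S[2] carries both prescriptions, phi(2^m y) = 2^m comm
    y s and phi(x) = 2^m mu(x), and the hypothesis on s is what makes them agree
    where they overlap and vanish on the multiples of 2^(m+1). *)
Lemma char_pair (s : S) :
    (forall y, y *+ (2 ^ m.+1) = 0 -> halfsq m y = comm y s) ->
  exists phi : {additive S -> 'Z_(2 ^ m.+1)},
    (forall x, odd (phi x) = comm x s) /\
    (forall x, x *+ 2 = 0 -> phi x = Z2half *+ sq x).
Proof.
move=> sP.
pose G := [set (x.1 *+ (2 ^ m) + x.2, Z2half *+ (comm x.1 s (+) sq x.2))
  | x : S * S & x.2 *+ 2 == 0] : {set S * 'Z_(2 ^ m.+1)}.
have GP y x : x *+ 2 = 0 ->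
    (y *+ (2 ^ m) + x, Z2half *+ (comm y s (+) sq x)) \in G.
  by move=> x2; apply/imsetP; exists (y, x); rewrite ?inE ?x2.
have [|||phi phiE] := @char_ext S _ (exp2_gt1 m) G.
- by have := @GP 0 0 (mul0rn _ _); rewrite comm0l sq0 mul0rn addr0.
- move=> _ _ /imsetP[[y x] /[!inE]/eqP/= x2 ->] /imsetP[[y' x'] /[!inE]/eqP/= x'2 ->].
  have nx2 : (- x') *+ 2 = 0 by rewrite mulNrn x'2 oppr0.
  have := @GP (y - y') (x - x'); rewrite mulrnDl x2 nx2 addr0 => /(_ erefl).
  have ye : - x' = x' by apply/eqP; rewrite eq_sym -addr_eq0 -mulr2n x'2.
  rewrite sqD // (comm2 x2 nx2) addbF ye commDl commNl => h; congr (_ \in G): h.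
  congr pair; first by rewrite mulrnBl /= opprD ye addrACA.
  rewrite addbACA -Z2half_add; congr (_ + _).
  rewrite /=; case: (_ (+) _); last by rewrite mulr0n oppr0.
  by rewrite mulr1n; apply/eqP; rewrite -addr_eq0 -mulr2n Z2_half2.
- move=> w a /imsetP[[y x] /[!inE]/eqP/= x2 [wy ->]].
  have ye : - x = x by apply/eqP; rewrite eq_sym -addr_eq0 -mulr2n x2.
  have xE : (y - w *+ 2) *+ (2 ^ m) = x.
    rewrite mulrnBl -mulrnA -expnS wy opprD addrA subrr add0r; exact: ye.
  have : halfsq m (y - w *+ 2) = comm y s.
    rewrite sP; first by rewrite commDl commNl commMnl addbF.
    by rewrite expnSr mulrnA xE.
  by rewrite /halfsq xE => ->; rewrite addbb.
exists phi; split=> x.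
  apply: (@Z2half_inj m); rewrite -Z2_mul_half -raddfMn.
  have := phiE _ (@GP x 0 (mul0rn _ _)); rewrite /= addr0 => ->.
  by rewrite sq0 addbF.
move=> x2; have := phiE _ (@GP 0 x x2); rewrite /= mul0rn add0r => ->.
by rewrite comm0l.
Qed.

(** Duality represents the character mu(2^m -) as comm _ s, and s is taken of
    least order 2^(n+1). By duality again, the minimality of n provides a t
    where this character is nontrivial and which commutes with all the elements
    of order dividing 2^n. *)
Lemma dual_element : (forall t : S, t *+ (2 ^ m.+1) = 0 -> halfsq m t ->
    exists x, comm t x) ->
  exists n (s t : S), [/\ s *+ (2 ^ n.+1) = 0, t *+ (2 ^ m.+1) = 0, halfsq m t,
    forall y, y *+ (2 ^ m.+1) = 0 -> halfsq m y = comm y s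
  & forall x, x *+ (2 ^ n) = 0 -> comm t x = false].
Proof.
move=> noc.
pose Q n := [exists s : S, (s *+ (2 ^ n) == 0) &&
  [forall y : S, (y *+ (2 ^ m.+1) == 0) ==> (halfsq m y == comm y s)]].
have QP n : reflect (exists2 s : S, s *+ (2 ^ n) = 0 &
    forall y, y *+ (2 ^ m.+1) = 0 -> halfsq m y = comm y s) (Q n).
  apply: (iffP existsP) => [[s /andP[/eqP sn /forallP sy]]|[s sn sy]].
    by exists s => // y ym; apply/eqP; apply: (implyP (sy y)); rewrite ym.
  exists s; rewrite sn eqxx; apply/forallP => y; apply/implyP => /eqP ym.
  by rewrite sy.
have exQ : exists n, Q n.
  exists (logn 2 #|S|); apply/QP; apply: comm_dual => [x y|t tm tn].
    exact: halfsqD.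
  apply/negbTE/negP => st; have [x tx] := noc t tm st.
  rewrite commC in tx; have [x' x'K] := comm_2part tx.
  by rewrite commC tn.
case: (ex_minnP exQ) => -[|n] Qn nmin.
  have /QP[s s0 sP] := Qn; have := sP _ t0m; rewrite st0 [s]s0 comm0r.
  by [].
have /QP[s sn sP] := Qn.
have [/existsP[t /and3P[/eqP tm st /forallP tn]]|nex] := boolP [exists t : S,
   [&& t *+ (2 ^ m.+1) == 0, halfsq m t
     & [forall x : S, (x *+ (2 ^ n) == 0) ==> ~~ comm t x]]].
  exists n, s, t; split=> // x xn; apply/negbTE; apply: (implyP (tn x)).
  by rewrite xn.
exfalso; suff /QP/nmin : exists2 s : S, s *+ (2 ^ n) = 0 &
    forall y, y *+ (2 ^ m.+1) = 0 -> halfsq m y = comm y s by rewrite ltnn.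
apply: comm_dual => [x y|t tm tn]; first exact: halfsqD.
apply/negbTE; apply: contraNN nex => st; apply/existsP; exists t.
rewrite tm eqxx st; apply/forallP => x; apply/implyP => /eqP xn.
by rewrite tn.
Qed.

Lemma odd_cons k l b chi : (0 < k <= l)%N -> (1 < l)%N -> plus_chi chi ->
  odd_chi ((k, l, b, ~~ b) :: chi).
Proof.
move=> kl l1 /plus_chiP[h1 h2 h3].
rewrite /odd_chi /= {1}/is_characteristic /= kl -/(is_characteristic chi) h1.
rewrite /num_minus big_cons -/(num_minus chi) h2 h3 /special !inE !xpair_eqE.
by case: b; rewrite /= (gtn_eqF l1) !andbF.
Qed.

(** The factor spanned by g and h has exactly one minus sign, and it is not one
    of the special ones since elements of order two commute. *)
Lemma normalizable_odd k l (g h : S) b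
    (phi : {additive S -> 'Z_(2 ^ k.+1)}) (psi : {additive S -> 'Z_(2 ^ l.+1)}) :
    (k <= l)%N -> g *+ (2 ^ k.+1) = 0 -> h *+ (2 ^ l.+1) = 0 -> comm g h ->
    (forall x, odd (phi x) = comm x h) -> (forall x, odd (psi x) = comm g x) ->
    halfsq k g = b -> halfsq l h = ~~ b ->
    (forall x, x *+ 2 = 0 -> phi x = 0 -> psi x = 0 -> sq x = false) ->
  normalizable S.
Proof.
move=> kl gk hl gh phiE psiE bE b'E kersq.
have l0 : (0 < l)%N.
  rewrite lt0n; apply: contraTN gh => /eqP l0.
  move: kl gk hl; rewrite l0 leqn0 => /eqP-> gk hl.
  by rewrite comm2.
have [q [qE iso]] := split_D kl gk hl gh phiE psiE.
have [|chi [H [pchi chiE]]] := @plus_normal_form (tw_ker q).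
  move=> y y2; have := ker_valP y; rewrite qE => /pair_eq0[py qy].
  exact: kersq (ker_tors2 y2) py qy.
apply: (@normalizable_chi S ((k.+1, l.+1, b, ~~ b) :: chi) H).
  by rewrite (@odd_cons k.+1 l.+1) ?orbT.
apply: qiso_trans iso; rewrite -!/(halfsq _ _) bE b'E.
apply: qiso_trans (tw_prod_iso (qiso_refl _) chiE).
apply: qiso_trans (qiso_sym (tw_prodA _ _ _)).
exact: tw_prod_iso (qiso_sym (tw_chi_cons _ _)) (qiso_refl _).
Qed.

(** The elements t and s of dual_element span the factor. The sign of s is made
    positive by adding t to s when both have the same order, and a multiple of t
    that is central when the order of t is larger; the order of s can be larger
    only if its sign is already positive, by the maximality of m. *)
Lemma normalizable_noncentral : (forall t : S, t *+ (2 ^ m.+1) = 0 -> halfsq m t ->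
    exists x, comm t x) -> normalizable S.
Proof.
move=> /dual_element[n [s [t [sn tm st sP tn]]]].
have [phi [phiE phi2]] := char_pair sP.
have [psi psiE] := char_lift (commDr_morph t) tn.
have ts : comm t s by rewrite -sP.
have phisq x : x *+ 2 = 0 -> phi x = 0 -> sq x = false.
  by move=> x2; rewrite phi2 //; exact: (@Z2half_inj m _ false).
have [mn|nm] := leqP m n.
  have [ss|ss] := boolP (halfsq n s); last first.
    apply: (@normalizable_odd m n t s true phi psi) => //; first exact: negbTE.
    by move=> x x2 px _; apply: phisq.
  (* Both orders agree, and mu(2^m (s + t)) = 1 + 1 as 2-torsion commutes. *)
  have nm : n = m by apply/eqP; rewrite eqn_leq mn (mmax sn ss).
  subst n; have [phi' phi'E] : exists f : {additive S -> 'Z_(2 ^ m.+1)},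
      f =1 fun x => phi x + psi x.
    by apply: additive_of => x y; rewrite !raddfD addrACA.
  apply: (@normalizable_odd m m t (s + t) true phi' psi) => //.
  - by rewrite mulrnDl sn tm addr0.
  - by rewrite commDr commxx addbF.
  - by move=> x; rewrite phi'E Z2_oddD phiE psiE commDr (commC t).
  - by rewrite halfsqD // ss st.
  - by move=> x x2; rewrite phi'E => + psx; rewrite psx addr0; apply: phisq.
have psiE' x : odd (psi x) = comm x t by rewrite psiE commC.
have [s' [s'n s'c ss']] : exists s' : S, [/\ s' *+ (2 ^ n.+1) = 0,
    forall x, comm x s' = comm x s & halfsq n s' = false].
  have [ss|ss] := boolP (halfsq n s); last by exists s; split=> //; exact: negbTE.
  (* The element added is central, being an even multiple of t, and 2^n times it
     is 2^m t, where mu is 1. *)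
  exists (s + t *+ (2 ^ (m - n))).
  have tn' : t *+ (2 ^ (m - n)) *+ (2 ^ n.+1) = 0.
    by rewrite -mulrnA -expnD addnS subnK ?(ltnW nm).
  split=> [|x|]; first by rewrite mulrnDl sn tn' addr0.
    by rewrite commDr commMnr oddX subn_eq0 leqNgt nm addbF.
  rewrite halfsqD // ss /halfsq -mulrnA -expnD subnK ?(ltnW nm) //.
  by rewrite -/(halfsq m t) st.
apply: (@normalizable_odd n m s' t false psi phi) => //.
- exact: ltnW.
- by rewrite commC s'c.
- by move=> x; rewrite phiE -s'c commC.
- by move=> x x2 _ px; apply: phisq.
Qed.

End Linear.

Theorem twist_normalizable (S : twist) : normalizable S.
Proof.
have [n] := ubnP #|S|; elim: n S => // n IH S Sn.
pose hyp := [exists g : S, exists h : S,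
  [&& g *+ 2 == 0, h *+ 2 == 0, comm g h, ~~ sq g & ~~ sq h]].
have [/existsP[g /existsP[h /and5P[/eqP g2 /eqP h2 gh sg sh]]]|nhyp] := boolP hyp.
  have [q [_ iso]] := split_plane g2 h2 gh.
  have [|p [pok pE]] := IH (tw_ker q).
    exact: leq_trans (split_card_lt iso (card_tw_D _ _ _ _)) Sn.
  exists (add_quad (1, 1, false, false)%N p); split.
    case: p pok {pE} => [chi G|m chi G|chi G] /=.
    - by case/orP=> [/even_chi_add|/odd_chi_add] ->; rewrite ?orbT.
    - by case/andP=> -> /even_chi_add->.
    - by move=> /even_chi_add->.
  apply: qiso_trans iso; rewrite (negPf sg) (negPf sh).
  apply: qiso_trans (tw_prod_iso (qiso_refl _) pE).
  exact: qiso_sym (tw_item_add _ _).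
have nohyp (g h : S) : g *+ 2 = 0 -> h *+ 2 = 0 -> comm g h -> sq g || sq h.
  move=> g2 h2 gh; apply/negPn/negP; rewrite negb_or => /andP[sg sh].
  case/negP: nhyp; apply/existsP; exists g; apply/existsP; exists h.
  by rewrite g2 h2 eqxx gh sg.
have [/existsP[g /existsP[h /and3P[/eqP g2 /eqP h2 gh]]]|nell] := boolP
    [exists g : S, exists h : S, [&& g *+ 2 == 0, h *+ 2 == 0 & comm g h]].
  exact: (normalizable_elliptic nohyp g2 h2 gh).
have comm2 (g h : S) : g *+ 2 = 0 -> h *+ 2 = 0 -> comm g h = false.
  move=> g2 h2; apply/negbTE; apply: contraNN nell => gh.
  by apply/existsP; exists g; apply/existsP; exists h; rewrite g2 h2 eqxx.
pose P m := [exists t : S, (t *+ (2 ^ m.+1) == 0) && halfsq m t].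
have Pbound m : P m -> (m <= logn 2 #|S|)%N.
  case/existsP=> t /andP[/eqP tm]; rewrite leqNgt; apply: contraTN => lm.
  rewrite /halfsq -(subnK (ltnW lm)) expnD mulnC mulrnA (tors_logn tm) mul0rn.
  by rewrite sq0.
have [/existsP[x /andP[/eqP x2 sx]]|nsq] := boolP [exists x : S, (x *+ 2 == 0) && sq x].
  have exP : exists m, P m by exists 0%N; apply/existsP; exists x; rewrite x2 eqxx.
  case: (ex_maxnP exP Pbound) => m /existsP[t0 /andP[/eqP t0m st0]] mmax'.
  have mmax k (t : S) : t *+ (2 ^ k.+1) = 0 -> halfsq k t -> (k <= m)%N.
    by move=> tk st; apply: mmax'; apply/existsP; exists t; rewrite tk eqxx.
  have [/existsP[t /and3P[/eqP tm st /forallP tc]]|nc] := boolP [exists t : S,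
      [&& t *+ (2 ^ m.+1) == 0, halfsq m t & [forall x, ~~ comm t x]]].
    by apply: (normalizable_central comm2 mmax tm st) => y; apply/negbTE.
  apply: (normalizable_noncentral comm2 t0m st0 mmax) => t tm st.
  apply/existsP; apply: contraNT nc => ntx; apply/existsP; exists t.
  by rewrite tm eqxx st -negb_exists.
have [|chi [G [pchi chiE]]] := @plus_normal_form S.
  move=> y y2; apply/negbTE; apply: contraNN nsq => sy.
  by apply/existsP; exists y; rewrite y2 eqxx.
by apply: (@normalizable_chi _ chi G) => //; rewrite plus_even.
Qed.

(** * Exponential sums *)

Definition tors_count (T : finZmodType) (n : nat) : nat := #|[pred x : T | x *+ n == 0]|.

Definition gauss (S : twist) (f : S -> bool) (a b : nat) : int :=
  \sum_(x : S | x *+ a == 0) \sum_(y : S | y *+ b == 0) (-1) ^+ (f x (+) comm x y).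

Lemma tors_count_gt0 (T : finZmodType) n : (0 < tors_count T n)%N.
Proof. by apply/card_gt0P; exists 0; rewrite inE mul0rn. Qed.

Section Gauss.
Variable S : twist.
Implicit Types (f : S -> bool).

(** The inner sum over y vanishes unless x is orthogonal to the b-torsion, and
    for these x the sign is positive. *)
Lemma gauss_pos f a b :
    (forall x, x *+ a = 0 -> (forall y, y *+ b = 0 -> comm x y = false) ->
       f x = false) ->
  0 < gauss f a b.
Proof.
move=> f0.
have f00 : f 0 = false by apply: f0; rewrite ?mul0rn // => y _; rewrite comm0l.
rewrite /gauss (bigD1 0) ?mul0rn //=; apply: ltr_wpDr; last first.
  rewrite f00 (bigD1 0) ?mul0rn //= comm0l expr0; apply: ltr_wpDr => //.
  by apply: sumr_ge0 => y _; rewrite comm0l.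
apply: sumr_ge0 => x /andP[/eqP xa _].
have [/forallP h|] := boolP [forall y : S, (y *+ b == 0) ==> ~~ comm x y].
  have xb y : y *+ b = 0 -> comm x y = false.
    by move=> yb; apply/negbTE; apply: (implyP (h y)); rewrite yb.
  by apply: sumr_ge0 => y /eqP yb; rewrite f0 // xb.
rewrite negb_forall => /existsP[y0]; rewrite negb_imply negbK.
case/andP=> /eqP y0b xy0; rewrite (sum_sign0 (x0 := y0)) // => y.
  exact: tors_shift.
by rewrite commDr xy0 => _; case: (f x); case: comm.
Qed.

(** The translation by x0 changes the sign of all the terms. *)
Lemma gauss_zero f a b x0 :
    (forall x y, x *+ a = 0 -> y *+ a = 0 -> f (x + y) = f x (+) f y) ->
    x0 *+ a = 0 -> f x0 -> (forall y, y *+ b = 0 -> comm x0 y = false) ->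
  gauss f a b = 0.
Proof.
move=> fD x0a fx0 x0b; rewrite /gauss exchange_big /= big1 // => y /eqP yb.
apply: (sum_sign0 (x0 := x0)) => x; first exact: tors_shift.
by move=> /eqP xa; rewrite fD // fx0 commDl x0b //; case: (f x); case: comm.
Qed.

End Gauss.

Lemma eq_gauss (S : twist) (f g : S -> bool) a b :
  (forall x, x *+ a = 0 -> f x = g x) -> gauss f a b = gauss g a b.
Proof.
by move=> fg; apply: eq_bigr => x /eqP xa; apply: eq_bigr => y _; rewrite fg.
Qed.

Lemma gauss_prod (S1 S2 : twist) (f1 : S1 -> bool) (f2 : S2 -> bool) a b :
  gauss (fun x : tw_prod S1 S2 => f1 x.1 (+) f2 x.2) a b =
  gauss f1 a b * gauss f2 a b.
Proof.
rewrite /gauss mulr_suml.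
under [RHS]eq_bigr => x1 _ do rewrite mulr_sumr.
rewrite [RHS]pair_big /=; apply: (@eq_big _ _ _ (tw_prod S1 S2)) => [[x1 x2]|[x1 x2] _] /=.
  by rewrite prod_mulrn -pair_eqE.
rewrite mulr_suml.
under [RHS]eq_bigr => y1 _ do rewrite mulr_sumr.
rewrite [RHS]pair_big /=; apply: (@eq_big _ _ _ (tw_prod S1 S2)) => [[y1 y2]|[y1 y2] _] /=.
  by rewrite prod_mulrn -pair_eqE.
by rewrite comm_prod -signr_addb addbACA.
Qed.

Lemma gauss_iso (S S' : twist) (f : S -> bool) (f' : S' -> bool) a b
    (h : {additive S -> S'}) : bijective h ->
    (forall x y, comm (h x) (h y) = comm x y) ->
    (forall x, x *+ a = 0 -> f' (h x) = f x) ->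
  gauss f' a b = gauss f a b.
Proof.
move=> hb hc hf; have hE (x : S) n : (h x *+ n == 0) = (x *+ n == 0).
  by rewrite -raddfMn -(inj_eq (bij_inj hb)) raddf0.
rewrite /gauss (reindex h) /=; last exact: onW_bij.
apply: eq_big => [x|x]; rewrite hE // => /eqP xa.
rewrite (reindex h) /=; last exact: onW_bij.
by apply: eq_big => [y|y _]; rewrite ?hE // hc hf.
Qed.

(** Its quotient by the sizes of the two torsion subgroups is 2 to minus the
    rank of the commutation form between them. *)
Definition commsum (S : twist) (j i : nat) := gauss (fun _ : S => false) (2 ^ j) (2 ^ i).
(** For j = i = 0 this is the Gauss sum of the quadratic form mu on the
    2-torsion, whose sign is the Arf invariant. *)
Definition sqsum (S : twist) (j i : nat) := gauss (@halfsq S j) (2 ^ j.+1) (2 ^ i).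

Lemma commsum_iso S S' j i : qiso S S' -> commsum S j i = commsum S' j i.
Proof. by move=> [h [hb hc _]]; apply/esym; exact: gauss_iso hb hc _. Qed.

Lemma sqsum_iso S S' j i : qiso S S' -> sqsum S j i = sqsum S' j i.
Proof.
move=> [h [hb hc hs]]; apply/esym; apply: gauss_iso hb hc _ => x xj.
by rewrite /halfsq -raddfMn hs // tors_half.
Qed.

Lemma tors_count_iso (T T' : finZmodType) (h : {additive T -> T'}) n :
  bijective h -> tors_count T n = tors_count T' n.
Proof.
move=> hb; rewrite /tors_count -(card_image (bij_inj hb)).
have [g hK gK] := hb; apply: eq_card => y; rewrite inE; apply/imageP/eqP.
  by move=> [x /[!inE]/eqP xn ->]; rewrite -raddfMn xn raddf0.
move=> yn; exists (g y) => //; rewrite inE -(inj_eq (bij_inj hb)) raddfMn gK.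
by rewrite yn raddf0.
Qed.

Lemma tors_count_prod (T1 T2 : finZmodType) (T : finZmodType)
    (h : {additive T -> (T1 * T2)%type}) n : bijective h ->
  tors_count T n = (tors_count T1 n * tors_count T2 n)%N.
Proof.
move=> hb; rewrite (tors_count_iso n hb) /tors_count -cardX.
by apply: eq_card => -[x y]; rewrite !inE prod_mulrn -pair_eqE.
Qed.

Lemma tors_count_tw_prod (S1 S2 : twist) n :
  tors_count (tw_prod S1 S2) n = (tors_count S1 n * tors_count S2 n)%N.
Proof.
rewrite /tors_count -cardX.
by apply: eq_card => -[x y]; rewrite !inE prod_mulrn -pair_eqE.
Qed.

Lemma commsum_prod S1 S2 j i :
  commsum (tw_prod S1 S2) j i = commsum S1 j i * commsum S2 j i.
Proof. by rewrite /commsum -gauss_prod; apply: eq_gauss. Qed.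

Lemma sqsum_prod S1 S2 j i :
  sqsum (tw_prod S1 S2) j i = sqsum S1 j i * sqsum S2 j i.
Proof.
rewrite /sqsum -gauss_prod; apply: eq_gauss => x _.
by rewrite /halfsq sq_prod prod_mulrn.
Qed.

Lemma commsum_gt0 S j i : 0 < commsum S j i.
Proof. by apply: gauss_pos. Qed.

Lemma sqsum_triv G j i : 0 < sqsum (tw_triv G) j i.
Proof. by apply: gauss_pos. Qed.

Lemma commsum_triv G j i : commsum (tw_triv G) j i =
  (tors_count G (2 ^ j) * tors_count G (2 ^ i))%:R.
Proof.
rewrite /commsum /gauss.
under eq_bigr => x _ do rewrite (eq_bigr (fun=> 1)) // sumr_const.
by rewrite sumr_const -mulrnA mulnC.
Qed.

Lemma sqsum_chi chi j i : sqsum (tw_chi chi) j i = \prod_(q <- chi) sqsum (tw_quad q) j i.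
Proof.
have s1 : sqsum tw1 j i = \prod_(q <- [::]) sqsum (tw_quad q) j i.
  rewrite big_nil /sqsum /gauss (big_pred1 0) => [|x]; last first.
    by rewrite [x]ord1 mul0rn !eqxx.
  rewrite (big_pred1 0) => [|x]; last by rewrite [x]ord1 mul0rn !eqxx.
  by [].
elim: chi => [//|q chi IH]; rewrite -(sqsum_iso _ _ (tw_chi_cons q chi)).
by rewrite sqsum_prod IH big_cons.
Qed.

Lemma commsum_chi chi j i :
  commsum (tw_chi chi) j i = \prod_(q <- chi) commsum (tw_quad q) j i.
Proof.
have s1 : commsum tw1 j i = \prod_(q <- [::]) commsum (tw_quad q) j i.
  rewrite big_nil /commsum /gauss (big_pred1 0) => [|x]; last first.
    by rewrite [x]ord1 mul0rn !eqxx.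
  rewrite (big_pred1 0) => [|x]; last by rewrite [x]ord1 mul0rn !eqxx.
  by [].
elim: chi => [//|q chi IH]; rewrite -(commsum_iso _ _ (tw_chi_cons q chi)).
by rewrite commsum_prod IH big_cons.
Qed.

Lemma tors_count_qiso S S' n : qiso S S' -> tors_count S n = tors_count S' n.
Proof. by move=> [h [hb _ _]]; exact: tors_count_iso hb. Qed.

Lemma tors_count_chi chi n :
  tors_count (tw_chi chi) n = (\prod_(q <- chi) tors_count (tw_quad q) n)%N.
Proof.
have s1 : tors_count tw1 n = (\prod_(q <- [::]) tors_count (tw_quad q) n)%N.
  rewrite big_nil; apply: eq_card1 (0 : tw1) _ _ => x.
  by rewrite [x]ord1 !inE mul0rn !eqxx.
elim: chi => [//|q chi IH]; rewrite -(tors_count_qiso _ (tw_chi_cons q chi)).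
by rewrite tors_count_tw_prod IH big_cons.
Qed.

Lemma tors_count_D k l b b' n : tors_count (tw_D k l b b') n =
  (tors_count ('Z_(2 ^ k)) n * tors_count ('Z_(2 ^ l)) n)%N.
Proof.
rewrite /tors_count -cardX.
by apply: eq_card => -[x y]; rewrite !inE prod_mulrn -pair_eqE.
Qed.

(** One of the two orders being larger than two, the elements of order at most
    two have an even product of coordinates, so the form mu of D(2^k, 2^l; 1, 1)
    is trivial on the 2-torsion. *)
Lemma sqsum_D_gt0 k l j i : (k, l) != (0, 0)%N ->
  0 < sqsum (tw_D k.+1 l.+1 false false) j i.
Proof.
move=> kl; apply: gauss_pos => x xj _.
have x2 := tors_half xj; rewrite /halfsq sq_D //= !addbF.
move: (x *+ _) x2 => -[z1 z2]; rewrite prod_mulrn => /pair_eq0/=[h1 h2].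
have e1 := @Z2_odd_tors2 k z1 h1; have e2 := @Z2_odd_tors2 l z2 h2.
by rewrite oddM e1 e2; move: kl; rewrite xpair_eqE => /negbTE;
  case: (k == 0)%N; case: (l == 0)%N; rewrite ?andbF.
Qed.

Lemma Z2_val1 k : (1 : 'Z_(2 ^ k.+1)) = 1%N :> nat.
Proof. by rewrite -[1]/(1%:R) Z2_val_nat modn_small // exp2_gt1. Qed.

Lemma comm_D_gen k l b b' (x : tw_D k.+1 l.+1 b b') :
  comm x (1, 0) = odd x.2 /\ comm x (0, 1) = odd x.1.
Proof. by rewrite !comm_D /fst /snd !Z2_val1 !muln1 !muln0 mul0n mul1n addbF. Qed.

Lemma sqsum_D11_00 b b' :
  sqsum (tw_D 1 1 b b') 0 0 = if b && b' then - 2%:R else 2%:R.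
Proof.
rewrite /sqsum /gauss /=.
rewrite (eq_bigr (fun x => (-1) ^+ (@sq (tw_D 1 1 b b') x))); last first.
  move=> x _; rewrite (big_pred1 0) => [|y]; last by [].
  by rewrite comm0r addbF /halfsq.
have sE (F : tw_D 1 1 b b' -> int) :
    \sum_(x : tw_D 1 1 b b' | x *+ 2 == 0) F x =
    \sum_(x1 : 'Z_(2 ^ 1)) \sum_(x2 : 'Z_(2 ^ 1)) F (x1, x2).
  rewrite pair_big /=; apply: (@eq_big _ _ _ (tw_D 1 1 b b')) => [[x1 x2]|[x1 x2] _] //.
  rewrite prod_mulrn; have e1 := Z2_exp x1; have e2 := Z2_exp x2.
  by rewrite /= -[x1 *+ 2]/(x1 *+ (2 ^ 1)) -[x2 *+ 2]/(x2 *+ (2 ^ 1)) e1 e2 eqxx.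
rewrite sE !big_ord_recl !big_ord0.
by case: (b) (b') => -[].
Qed.

Lemma sqsum_D11 b b' j i : ~~ (b && b') -> 0 < sqsum (tw_D 1 1 b b') j i.
Proof.
move=> bb'; have t2 (a : 'Z_(2 ^ 1)) n : a *+ (2 ^ n.+1) = 0.
  by rewrite (expnS 2 n) mulrnA (Z2_exp a) mul0rn.
case: j => [|j]; last first.
  apply: gauss_pos => x _ _; rewrite /halfsq; set y := _ *+ _.
  suff -> : y = 0 by rewrite sq0.
  by rewrite /y prod_mulrn; congr pair; exact: t2.
case: i => [|i]; last first.
  apply: gauss_pos => x _ xo; rewrite /halfsq.
  suff -> : x = 0 by rewrite mul0rn sq0.
  have := xo (1, 0); have := xo (0, 1).
  have [-> ->] := comm_D_gen x.
  rewrite !prod_mulrn !t2 => /(_ erefl) + /(_ erefl).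
  case: x {xo} => x1 x2 /= e1 e2.
  have z2 (a : 'Z_(2 ^ 1)) : odd a = false -> a = 0.
    by case: a => -[|[|//]] // ? _; exact: val_inj.
  by rewrite (z2 x1 e1) (z2 x2 e2).
by rewrite sqsum_D11_00 (negPf bb').
Qed.

Lemma sqsum_H4 : sqsum (tw_D 1 1 true true) 0 0 < 0.
Proof. by rewrite sqsum_D11_00. Qed.

Lemma tw_D_swap k l b b' : qiso (tw_D k.+1 l.+1 b b') (tw_D l.+1 k.+1 b' b).
Proof.
apply: (@qisoI (tw_D k.+1 l.+1 b b') (tw_D l.+1 k.+1 b' b) (fun x => (x.2, x.1))) => //.
- by exists (fun x => (x.2, x.1)) => -[].
- move=> x y; rewrite !comm_D /= addbC.
  by congr (odd _ (+) odd _); exact: mulnC.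
- move=> [x1 x2] x0; have y0 : ((x2, x1) : tw_D l.+1 k.+1 b' b) *+ 2 = 0.
    by move: x0; rewrite !prod_mulrn => /pair_eq0/=[-> ->].
  rewrite (sq_D x0) (sq_D y0) /= mulnC.
  by case: odd; case: (b && _); case: (b' && _).
Qed.

Lemma half_power m j : (j <= m)%N ->
  exists2 a : 'Z_(2 ^ m.+1), a *+ (2 ^ j) = Z2half & a *+ (2 ^ j.+1) = 0.
Proof.
move=> jm; have aj : (2 ^ (m - j))%:R *+ (2 ^ j) = @Z2half m.
  by rewrite -mulrnA -expnD subnK.
by exists (2 ^ (m - j))%:R => //; rewrite (expnSr 2 j) mulrnA aj Z2_half2.
Qed.

Lemma Z2_exp_le m j (a : 'Z_(2 ^ m.+1)) : (m < j)%N -> a *+ (2 ^ j) = 0.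
Proof.
move=> mj; have -> : (2 ^ j = 2 ^ m.+1 * 2 ^ (j - m.+1))%N by rewrite -expnD subnKC.
by rewrite mulrnA Z2_exp mul0rn.
Qed.

Section CyclicSums.
Variables (m : nat) (i : nat).

Lemma halfsq_C j (x : tw_C (2 ^ m.+1)) :
  x *+ (2 ^ j.+1) = 0 -> halfsq j x = (x *+ (2 ^ j) != 0).
Proof. by move=> /tors_half xj; exact: sq_C. Qed.

Lemma sqsum_C_eq0 j : (j <= m)%N -> sqsum (tw_C (2 ^ m.+1)) j i = 0.
Proof.
move=> jm; have [a aj aj1] := half_power jm.
apply: (@gauss_zero _ _ _ _ (a : tw_C (2 ^ m.+1))) => //.
- by apply: halfsqD => x y _ _; exact: comm_C.
- by rewrite halfsq_C // aj Z2half_neq0.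
- by move=> y _; exact: comm_C.
Qed.

Lemma sqsum_C_gt0 j : (m < j)%N -> 0 < sqsum (tw_C (2 ^ m.+1)) j i.
Proof.
move=> mj; apply: gauss_pos => x _ _; rewrite /halfsq.
by have -> : x *+ (2 ^ j) = 0; [exact: Z2_exp_le | exact: sq0].
Qed.

End CyclicSums.

Section OddSums.
Variables (k l : nat).
Hypothesis kl : (k, l) != (0, 0)%N.
Let S := tw_D k.+1 l.+1 true false.

Lemma D_tors2_even (x : D_grp k.+1 l.+1) : x *+ 2 = 0 ->
  odd x.1 && odd x.2 = false.
Proof.
case: x => x1 x2; rewrite prod_mulrn => /pair_eq0/=[h1 h2].
have e1 := @Z2_odd_tors2 k x1 h1; have e2 := @Z2_odd_tors2 l x2 h2.
rewrite e1 e2; move: kl; rewrite xpair_eqE => /negbTE.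
by case: (k == 0)%N; case: (l == 0)%N; rewrite ?andbF.
Qed.

Lemma D_tors2_comm (x y : S) : x *+ 2 = 0 -> y *+ 2 = 0 -> comm x y = false.
Proof.
move=> x2' y2'; rewrite comm_D; case: x y x2' y2' => x1 x2 [y1 y2].
rewrite !prod_mulrn => /pair_eq0/=[h1 h2] /pair_eq0/=[h3 h4].
have e1 := @Z2_odd_tors2 k x1 h1; have e2 := @Z2_odd_tors2 l x2 h2.
have e3 := @Z2_odd_tors2 k y1 h3; have e4 := @Z2_odd_tors2 l y2 h4.
rewrite !oddM e1 e2 e3 e4; move: kl; rewrite xpair_eqE => /negbTE.
by case: (k == 0)%N; case: (l == 0)%N; rewrite ?andbF.
Qed.

Lemma halfsq_D j (x : S) :
  x *+ (2 ^ j.+1) = 0 -> halfsq j x = (x.1 *+ (2 ^ j) != 0).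
Proof.
move=> /tors_half xj; rewrite /halfsq sq_D // oddM andbC D_tors2_even // addbF.
by case: x xj => x1 x2 _; rewrite prod_mulrn.
Qed.

Lemma halfsq_D_add j (x y : S) : x *+ (2 ^ j.+1) = 0 -> y *+ (2 ^ j.+1) = 0 ->
  halfsq j (x + y) = halfsq j x (+) halfsq j y.
Proof. by apply: halfsqD; exact: D_tors2_comm. Qed.

Lemma sqsum_D_eq0 j : (j <= k)%N -> sqsum S j 0 = 0.
Proof.
move=> jk; have [a aj aj1] := half_power jk.
have a0 : ((a, 0) : S) *+ (2 ^ j.+1) = 0 by rewrite prod_mulrn aj1 mul0rn.
apply: (@gauss_zero S _ _ _ (a, 0)) => //.
- exact: halfsq_D_add.
- by rewrite halfsq_D // aj Z2half_neq0.
- by move=> y y0; rewrite [y]y0 comm0r.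
Qed.

Lemma sqsum_D_gt j : (k < j)%N -> 0 < sqsum S j 0.
Proof.
move=> kj; apply: gauss_pos => x xj _; rewrite halfsq_D //.
by have -> : x.1 *+ (2 ^ j) = 0; [exact: Z2_exp_le | rewrite eqxx].
Qed.

Lemma sqsum_D_partner0 i : (i <= l)%N -> sqsum S k i = 0.
Proof.
move=> il; have a0 : ((1, 0) : S) *+ (2 ^ k.+1) = 0.
  by rewrite prod_mulrn (Z2_exp (1 : 'Z_(2 ^ k.+1))) mul0rn.
apply: (@gauss_zero S _ _ _ (1, 0)) => //.
- exact: halfsq_D_add.
- rewrite halfsq_D //= -[1 *+ _]/(@Z2half k); exact: Z2half_neq0.
- move=> y yi; rewrite commC; have [-> _] := comm_D_gen y.
  apply: (@Z2half_inj l _ false); rewrite -Z2_mul_half.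
  case: y yi => y1 y2; rewrite prod_mulrn => /pair_eq0/=[_ y2i].
  have -> : (2 ^ l = 2 ^ i * 2 ^ (l - i))%N by rewrite -expnD subnKC.
  by rewrite mulrnA y2i mul0rn.
Qed.

Lemma sqsum_D_partner_gt i : (l < i)%N -> 0 < sqsum S k i.
Proof.
move=> li; apply: gauss_pos => x xk xo; rewrite halfsq_D //.
have := xo (0, 1); have [_ ->] := comm_D_gen x.
rewrite prod_mulrn (Z2_exp_le (1 : 'Z_(2 ^ l.+1)) li) mul0rn => /(_ erefl) xe.
have := @Z2_mul_half k x.1; rewrite xe mulr0n => ->.
by rewrite eqxx.
Qed.

End OddSums.

(** * Ranks of the commutation form *)

Lemma Z2_tors_even k j (a : 'Z_(2 ^ k.+1)) : (j <= k)%N -> a *+ (2 ^ j) = 0 ->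
  odd a = false.
Proof.
move=> jk aj; apply: (@Z2half_inj k _ false); rewrite -Z2_mul_half.
have -> : (2 ^ k = 2 ^ j * 2 ^ (k - j))%N by rewrite -expnD subnKC.
by rewrite mulrnA aj mul0rn.
Qed.

Definition pairing_sum k l j i : int :=
  \sum_(a : 'Z_(2 ^ k.+1) | a *+ (2 ^ j) == 0)
  \sum_(c : 'Z_(2 ^ l.+1) | c *+ (2 ^ i) == 0) (-1) ^+ (odd a && odd c).

(** The pairing is trivial between the two torsion subgroups unless both contain
    a generator; then the sum over c vanishes for half of the a. *)
Lemma pairing_sumE k l j i : (2 ^ ((k < j) && (l < i)))%N%:R * pairing_sum k l j i =
  (tors_count ('Z_(2 ^ k.+1)) (2 ^ j) * tors_count ('Z_(2 ^ l.+1)) (2 ^ i))%N%:R.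
Proof.
have even_case : (forall a : 'Z_(2 ^ k.+1), a *+ (2 ^ j) == 0 ->
    forall c : 'Z_(2 ^ l.+1), c *+ (2 ^ i) == 0 -> odd a && odd c = false) ->
  pairing_sum k l j i =
    (tors_count ('Z_(2 ^ k.+1)) (2 ^ j) * tors_count ('Z_(2 ^ l.+1)) (2 ^ i))%N%:R.
  move=> ev; rewrite /pairing_sum.
  rewrite (eq_bigr (fun=> (tors_count ('Z_(2 ^ l.+1)) (2 ^ i))%:R)); last first.
    move=> a a0; rewrite (eq_bigr (fun=> 1)) ?sumr_const // => c c0.
    by rewrite ev.
  by rewrite sumr_const -mulrnA mulnC.
have [kj|jk] := ltnP k j; last first.
  by rewrite mul1r even_case // => a /eqP a0 c _; rewrite (Z2_tors_even jk a0).
have [li|il] := ltnP l i; last first.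
  by rewrite mul1r even_case // => a _ c /eqP c0; rewrite (Z2_tors_even il c0) andbF.
have all0 m n (a : 'Z_(2 ^ m.+1)) : (m < n)%N -> a *+ (2 ^ n) == 0.
  by move=> mn; rewrite Z2_exp_le.
have tc m n : (m < n)%N -> tors_count ('Z_(2 ^ m.+1)) (2 ^ n) = #|'Z_(2 ^ m.+1)|.
  by move=> mn; apply: eq_card => a; rewrite !inE all0.
have flip m : \sum_(a : 'Z_(2 ^ m.+1)) (-1) ^+ odd a = 0 :> int.
  apply: (sum_sign0 (x0 := 1)) => // a _; rewrite Z2_oddD Z2_val1.
  exact: addTb.
rewrite !tc // expn1 /pairing_sum mulr_sumr (eq_bigl predT) => [|a]; last exact: all0.
rewrite (eq_bigr (fun a : 'Z_(2 ^ k.+1) => #|'Z_(2 ^ l.+1)|%:R * (1 + (-1) ^+ odd a))).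
  by rewrite -mulr_sumr big_split /= flip addr0 sumr_const -natrM mulnC.
move=> a _; rewrite (eq_bigl predT) => [|c]; last exact: all0.
case: (odd a) => /=; first by rewrite flip mulr0 subrr mulr0.
by rewrite sumr_const expr0 mulrC.
Qed.

Lemma commsum_D k l b b' j i : commsum (tw_D k.+1 l.+1 b b') j i =
  pairing_sum k l j i * pairing_sum l k j i.
Proof.
rewrite /commsum /gauss /pairing_sum big_distrlr [RHS]pair_big /=.
apply: (@eq_big _ _ _ (tw_D k.+1 l.+1 b b')) => [[a c]|[a c] _] /=.
  by rewrite prod_mulrn -pair_eqE.
rewrite [RHS]mulrC [RHS]big_distrlr [RHS]pair_big /=.
apply: (@eq_big _ _ _ (tw_D k.+1 l.+1 b b')) => [[a' c']|[a' c'] _] /=.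
  by rewrite prod_mulrn -pair_eqE.
rewrite comm_D /= signr_addb !oddM.
by rewrite [odd c' && _]andbC.
Qed.

Definition shape (q : quadruple) : nat * nat := (q.1.1.1, q.1.1.2).

Definition shape_rank j i (s : nat * nat) : nat :=
  ((s.1 <= j) && (s.2 <= i) + (s.2 <= j) && (s.1 <= i))%N.

Definition chi_rank (chi : seq quadruple) j i := (\sum_(q <- chi) shape_rank j i (shape q))%N.

Lemma commsum_chiE chi j i : is_characteristic chi ->
  (2 ^ chi_rank chi j i)%N%:R * commsum (tw_chi chi) j i =
  (tors_count (tw_chi chi) (2 ^ j) * tors_count (tw_chi chi) (2 ^ i))%N%:R.
Proof.
rewrite /chi_rank commsum_chi !tors_count_chi.
elim: chi => [|[[[k l] b] b'] chi IH]; first by rewrite !big_nil.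
rewrite /= => /andP[/andP[k1 kl]] /IH {}IH; rewrite !big_cons.
have {kl} l1 := leq_trans k1 kl; case: k k1 => // k _; case: l l1 => // l _.
rewrite mulnACA natrM -IH expnD natrM mulrACA; congr (_ * _).
rewrite /tw_quad !tors_count_D commsum_D /shape_rank /shape /= expnD natrM.
rewrite mulrACA pairing_sumE [((l < j) && (k < i))%N]/(_ && _) pairing_sumE.
by rewrite -natrM mulnACA; congr (_ * _)%N%:R; exact: mulnC.
Qed.

(** Each of the two summands of shape_rank is the indicator of a quadrant, whose
    second difference is the indicator of its corner. *)
Lemma chi_rank_second_difference chi j i :
  (chi_rank chi j.+1 i.+1 + chi_rank chi j i =
   chi_rank chi j i.+1 + chi_rank chi j.+1 i +
   \sum_(q <- chi) ((shape q == (j.+1, i.+1)) + (shape q == (i.+1, j.+1))))%N.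
Proof.
rewrite /chi_rank -!big_split /=; apply: eq_bigr => -[[[k l] b] b'] _.
rewrite /shape_rank /shape /= !xpair_eqE.
have h a c : (a <= c.+1)%N = (a <= c)%N || (a == c.+1) by rewrite orbC -leq_eqVlt.
have x a c : (a == c.+1)%N -> (a <= c)%N = false.
  by move=> /eqP->; rewrite ltnn.
rewrite !h; move: (x k j) (x k i) (x l j) (x l i).
by do 4!case: (_ == _.+1); do 4!case: (_ <= _)%N => //=;
  do ?[by move=> /(_ isT)|move=> ?|move=> _].
Qed.

Lemma rank_shape chi chi' : is_characteristic chi -> is_characteristic chi' ->
    (forall j i, chi_rank chi j i = chi_rank chi' j i) ->
  perm_eq (map shape chi) (map shape chi').
Proof.
move=> cchi cchi' r.
have sorted_shape X s : is_characteristic X -> s \in map shape X -> (0 < s.1 <= s.2)%N.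
  by move=> /allP cX /mapP[[[[k l] b] b'] /cX h ->].
have cnt X s : (\sum_(q <- X) (shape q == s))%N = count_mem s (map shape X).
  by rewrite count_map -sum1_count [RHS]big_mkcond.
have E j i : (count_mem (j.+1, i.+1) (map shape chi) +
              count_mem (i.+1, j.+1) (map shape chi) =
              count_mem (j.+1, i.+1) (map shape chi') +
              count_mem (i.+1, j.+1) (map shape chi'))%N.
  rewrite -!cnt -!big_split /=; apply/eqP.
  rewrite -(eqn_add2l (chi_rank chi j i.+1 + chi_rank chi j.+1 i)).
  by rewrite -chi_rank_second_difference !r -chi_rank_second_difference.
apply/allP => -[j i]; rewrite mem_cat => ji /=.
have /andP[/= j0 jlei] : (0 < (j, i).1 <= (j, i).2)%N.
  by case/orP: ji; apply: sorted_shape.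
have i0 := leq_trans j0 jlei; case: j i j0 i0 jlei {ji} => // j [//|i] _ _ ji.
have := E j i; move: ji; rewrite leq_eqVlt => /predU1P[[->]|ij].
  by rewrite !addnn => /double_inj->.
have no X : is_characteristic X -> count_mem (i.+1, j.+1) (map shape X) = 0%N.
  move=> cX; apply/count_memPn; apply/negP => /(sorted_shape _ _ cX) /=.
  by rewrite leqNgt ij.
by rewrite !no // !addn0 => ->.
Qed.

Lemma shape_tors_count chi chi' n : perm_eq (map shape chi) (map shape chi') ->
  tors_count (tw_chi chi) n = tors_count (tw_chi chi') n.
Proof.
have E X : tors_count (tw_chi X) n = (\prod_(s <- map shape X)
    (tors_count ('Z_(2 ^ s.1)) n * tors_count ('Z_(2 ^ s.2)) n))%N.
  rewrite tors_count_chi big_map; apply: eq_bigr => -[[[k l] b] b'] _.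
  exact: tors_count_D.
by move=> P; rewrite !E (perm_big _ P).
Qed.

(** * Finite abelian groups with equally many torsion elements *)

Lemma order_mulrn (T : finZmodType) (x : T) n : (x *+ n == 0) = (#[x]%g %| n)%N.
Proof. by rewrite order_dvdn FinRing.zmodXgE. Qed.

Lemma exists_exponent (T : finZmodType) : exists N (x : T),
  (0 < N)%N /\ (forall y : T, y *+ N = 0) /\ (forall n, x *+ n = 0 -> (N %| n)%N).
Proof.
have nT : nilpotent [set: T] := abelian_nil (FinRing.zmod_abelian _).
have [x _ ex] := exponent_witness nT; exists (exponent [set: T]), x; split; first exact: exponent_gt0.
split.
  by move=> y; apply/eqP; rewrite order_mulrn dvdn_exponent ?inE.
by move=> n /eqP; rewrite order_mulrn ex.
Qed.

Lemma exponent_count (T : finZmodType) N : (forall y : T, y *+ N = 0) <->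
  tors_count T N = #|T|.
Proof.
split=> [TN|TN y]; first by apply: eq_card => y; rewrite !inE TN eqxx.
have : y \in [pred y : T | y *+ N == 0] by rewrite (elimT (subset_cardP TN) (subset_predT _)).
by rewrite inE => /eqP.
Qed.

(** A cyclic subgroup of maximal order is a direct summand, because the
    identification of the subgroup with Z/N extends to the whole group. *)
Lemma split_exponent (T : finZmodType) N (x : T) : (1 < N)%N ->
    (forall y : T, y *+ N = 0) -> (forall n, x *+ n = 0 -> (N %| n)%N) ->
  exists (phi : {additive T -> 'Z_N}) (f : {additive ('Z_N * ker phi)%type -> T}),
    bijective f.
Proof.
move=> N1 TN xN.
have pD : {morph (fun i : 'Z_N => x *+ i) : i j / i + j}.
  move=> i j; rewrite /= [X in (_ %% X)%N]Zp_cast // -mulrnDr.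
  by rewrite [in RHS](divn_eq (i + j) N) mulrnDr mulrnA TN add0r.
have xinj (i : 'Z_N) : x *+ i = 0 -> i = 0.
  move=> /xN Ni; have := ltn_ord i; rewrite [X in (_ < X)%N]Zp_cast // => iN.
  apply: ord_inj; apply/eqP; move: Ni; apply: contraTT; rewrite -lt0n => i0.
  by rewrite gtnNdvd.
pose G := [set (x *+ i, i) | i : 'Z_N] : {set T * 'Z_N}.
have [|||phi phiE] := @char_ext T _ N1 G.
- by apply/imsetP; exists 0.
- move=> _ _ /imsetP[i _ ->] /imsetP[j _ ->]; apply/imsetP; exists (i - j) => //.
  congr pair; apply: (addIr (x *+ j)); by rewrite -pD !subrK.
- by move=> t a /imsetP[i _ [ti ->]]; apply: xinj; rewrite -ti TN.
have phix (i : 'Z_N) : phi (x *+ i) = i.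
  by apply: (phiE (x *+ i, i)); apply/imsetP; exists i.
exists phi; have [|f fE] := @additive_of ('Z_N * ker phi)%type T
    (fun z => x *+ z.1 + ker_val z.2).
  by move=> [i y] [i' y']; rewrite /= pD addrACA; congr (_ + _); exact: ker_valD.
exists f; apply: bij_eq1 (fsym fE); apply: split_bij pD _ => i.
by rewrite phix.
Qed.

Lemma zmod_iso_trans (G1 G2 G3 : zmodType) :
  zmod_iso G1 G2 -> zmod_iso G2 G3 -> zmod_iso G1 G3.
Proof.
move=> [f fb] [g gb]; exists (g \o f : {additive _ -> _}); exact: bij_comp.
Qed.

Lemma zmod_iso_sym (G1 G2 : zmodType) : zmod_iso G1 G2 -> zmod_iso G2 G1.
Proof.
move=> [f [g fK gK]]; have [|h hE] := @additive_of G2 G1 g.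
  by move=> x y; apply: (can_inj fK); rewrite raddfD !gK.
by exists h; apply: bij_eq1 (fsym hE); exists f.
Qed.

Lemma zmod_iso_prod (G1 G2 H1 H2 : zmodType) : zmod_iso G1 H1 -> zmod_iso G2 H2 ->
  zmod_iso (G1 * G2)%type (H1 * H2)%type.
Proof.
move=> [f [f' fK f'K]] [g [g' gK g'K]].
have [|h hE] := @additive_of (G1 * G2)%type (H1 * H2)%type (fun x => (f x.1, g x.2)).
  by move=> x y; congr pair; rewrite /= raddfD.
exists h; apply: bij_eq1 (fsym hE).
by exists (fun x => (f' x.1, g' x.2)) => -[x y] /=; rewrite ?fK ?gK ?f'K ?g'K.
Qed.

(** The exponent N can be read off the numbers of torsion elements. Both groups
    have a summand Z/N, and the complements again have equally many torsion
    elements. *)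
Theorem tors_count_zmod_iso (G G' : finZmodType) :
  (forall n, tors_count G n = tors_count G' n) -> zmod_iso G G'.
Proof.
have [n] := ubnP #|G|; elim: n G G' => // n IH G G' Gn tG.
have cG : #|G| = #|G'|.
  have kill (T : finZmodType) m : (#|T| %| m)%N -> forall y : T, y *+ m = 0.
    by move=> /dvdnP[c ->] y; rewrite mulnC mulrnA mulrn_card mul0rn.
  rewrite -(exponent_count G (#|G| * #|G'|)%N).1; last first.
    by apply: kill; rewrite dvdn_mulr.
  rewrite tG; apply/exponent_count; apply: kill; exact: dvdn_mull.
have [N [x [N0 [GN xN]]]] := exists_exponent G.
have [N' [x' [_ [GN' xN']]]] := exists_exponent G'.
have NN' : N = N'.
  apply/eqP; rewrite eqn_dvd; apply/andP; split.
    by apply: xN; move: x; apply/exponent_count; rewrite tG cG; apply/exponent_count.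
  by apply: xN'; move: x'; apply/exponent_count; rewrite -tG -cG; apply/exponent_count.
subst N'; have [N1|N1] := leqP N 1.
  have one (T : finZmodType) : (forall y : T, y *+ N = 0) -> forall y : T, y = 0.
    have -> : N = 1%N by apply/eqP; rewrite eqn_leq N1.
    by [].
  have [|h hE] := @additive_of G G' (fun=> 0); first by move=> ? ? /=; rewrite addr0.
  exists h; exists (fun=> 0) => y; first by rewrite (one _ GN y).
  by rewrite (one _ GN' y) hE.
have [phi [f fb]] := split_exponent N1 GN xN.
have [phi' [f' f'b]] := split_exponent N1 GN' xN'.
have fi : zmod_iso G (('Z_N) * ker phi)%type by apply: zmod_iso_sym; exists f.
have f'i : zmod_iso (('Z_N) * ker phi')%type G' by exists f'.
have : zmod_iso (ker phi) (ker phi').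
  apply: IH => [|m].
    rewrite ltnS in Gn; apply: leq_trans Gn; rewrite -(bij_eq_card fb) card_prod.
    rewrite ltn_Pmull ?card_ord //; by apply/card_gt0P; exists 0.
  have [g gb] := fi; have [g' g'b] := zmod_iso_sym f'i.
  have := tG m; rewrite (tors_count_prod _ gb) (tors_count_prod _ g'b).
  by move/eqP; rewrite eqn_pmul2l ?tors_count_gt0 // => /eqP.
move=> kk; apply: zmod_iso_trans fi _; apply: zmod_iso_trans f'i.
by apply: zmod_iso_prod kk; exists idfun; exists id.
Qed.

(** * Uniqueness of the normal form *)

Definition plus_of (s : nat * nat) : quadruple := (s.1, s.2, false, false).

Lemma plus_chi_shape chi : plus_chi chi -> map plus_of (map shape chi) = chi.
Proof.
elim: chi => //= -[[[k l] b] b'] chi IH /andP[/and4P[_ _ /negPf-> /negPf->]].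
by move=> /IH->.
Qed.

Lemma num_minus_cons k l b b' chi :
  num_minus ((k, l, b, b') :: chi) = (b + b' + num_minus chi)%N.
Proof. by rewrite /num_minus big_cons. Qed.

Lemma num_minus0_plus chi : is_characteristic chi -> num_minus chi = 0%N ->
  plus_chi chi.
Proof.
elim: chi => // -[[[k l] b] b'] chi IH /= /andP[kl /IH {}IH].
by rewrite num_minus_cons; case: b => //; case: b' => // /IH ->; rewrite /= !andbT.
Qed.

Lemma num_minus1_split chi : is_characteristic chi -> num_minus chi = 1%N ->
  exists k l b r, [/\ perm_eq chi ((k, l, b, ~~ b) :: r), (0 < k <= l)%N & plus_chi r].
Proof.
elim: chi => [|[[[k l] b] b'] chi IH] /=; first by rewrite /num_minus big_nil.
move=> /andP[kl cchi]; rewrite num_minus_cons.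
case: b => [|]; case: b' => //; rewrite ?add0n ?add1n.
- by move=> [/(num_minus0_plus cchi) pchi]; exists k, l, true, chi.
- by move=> [/(num_minus0_plus cchi) pchi]; exists k, l, false, chi.
move=> /(IH cchi)[k' [l' [b [r [pr kl' plr]]]]].
exists k', l', b, ((k, l, false, false) :: r); split=> //; last first.
  by rewrite /= !andbT kl.
apply: perm_trans (_ : perm_eq _ ((k, l, false, false) :: (k', l', b, ~~ b) :: r)) _.
  by rewrite perm_cons.
by apply/seq.permP => a /=; rewrite addnCA.
Qed.

Lemma plus_special_false chi : plus_chi chi -> has special chi = false.
Proof. by case/plus_chiP. Qed.

Lemma special_cons k l b : (k <= l)%N ->
  special (k, l, b, ~~ b) = (l <= 1)%N && (0 < k)%N.
Proof.
move=> kl; rewrite /special !inE !xpair_eqE.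
case: b; rewrite /= ?andbF ?andbT ?orbF /=.
all: case: k kl => [|[|k]] kl; case: l kl => [|[|l]] //=.
Qed.

Lemma even_chi_split chi : even_chi chi ->
  plus_chi chi \/ exists q r, [/\ perm_eq chi (q :: r), special q & plus_chi r].
Proof.
move=> /andP[cchi /orP[/eqP n0|/andP[/eqP n1 sp]]].
  by left; apply: num_minus0_plus.
right; have [k [l [b [r [pr kl plr]]]]] := num_minus1_split cchi n1.
exists (k, l, b, ~~ b), r; split=> //.
by move: sp; rewrite (perm_has _ pr) /= plus_special_false // orbF.
Qed.

Lemma even_chi_same chi : even_chi chi -> exists chi0,
  [/\ plus_chi chi0, same_chi chi chi0 & perm_eq (map shape chi) (map shape chi0)].
Proof.
move=> /even_chi_split[pchi|[q [r [pr sq plr]]]].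
  by exists chi; split=> //; exact: same_perm.
exists ((1%N, 1%N, false, false) :: r); split=> //.
  exact: same_trans (same_perm pr) (same_special _ sq).
rewrite (permPl (perm_map _ pr)) /= (_ : shape q = (1, 1)%N) //.
by move: sq; rewrite /special !inE => /orP[]/eqP->.
Qed.

Lemma same_chi_even chi chi' : even_chi chi -> even_chi chi' ->
  perm_eq (map shape chi) (map shape chi') -> same_chi chi chi'.
Proof.
move=> /even_chi_same[c [pc sc pmc]] /even_chi_same[c' [pc' sc' pmc']] P.
apply: same_trans sc (same_trans _ (same_sym sc')).
apply: same_perm; rewrite -(plus_chi_shape pc) -(plus_chi_shape pc').
apply: perm_map; rewrite -(permPl pmc); exact: perm_trans P pmc'.
Qed.

(** The quadruple whose negative generator has order 2^(m+1) and whose positive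
    generator has order 2^(n+1). *)
Definition odd_quad (m n : nat) (q : quadruple) : Prop :=
  q = (m.+1, n.+1, true, false) /\ (m <= n)%N \/
  q = (n.+1, m.+1, false, true) /\ (n <= m)%N.

Lemma odd_chi_split chi : odd_chi chi -> exists m n q r,
  [/\ perm_eq chi (q :: r), odd_quad m n q, (m, n) != (0, 0)%N & plus_chi r].
Proof.
move=> /and3P[cchi /eqP n1 nsp].
have [k [l [b [r [pr /andP[k0 kl] plr]]]]] := num_minus1_split cchi n1.
move: nsp; rewrite (perm_has _ pr) /= negb_or special_cons // k0 andbT -ltnNge.
move=> /andP[l1 _].
case: k k0 kl pr => // k _; case: l l1 => // l l1 kl pr.
have l0 : l != 0%N by rewrite -lt0n.
case: b pr => pr.
  exists k, l, (k.+1, l.+1, true, false), r; split=> //; first by left.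
  by rewrite xpair_eqE (negPf l0) andbF.
exists l, k, (k.+1, l.+1, false, true), r; split=> //; first by right.
by rewrite xpair_eqE (negPf l0).
Qed.

Lemma same_chi_odd m n q q' r r' chi chi' :
    odd_quad m n q -> odd_quad m n q' -> plus_chi r -> plus_chi r' ->
    perm_eq chi (q :: r) -> perm_eq chi' (q' :: r') ->
    perm_eq (map shape chi) (map shape chi') ->
  same_chi chi chi'.
Proof.
move=> oq oq' pr pr' P P' S.
have sqq : shape q = shape q'.
  case: oq oq' => -[-> mn] [] [-> nm] //; rewrite /shape /=.
    by have -> : m = n by apply/eqP; rewrite eqn_leq mn.
  by have -> : m = n by apply/eqP; rewrite eqn_leq mn nm.
have rr : perm_eq r r'.
  rewrite -(plus_chi_shape pr) -(plus_chi_shape pr'); apply: perm_map.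
  rewrite -(perm_cons (shape q)); have := perm_map shape P'; rewrite /= -sqq.
  apply: perm_trans; apply: perm_trans S.
  by rewrite perm_sym; exact: (perm_map shape P).
apply: same_trans (same_perm P) _; apply: same_trans (same_sym (same_perm P')).
apply: same_trans (same_perm (_ : perm_eq (q :: r) (q :: r'))) _.
  by rewrite perm_cons.
case: oq oq' {P P' sqq} => -[-> mn] [] [-> nm].
- exact: same_perm (perm_refl _).
- have -> : m = n by apply/eqP; rewrite eqn_leq mn.
  exact: same_sym (same_swap _ _).
- have -> : m = n by apply/eqP; rewrite eqn_leq mn nm.
  exact: same_swap.
- exact: same_perm (perm_refl _).
Qed.

Lemma sqsum_plus chi j i : plus_chi chi -> 0 < sqsum (tw_chi chi) j i.
Proof.
rewrite sqsum_chi; elim: chi => [|[[[k l] b] b'] chi IH] /=.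
  by rewrite big_nil.
move=> /andP[/and4P[k0 kl /negPf-> /negPf->] /IH h]; rewrite big_cons mulr_gt0 //.
have l0 := leq_trans k0 kl; case: k l k0 kl l0 => // k [] // l _ _ _ /=.
have [[-> ->]|kl] := eqVneq (k, l) (0, 0)%N; first exact: sqsum_D11.
exact: sqsum_D_gt0.
Qed.

Lemma sqsum_chi_perm chi q r j i : perm_eq chi (q :: r) ->
  sqsum (tw_chi chi) j i = sqsum (tw_quad q) j i * sqsum (tw_chi r) j i.
Proof. by move=> P; rewrite !sqsum_chi (perm_big _ P) big_cons. Qed.

Lemma sqsum_even chi j i : even_chi chi -> 0 < sqsum (tw_chi chi) j i.
Proof.
move=> /even_chi_split[pchi|[q [r [pr sq plr]]]]; first exact: sqsum_plus.
rewrite (sqsum_chi_perm _ _ pr) mulr_gt0 ?sqsum_plus //.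
by move: sq; rewrite /special !inE => /orP[]/eqP->; exact: sqsum_D11.
Qed.

Lemma sqsum_odd_quad m n q j i : odd_quad m n q ->
  sqsum (tw_quad q) j i = sqsum (tw_D m.+1 n.+1 true false) j i.
Proof. by case=> -[-> _] //=; apply: sqsum_iso; exact: tw_D_swap. Qed.

Definition extra (p : item) : twist :=
  match p with
  | Item1 _ _ => tw1
  | Item2 m _ _ => tw_C (2 ^ m)
  | Item3 _ _ => tw_D 1 1 true true
  end.

Definition chi_of p :=
  match p with Item1 chi _ => chi | Item2 _ chi _ => chi | Item3 chi _ => chi end.
Definition grp_of p :=
  match p with Item1 _ G => G | Item2 _ _ G => G | Item3 _ G => G end.

Lemma tw_itemE p : qiso (tw_prod (extra p) (tw_prod (tw_chi (chi_of p)) (tw_triv (grp_of p))))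
  (tw_item p).
Proof.
case: p => [chi G|m chi G|chi G] /=; last 2 first.
- exact: tw_item23E.
- exact: tw_item23E.
exact: tw_prodA.
Qed.

Lemma sqsum_item p j i : sqsum (tw_item p) j i =
  sqsum (extra p) j i * (sqsum (tw_chi (chi_of p)) j i * sqsum (tw_triv (grp_of p)) j i).
Proof. by rewrite -(sqsum_iso _ _ (tw_itemE p)) !sqsum_prod. Qed.

Lemma item_ok_char p : item_ok p -> is_characteristic (chi_of p).
Proof.
by case: p => [chi G|m chi G|chi G] /=; [case/orP|case/andP=> _|]; case/andP.
Qed.

(** The summand common to both items cancels: from the commutation sums, because
    it contributes the same nonzero factor to both sides, and from the numbers
    of torsion elements likewise. *)
Lemma same_extra p p' : item_ok p -> item_ok p' -> extra p = extra p' ->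
    qiso (tw_item p) (tw_item p') ->
  perm_eq (map shape (chi_of p)) (map shape (chi_of p')) /\
  zmod_iso (grp_of p) (grp_of p').
Proof.
move=> /item_ok_char cp /item_ok_char cp' ee pp'.
have rE X chi (G : finZmodType) S j i : is_characteristic chi ->
    qiso (tw_prod X (tw_prod (tw_chi chi) (tw_triv G))) S ->
  (2 ^ chi_rank chi j i)%N%:R *
    (commsum S j i * (tors_count X (2 ^ j) * tors_count X (2 ^ i))%N%:R) =
  commsum X j i * (tors_count S (2 ^ j) * tors_count S (2 ^ i))%N%:R.
  move=> cchi iso; rewrite -(commsum_iso _ _ iso) -!(tors_count_qiso _ iso).
  rewrite !commsum_prod !tors_count_tw_prod commsum_triv.
  have E := commsum_chiE j i cchi; rewrite !natrM in E *.
  move: (_%:R) E => r; set c := commsum (tw_chi _) _ _ => E.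
  rewrite [LHS](_ : _ = commsum X j i * (r * c) *
    ((tors_count G (2 ^ j))%:R * (tors_count G (2 ^ i))%:R *
     ((tors_count X (2 ^ j))%:R * (tors_count X (2 ^ i))%:R))); first by rewrite E; ring.
  by ring.
have P : perm_eq (map shape (chi_of p)) (map shape (chi_of p')).
  apply: rank_shape => // j i; have h := rE _ _ _ _ j i cp (tw_itemE p).
  have := rE _ _ _ _ j i cp' (tw_itemE p').
  rewrite -ee -(commsum_iso _ _ pp') -!(tors_count_qiso _ pp') -h.
  move=> /(mulIf _) /eqP; rewrite eqr_nat eqn_exp2l // => E.
  apply/eqP; rewrite eq_sym; apply: E; rewrite mulf_neq0 //.
    by rewrite gt_eqF // commsum_gt0.
  by rewrite pnatr_eq0 -lt0n muln_gt0 !tors_count_gt0.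
split=> //; apply: tors_count_zmod_iso => n.
have := tors_count_qiso n pp'.
rewrite -!(tors_count_qiso n (tw_itemE _)) !tors_count_tw_prod -ee.
rewrite (shape_tors_count n P) => /eqP.
by rewrite !eqn_pmul2l ?tors_count_gt0 // => /eqP.
Qed.

Lemma sqsum_item_even chi G j i : even_chi chi ->
  0 < sqsum (tw_item (Item1 chi G)) j i.
Proof. by move=> ec; rewrite sqsum_item !mulr_gt0 ?sqsum_triv ?sqsum_even. Qed.

Lemma sqsum_item_odd chi G : odd_chi chi -> exists m n q r,
  [/\ perm_eq chi (q :: r), odd_quad m n q, plus_chi r,
      forall j, (sqsum (tw_item (Item1 chi G)) j 0 == 0) = (j <= m)%N
    & forall i, (sqsum (tw_item (Item1 chi G)) m i == 0) = (i <= n)%N].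
Proof.
move=> /odd_chi_split[m [n [q [r [pr oq mn plr]]]]]; exists m, n, q, r.
have nz S j i : 0 < sqsum S j i -> (sqsum S j i == 0) = false by move=> /gt_eqF.
have sE j i : (sqsum (tw_item (Item1 chi G)) j i == 0) =
    (sqsum (tw_D m.+1 n.+1 true false) j i == 0).
  rewrite sqsum_item (sqsum_chi_perm _ _ pr) (sqsum_odd_quad _ _ oq) !mulf_eq0.
  rewrite (gt_eqF (sqsum_triv 'I_1 j i)).
  by rewrite (gt_eqF (sqsum_triv G j i)) (gt_eqF (sqsum_plus j i plr)) !orbF.
split=> // [j|i]; rewrite sE; case: leqP => h.
- by rewrite sqsum_D_eq0 ?eqxx.
- by rewrite nz ?sqsum_D_gt.
- by rewrite sqsum_D_partner0 ?eqxx.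
- by rewrite nz ?sqsum_D_partner_gt.
Qed.

Lemma sqsum_item2 m chi G : even_chi chi ->
  (forall j, (sqsum (tw_item (Item2 m.+1 chi G)) j 0 == 0) = (j <= m)%N) /\
  (forall i, sqsum (tw_item (Item2 m.+1 chi G)) m i = 0).
Proof.
move=> ec; split=> [j|i]; rewrite sqsum_item; last by rewrite sqsum_C_eq0 // mul0r.
rewrite !mulf_eq0 (gt_eqF (sqsum_even _ _ ec)) (gt_eqF (sqsum_triv _ _ _)) !orbF.
case: leqP => h; first by rewrite sqsum_C_eq0 ?eqxx.
by rewrite gt_eqF ?sqsum_C_gt0.
Qed.

Lemma sqsum_item3 chi G : even_chi chi -> sqsum (tw_item (Item3 chi G)) 0 0 < 0.
Proof.
move=> ec; rewrite sqsum_item nmulr_rlt0; last exact: sqsum_H4.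
by rewrite mulr_gt0 ?sqsum_triv ?sqsum_even.
Qed.

Lemma eq_leq_bound m n : (forall j, (j <= m) = (j <= n))%N -> m = n.
Proof. by move=> h; apply/eqP; rewrite eqn_leq -h leqnn h leqnn. Qed.

Lemma sqsum_item1_2 chi G m chi' G' : even_chi chi || odd_chi chi -> even_chi chi' ->
  ~ qiso (tw_item (Item1 chi G)) (tw_item (Item2 m.+1 chi' G')).
Proof.
move=> + /(sqsum_item2 m G')[h1' h2'] iso; have sE j i := sqsum_iso j i iso.
case/orP=> [ec|/(@sqsum_item_odd chi G)[m' [n [q [r [_ _ _ h1 h2]]]]]].
  by have := sqsum_item_even G 0 0 ec; rewrite sE lt0r h1' leq0n.
have mm : m' = m by apply: eq_leq_bound => j; rewrite -h1 sE h1'.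
by have := h2 n.+1; rewrite mm sE h2' eqxx ltnn.
Qed.

Lemma sqsum_item1_3 chi G chi' G' : even_chi chi || odd_chi chi -> even_chi chi' ->
  ~ qiso (tw_item (Item1 chi G)) (tw_item (Item3 chi' G')).
Proof.
move=> + /(sqsum_item3 G') + iso; rewrite -(sqsum_iso _ _ iso).
case/orP=> [ec|/(@sqsum_item_odd chi G)[m [n [q [r [_ _ _ h1 _]]]]]].
  by rewrite lt_gtF ?sqsum_item_even.
have /eqP-> : sqsum (tw_item (Item1 chi G)) 0 0 == 0 by rewrite h1.
by rewrite ltxx.
Qed.

Lemma sqsum_item2_3 m chi G chi' G' : even_chi chi -> even_chi chi' ->
  ~ qiso (tw_item (Item2 m.+1 chi G)) (tw_item (Item3 chi' G')).
Proof.
move=> /(sqsum_item2 m G)[h1 _] /(sqsum_item3 G') + iso.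
rewrite -(sqsum_iso _ _ iso).
have /eqP-> : sqsum (tw_item (Item2 m.+1 chi G)) 0 0 == 0 by rewrite h1.
by rewrite ltxx.
Qed.

(** At j = i = 0 the sum sqsum is positive for item (1) with an even
    characteristic, negative for item (3), and zero otherwise. In the remaining
    cases it vanishes at i = 0 exactly for j <= m, which gives m; at j = m it
    vanishes for all i in item (2), and exactly as long as i <= n in item (1)
    with an odd characteristic, which gives the order 2^(n+1) of the partner. *)
Theorem tw_item_inj p p' : item_ok p -> item_ok p' ->
  qiso (tw_item p) (tw_item p') -> same_item p p'.
Proof.
move=> okp okp' pp'; have sE j i := sqsum_iso j i pp'.
have SE := same_extra okp okp' _ pp'.
case: p p' okp okp' pp' sE SE => [chi G|[//|m] chi G|chi G] [chi' G'|[//|m'] chi' G'|chi' G'];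
  move=> okp okp' pp' sE SE.
- have [S Giso] := SE erefl; split=> //.
  case/orP: okp => [ec|/(@sqsum_item_odd chi G)[m [n [q [r [P oq plr h1 h2]]]]]];
    case/orP: okp' => [ec'|/(@sqsum_item_odd chi' G')[m' [n' [q' [r' [P' oq' plr' h1' h2']]]]]].
  + exact: same_chi_even.
  + by have := sqsum_item_even G 0 0 ec; rewrite sE lt0r h1' leq0n.
  + by have := sqsum_item_even G' 0 0 ec'; rewrite -sE lt0r h1 leq0n.
  have mm : m = m' by apply: eq_leq_bound => j; rewrite -h1 sE h1'.
  subst m'; have nn : n = n' by apply: eq_leq_bound => i; rewrite -h2 sE h2'.
  subst n'; exact: same_chi_odd oq oq' plr plr' P P' S.
- by case: (sqsum_item1_2 okp okp' pp').
- by case: (sqsum_item1_3 okp okp' pp').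
- by case: (sqsum_item1_2 okp' okp (qiso_sym pp')).
- have [h1 _] := sqsum_item2 m G okp; have [h1' _] := sqsum_item2 m' G' okp'.
  have mm : m = m' by apply: eq_leq_bound => j; rewrite -h1 sE h1'.
  subst m'; have [S Giso] := SE erefl; split=> //; exact: same_chi_even.
- by case: (sqsum_item2_3 okp okp' pp').
- by case: (sqsum_item1_3 okp' okp (qiso_sym pp')).
- by case: (sqsum_item2_3 okp' okp (qiso_sym pp')).
- have [S Giso] := SE erefl; split=> //; exact: same_chi_even.
Qed.

(** * Models of graded algebras *)

Definition comb (F : fieldType) (B A : falgType F) (S : twist)
    (io : B -> A) (x : S -> A) (f : {ffun S -> B}) : A :=
  \sum_t io (f t) * x t.

(** X is B tensored with the algebra twisted by S, where B sits in the identity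
    component; this is expressed by a basis x over B, which avoids comparing
    tensor products. *)
Record is_model (F : fieldType) (B : falgType F) (X : gralg F) (S : twist)
    (al : {additive S -> gr_grp X}) (io : {lrmorphism B -> gr_alg X})
    (x : S -> gr_alg X) : Prop := IsModel {
  model_bij : bijective al;
  model1 : x 0 = 1;
  modelM : forall s t, x s * x t = (-1) ^+ tw_sgn s t *: x (s + t);
  modelC : forall b t, x t * io b = io b * x t;
  model_comp : forall t a, a \in gr_comp X (al t) <-> exists b, a = io b * x t;
  model_onto : forall a, exists f : {ffun S -> B}, a = comb io x f;
  model_inj : forall f : {ffun S -> B}, comb io x f = 0 -> f = 0 }.

Definition has_model (F : fieldType) (B : falgType F) (X : gralg F) (S : twist) :=
  exists al io x, @is_model F B X S al io x.

Section ModelTheory.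
Variables (F : fieldType) (B : falgType F) (S : twist).

(** The multiplication of combinations depends on the twist only; this is why
    two algebras with the same model are isomorphic. *)
Definition comb_mul (f g : {ffun S -> B}) : {ffun S -> B} :=
  [ffun z => \sum_s (-1) ^+ tw_sgn s (z - s) *: (f s * g (z - s))].

Definition comb_delta t (b : B) : {ffun S -> B} := [ffun s => if s == t then b else 0].

Section OneModel.
Variables (X : gralg F) (al : {additive S -> gr_grp X})
  (io : {lrmorphism B -> gr_alg X}) (x : S -> gr_alg X).
Hypothesis mX : is_model al io x.

Lemma comb_linear : linear (comb io x).
Proof.
move=> k f g; rewrite /comb scaler_sumr -big_split; apply: eq_bigr => t _ /=.
by rewrite !ffunE linearP mulrDl scalerAl.
Qed.

Lemma comb_deltaE t b : comb io x (comb_delta t b) = io b * x t.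
Proof.
rewrite /comb (bigD1 t) //= big1 => [|s st]; first by rewrite ffunE eqxx addr0.
by rewrite ffunE (negPf st) linear0 mul0r.
Qed.

Lemma combM f g : comb io x f * comb io x g = comb io x (comb_mul f g).
Proof.
rewrite /comb mulr_suml.
transitivity (\sum_s \sum_z io ((-1) ^+ tw_sgn s (z - s) *: (f s * g (z - s))) * x z).
  apply: eq_bigr => s _; rewrite mulr_sumr [RHS](reindex_inj (addrI s)).
  apply: eq_bigr => t _ /=; rewrite addrAC subrr add0r.
  rewrite mulrA -[_ * x s * _]mulrA (modelC mX) mulrA -[LHS]mulrA (modelM mX).
  by rewrite -scalerAr linearZ -scalerAl /= rmorphM.
rewrite exchange_big; apply: eq_bigr => z _ /=; rewrite ffunE linear_sum /=.
by rewrite mulr_suml.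
Qed.

Lemma comb1 : comb io x (comb_delta 0 1) = 1.
Proof. by rewrite comb_deltaE rmorph1 (model1 mX) mul1r. Qed.

Lemma comb_can : exists2 g, cancel (comb io x) g & cancel g (comb io x).
Proof.
have ex a : exists f : {ffun S -> B}, comb io x f == a.
  by have [f ->] := model_onto mX a; exists f.
pose g a := xchoose (ex a).
have gE a : comb io x (g a) = a by apply/eqP/(xchooseP (ex a)).
exists g => [f|a]; last exact: gE.
apply/eqP; rewrite eq_sym -subr_eq0; apply/eqP; apply: (model_inj mX).
have -> : f - g (comb io x f) = (-1) *: g (comb io x f) + f by rewrite scaleN1r addrC.
by rewrite comb_linear gE scaleN1r addNr.
Qed.

End OneModel.

Lemma model_equiv X Y : has_model B X S -> has_model B Y S -> gr_equiv X Y.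
Proof.
move=> [alX [ioX [x mX]]] [alY [ioY [y mY]]].
have [g cK gK] := comb_can mX; have [h cK' hK] := comb_can mY.
pose CX := comb ioX x; pose CY := comb ioY y.
pose p a := CY (g a).
have plin : linear p.
  move=> k a b; rewrite /p -(comb_linear ioY); congr CY; apply: (can_inj cK).
  by rewrite comb_linear !gK.
have pM : monoid_morphism p.
  split=> [|a b]; rewrite /p.
    by rewrite -[X in g X](comb1 mX) cK; exact: (comb1 mY).
  by rewrite /CY (combM mY); congr comb; apply: (can_inj cK); rewrite -(combM mX) !gK.
pose phi : {lrmorphism gr_alg X -> gr_alg Y} :=
  HB.pack p (GRing.isLinear.Build _ _ _ _ p plin) (GRing.isMonoidMorphism.Build _ _ p pM).
have pE b t : p (ioX b * x t) = ioY b * y t.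
  by rewrite -comb_deltaE /p cK /CY comb_deltaE.
have [al' alK al'K] := model_bij mX; have [beta bK b'K] := model_bij mY.
have [alpha aE] : exists f : {additive gr_grp X -> gr_grp Y}, f =1 alY \o al'.
  apply: additive_of => u v /=; rewrite -raddfD; congr (alY _).
  by apply: (can_inj alK); rewrite raddfD !al'K.
have phiE a : linfun_ahom phi a = p a by rewrite lfunE.
exists (linfun_ahom phi), alpha; split.
- exists (fun b => CX (h b)) => a; rewrite phiE /p.
    by rewrite /CX /CY cK' gK.
  by rewrite /CX cK /CY hK.
- apply: bij_eq1 (fsym aE); apply: bij_comp (model_bij mY) _.
  by exists alX.
- move=> u; rewrite -[u]al'K; move: (al' u) => {u} t; rewrite aE /= alK.
  apply/vspaceP => b; apply/memv_imgP/idP => [[a /(model_comp mX)[c ->] ->]|].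
    by apply/(model_comp mY); exists c; rewrite phiE pE.
  move=> /(model_comp mY)[c ->]; exists (ioX c * x t).
    by apply/(model_comp mX); exists c.
  by rewrite phiE pE.
Qed.

Lemma model_push X Y : gr_equiv X Y -> has_model B X S -> has_model B Y S.
Proof.
move=> [phi [alpha [bphi balpha phiE]]] [al [io [x mX]]].
exists (alpha \o al : {additive _ -> _}), (phi \o io : {lrmorphism _ -> _}), (phi \o x).
have combE f : comb (phi \o io) (phi \o x) f = phi (comb io x f).
  by rewrite /comb linear_sum; apply: eq_bigr => t _; rewrite rmorphM.
have phiM a b : phi (a * b) = phi a * phi b by exact: rmorphM.
have phiZ k a : phi (k *: a) = k *: phi a by exact: linearZ.
have [psi phiK psiK] := bphi; split.
- exact: bij_comp balpha (model_bij mX).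
- by rewrite /= (model1 mX) rmorph1.
- by move=> s t; rewrite /= -phiM (modelM mX) phiZ.
- by move=> b t; rewrite /= -!phiM (modelC mX).
- move=> t a; rewrite /= -phiE; split.
    move=> /memv_imgP[b /(model_comp mX)[c ->] ->]; exists c; exact: phiM.
  move=> [b ->]; apply/memv_imgP; exists (io b * x t); last by rewrite phiM.
  by apply/(model_comp mX); exists b.
- move=> a; have [f fE] := model_onto mX (psi a); exists f.
  by rewrite combE -fE psiK.
- move=> f; rewrite combE => E; apply: (model_inj mX).
  by apply: (can_inj phiK); rewrite E linear0.
Qed.

End ModelTheory.

(** * The twist determines the algebra and conversely *)

Lemma sign_scaleI (R : numFieldType) (A : falgType R) (b b' : bool) (x : A) :
  x != 0 -> (-1) ^+ b *: x = (-1) ^+ b' *: x -> b = b'.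
Proof.
move=> x0 /eqP; rewrite -subr_eq0 -scalerBl scaler_eq0 (negPf x0) orbF subr_eq0.
by move=> /eqP/signr_inj.
Qed.

Section Coboundary.

(** The condition on the 2-torsion says that the element (0, true) of the
    extension defined below is not a square. *)
Record symcocycle (T : finZmodType) := SymCocycle {
  sc :> T -> T -> bool;
  sc00 : sc 0 0 = false;
  scA : forall r s t, sc r s (+) sc (r + s) t = sc s t (+) sc r (s + t);
  scC : forall s t, sc s t = sc t s;
  sc2 : forall t, t *+ 2 = 0 -> sc t t = false }.

Variables (T : finZmodType) (e : symcocycle T).

Definition ext (c : symcocycle T) : Type := (T * bool)%type.
HB.instance Definition _ (c : symcocycle T) := Finite.on (ext c).

Lemma sc0l t : e 0 t = false.
Proof. by have := scA e 0 0 t; rewrite !add0r sc00; case: (e 0 t). Qed.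

Definition ext_add (u v : ext e) : ext e := (u.1 + v.1, u.2 (+) v.2 (+) e u.1 v.1).
Definition ext_opp (u : ext e) : ext e := (- u.1, u.2 (+) e u.1 (- u.1)).
Definition ext_zero : ext e := (0, false).

Fact ext_addA : associative ext_add.
Proof.
move=> [r a] [s b] [t c]; rewrite /ext_add /= addrA; congr pair.
have := scA e r s t; case: (e r s); case: (e _ t); case: (e s t); case: (e r _) => // _.
all: by case: a; case: b; case: c.
Qed.

Fact ext_addC : commutative ext_add.
Proof. by move=> [r a] [s b]; rewrite /ext_add /= addrC scC (addbC a). Qed.

Fact ext_add0 : left_id ext_zero ext_add.
Proof. by move=> [r a]; rewrite /ext_add /= add0r sc0l addbF. Qed.

Fact ext_addN : left_inverse ext_zero ext_opp ext_add.
Proof.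
move=> [r a]; rewrite /ext_add /ext_opp /= addNr [e (- r) r]scC /ext_zero.
by congr pair; case: a; case: (e _ _).
Qed.

HB.instance Definition _ :=
  GRing.isZmodule.Build (ext e) ext_addA ext_addC ext_add0 ext_addN.

Definition ext_grp : finZmodType := FinRing.Zmodule.clone (ext e) _.

(** As (0, true) is not twice an element, a character of the extension with
    values in Z/2 is nontrivial there; its values on the section t -> (t, false)
    are the cochain. *)
Lemma sym_coboundary : exists f : T -> bool,
  f 0 = false /\ forall s t, f (s + t) = f s (+) f t (+) e s t.
Proof.
have D (u v : ext_grp) : u + v = ext_add u v by [].
pose z : ext_grp := (0, true).
have z2 : z + z = 0 by rewrite D /ext_add /= addr0 sc0l.
pose G := [set (0, 0); (z, 1)] : {set ext_grp * 'Z_(2 ^ 1)}.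
have [|||phi phiE] := @char_ext ext_grp _ (exp2_gt1 0) G.
- by rewrite !inE eqxx.
- have one2 : 1 + 1 = 0 :> 'Z_(2 ^ 1) by apply: val_inj.
  have N1 : - 1 = 1 :> 'Z_(2 ^ 1) by apply/eqP; rewrite eq_sym -addr_eq0 one2.
  have Nz : - z = z by apply/eqP; rewrite eq_sym -addr_eq0 z2.
  move=> u v; rewrite !inE => /orP[]/eqP-> /orP[]/eqP->; apply/orP.
  + by left; rewrite subrr.
  + by right; rewrite sub0r; apply/eqP; congr pair.
  + by right; rewrite subr0.
  + by left; rewrite subrr.
- move=> [t b] a; rewrite -[(2 ^ 1)%N]/2%N mulr2n D /ext_add /= addbb addFb => /set2P[].
    by move=> [_ _ ->].
  by move=> [t2]; rewrite sc2.
have phiz : phi z = 1 by apply: (phiE (z, 1)); rewrite !inE eqxx orbT.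
exists (fun t => odd (phi ((t, false) : ext_grp))); split.
  by rewrite -[(0, false) : ext_grp]/(0 : ext_grp) raddf0.
move=> s t; have -> : ((s + t, false) : ext_grp) =
    ((s, false) : ext_grp) + ((t, false) : ext_grp) + z *+ e s t.
  rewrite !D /ext_add; case: (e s t) => /=.
    by rewrite ?mulr1n /= addr0 [e _ 0]scC sc0l.
  by rewrite ?mulr0n /= addr0 [e _ 0]scC sc0l.
by rewrite !raddfD !Z2_oddD raddfMn phiz Z2_oddMn; case: (e s t); rewrite /= ?andbT.
Qed.

End Coboundary.

Lemma sign_scaleK (F : fieldType) (V : lmodType F) (b : bool) (v : V) :
  (-1) ^+ b *: ((-1) ^+ b *: v) = v.
Proof. by rewrite scalerA -signr_addb addbb scale1r. Qed.

(** The difference of the two cocycles is symmetric since comm is preserved and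
    trivial at the squares of 2-torsion elements since sq is, so it is the
    coboundary of signs by which the basis is changed. *)
Lemma model_qiso (F : fieldType) (B : falgType F) (X : gralg F) (S S' : twist) :
  qiso S' S -> has_model B X S -> has_model B X S'.
Proof.
move=> [h [hb hc hs]] [al [io [x mX]]].
pose e0 (s t : S') := tw_sgn s t (+) tw_sgn (h s) (h t).
have e00 : e0 0 0 = false by rewrite /e0 raddf0 !tw_sgn00.
have eA r s t : e0 r s (+) e0 (r + s) t = e0 s t (+) e0 r (s + t).
  rewrite /e0 !raddfD addbACA tw_sgnA (tw_sgnA (h r)).
  by rewrite addbACA.
have eC s t : e0 s t = e0 t s.
  by have := hc s t; rewrite /e0 /comm; do 4![case: tw_sgn].
have e2 t : t *+ 2 = 0 -> e0 t t = false.
  by move=> /hs; rewrite /e0 /sq => ->; exact: addbb.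
have [f [f0 fD]] := sym_coboundary (SymCocycle e00 eA eC e2).
exists (al \o h : {additive _ -> _}), io, (fun s => (-1) ^+ f s *: x (h s)).
have combE (g : {ffun S' -> B}) : comb io (fun s => (-1) ^+ f s *: x (h s)) g =
    comb io (fun s => x (h s)) [ffun s => (-1) ^+ f s *: g s].
  apply: eq_bigr => s _; rewrite ffunE linearZ -scalerAl -scalerAr.
  by [].
have [h' hK h'K] := hb.
have combR (g : {ffun S' -> B}) :
    comb io (fun s => x (h s)) g = comb io x [ffun t => g (h' t)].
  rewrite /comb [RHS](reindex h) /=; last exact: onW_bij.
  by apply: eq_bigr => s _; rewrite ffunE hK.
split.
- exact: bij_comp (model_bij mX) hb.
- by rewrite f0 scale1r raddf0 (model1 mX).
- move=> s t; rewrite -scalerAl -scalerAr (modelM mX) raddfD !scalerA -!signr_addb.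
  rewrite fD /= /e0; congr (_ ^+ nat_of_bool _ *: _).
  by case: (f s); case: (f t); do 2!case: tw_sgn.
- by move=> b t; rewrite -scalerAl -scalerAr (modelC mX).
- move=> t a; rewrite /= (model_comp mX); split=> -[b ->].
    exists ((-1) ^+ f t *: b).
    by rewrite linearZ /= -scalerAl -scalerAr sign_scaleK.
  exists ((-1) ^+ f t *: b).
  by rewrite linearZ /= -scalerAl -scalerAr.
- move=> a; have [g ->] := model_onto mX a.
  exists [ffun s => (-1) ^+ f s *: g (h s)].
  rewrite combE combR; congr comb; apply/ffunP => t; rewrite !ffunE h'K.
  by rewrite sign_scaleK.
- move=> g; rewrite combE combR => /(model_inj mX)/ffunP E; apply/ffunP => s.
  have := E (h s); rewrite !ffunE hK => /(congr1 (fun b => (-1) ^+ f s *: b)).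
  by rewrite sign_scaleK scaler0.
Qed.

(** The elements of x and x' of the same degree commute with the identity
    component, so they are proportional, the centre of B being the field.
    Commutation signs do not depend on the factor, and squares are multiplied by
    the square of a real number. *)
Lemma model_unique (F : realFieldType) (B : falgType F) (X : gralg F) (S S' : twist) :
    (forall b : B, (forall c, b * c = c * b) -> exists k, b = k%:A) ->
  has_model B X S -> has_model B X S' -> qiso S S'.
Proof.
move=> cB [al [io [x mX]]] [al' [io' [x' mX']]].
have [be beK Kbe] := model_bij mX'.
have xnz t : x t != 0.
  apply/eqP => xt; have := comb_deltaE io x t 1; rewrite xt mulr0.
  by move/(model_inj mX)/ffunP/(_ t)/eqP; rewrite !ffunE eqxx oner_eq0.
have x'nz t : x' t != 0.
  apply/eqP => xt; have := comb_deltaE io' x' t 1; rewrite xt mulr0.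
  by move/(model_inj mX')/ffunP/(_ t)/eqP; rewrite !ffunE eqxx oner_eq0.
have in0 c : io c \in gr_comp X (al 0).
  by apply/(model_comp mX); exists c; rewrite (model1 mX) mulr1.
have x'C c t : x' t * io c = io c * x' t.
  have := in0 c; rewrite raddf0 -(raddf0 al') => /(model_comp mX')[d ->].
  by rewrite (model1 mX') mulr1 (modelC mX').
have iodiv b t : io b * x t = 0 -> b = 0.
  rewrite -comb_deltaE => /(model_inj mX)/ffunP/(_ t).
  by rewrite !ffunE eqxx.
have xx' t : exists2 k, k != 0 & x' (be (al t)) = k *: x t.
  have : x' (be (al t)) \in gr_comp X (al t).
    rewrite -{2}[al t]Kbe; apply/(model_comp mX'); exists 1.
    by rewrite rmorph1 mul1r.
  move=> /(model_comp mX)[b bE]; have [k kE] : exists k, b = k%:A.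
    apply: cB => c; apply/eqP; rewrite -subr_eq0; apply/eqP; apply: (iodiv _ t).
    rewrite rmorphB !rmorphM mulrBl -[_ * io c * _]mulrA -(modelC mX) mulrA -bE.
    by rewrite -mulrA -bE x'C subrr.
  exists k; last by rewrite bE kE linearZ /= rmorph1 -scalerAl mul1r.
  apply: contraNneq (x'nz (be (al t))) => k0.
  by rewrite bE kE k0 scale0r linear0 mul0r.
have hD : {morph be \o al : s t / s + t}.
  by move=> s t; rewrite /= raddfD; apply: (can_inj beK); rewrite raddfD !Kbe.
apply: (@qisoI _ _ (be \o al)) => //.
- by apply: bij_comp (model_bij mX); exists al'.
- move=> s t /=; have [k k0 kE] := xx' s; have [l l0 lE] := xx' t.
  have E : x (s + t) != 0 by exact: xnz.
  have E' : x' (be (al s) + be (al t)) != 0 by exact: x'nz.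
  have := modelM mX' (be (al s)) (be (al t)).
  have := modelM mX' (be (al t)) (be (al s)).
  rewrite kE lE -!scalerAl -!scalerAr !(modelM mX).
  rewrite [be (al t) + _]addrC [t + s]addrC => e1 e2.
  have {}e1 : (l * k) *: x (s + t) =
     (-1) ^+ (tw_sgn t s (+) tw_sgn (be (al t)) (be (al s))) *: x' (be (al s) + be (al t)).
    rewrite signr_addb -[RHS]scalerA -e1 !scalerA; congr (_ *: _).
    by rewrite [RHS]mulrC !mulrA -signr_addb addbb mul1r.
  have {}e2 : (l * k) *: x (s + t) =
     (-1) ^+ (tw_sgn s t (+) tw_sgn (be (al s)) (be (al t))) *: x' (be (al s) + be (al t)).
    rewrite signr_addb -[RHS]scalerA -e2 !scalerA; congr (_ *: _).
    by rewrite [RHS]mulrC !mulrA -signr_addb addbb mul1r mulrC.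
  have := sign_scaleI E' (etrans (esym e1) e2); rewrite /comm.
  by do 4![case: tw_sgn].
- move=> t t2 /=; have [k k0 kE] := xx' t.
  have := modelM mX' (be (al t)) (be (al t)).
  have -> : be (al t) + be (al t) = 0 by rewrite -(hD t t) /= -mulr2n t2 raddf0 -(raddf0 al') beK.
  rewrite kE -scalerAl -scalerAr (modelM mX) -mulr2n t2 (model1 mX) (model1 mX').
  rewrite !scalerA => /eqP; rewrite -subr_eq0 -scalerBl scaler_eq0 oner_eq0 orbF subr_eq0.
  rewrite /sq; have kk : 0 < k * k by rewrite -expr2 exprn_even_gt0 //= k0.
  case: (tw_sgn t t); case: (tw_sgn _ _); rewrite ?expr0 ?expr1 ?mulr1 ?mulrN1 //.
    by move=> /eqP E; have := @ltr01 F; rewrite -E oppr_gt0 lt_gtF.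
  by move=> /eqP E; have := kk; rewrite E oppr_gt0 lt_gtF ?ltr01.
Qed.

(** * Models of the listed algebras *)

Section TensorModel.
Variables (F : fieldType).

(** In coordinates with respect to a basis of A, the relation becomes one linear
    relation between the y t for each coordinate. *)
Lemma pure_indep (A B : falgType F) (T : finType) (a : T -> A) (y : T -> B) :
    (forall c : T -> F, \sum_t c t *: y t = 0 -> forall t, c t = 0) ->
  \sum_t pure (a t) (y t) = 0 -> forall t, a t = 0.
Proof.
move=> yfree s0 t; rewrite (coord_vbasis (memvf (a t))) big1 // => i _.
suff -> : coord (vbasis {:A}) i (a t) = 0 by rewrite scale0r.
apply: (yfree (fun t => coord (vbasis {:A}) i (a t))).
rewrite (coord_vbasis (memvf (\sum_t _))) big1 // => j _.
suff -> : coord (vbasis {:B}) j (\sum_t coord (vbasis {:A}) i (a t) *: y t) = 0.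
  by rewrite scale0r.
have := congr1 (fun M : tens A B => M i j) s0; rewrite summxE mxE => E.
by rewrite linear_sum -[RHS]E; apply: eq_bigr => s _; rewrite linearZ mxE.
Qed.

Lemma mem_tensv (A B : falgType F) (U : {vspace A}) (V : {vspace B}) u v :
  u \in U -> v \in V -> pure u v \in tensv U V.
Proof.
move=> /coord_vbasis-> /coord_vbasis->.
rewrite pure_suml memv_suml // => i _; rewrite pure_sumr memv_suml // => j _.
rewrite pureZl pureZr !memvZ //; apply: memv_span; apply/allpairsP.
by exists ((vbasis U)`_i, (vbasis V)`_j); rewrite !mem_nth // size_tuple.
Qed.

Lemma tens_model (B : falgType F) (X Y : gralg F) (S1 S2 : twist) :
    has_model B X S1 -> has_model F^o Y S2 ->
  has_model B (gr_tens X Y) (tw_prod S1 S2).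
Proof.
move=> [al1 [io1 [x mX]]] [al2 [io2 [y mY]]].
have io2E (k : F) : io2 k = k *: 1.
  have := linearZ_LR io2 k 1; rewrite rmorph1 => <-.
  by congr (io2 _); exact: esym (mulr1 _).
have [al alE] : exists f : {additive tw_prod S1 S2 -> gr_grp (gr_tens X Y)},
    f =1 fun s => (al1 s.1, al2 s.2).
  by apply: additive_of => s t; congr pair; rewrite /= raddfD.
pose io0 b : tens (gr_alg X) (gr_alg Y) := pure (io1 b) 1.
have iolin : linear io0.
  by move=> k b c; rewrite /io0 linearP pureDl pureZl.
have ioM : monoid_morphism io0.
  by split=> [|b c]; rewrite /io0 ?rmorph1 ?pure1 // rmorphM pureM mulr1.
pose io : {lrmorphism B -> gr_alg (gr_tens X Y)} :=
  HB.pack io0 (GRing.isLinear.Build _ _ _ _ io0 iolin)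
    (GRing.isMonoidMorphism.Build _ _ io0 ioM).
have ioE b u v : io b * pure u v = pure (io1 b * u) v.
  by rewrite [LHS]pureM mul1r.
pose xy (s : tw_prod S1 S2) : gr_alg (gr_tens X Y) := pure (x s.1) (y s.2).
exists al, io, xy.
have yfree (c : S2 -> F) : \sum_t c t *: y t = 0 -> forall t, c t = 0.
  move=> E; suff /ffunP h : [ffun t => c t : F^o] = 0 by move=> t; have := h t; rewrite !ffunE.
  apply: (model_inj mY); rewrite -[RHS]E; apply: eq_bigr => t _.
  by rewrite ffunE io2E -scalerAl mul1r.
have combE (f : {ffun tw_prod S1 S2 -> B}) :
    comb io xy f =
    \sum_t pure (comb io1 x [ffun s => f ((s, t) : tw_prod S1 S2)]) (y t).
  rewrite /comb; under [RHS]eq_bigr => t _ do rewrite pure_suml.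
  rewrite [RHS]exchange_big [RHS]pair_big /=.
  apply: (@eq_big _ _ _ (tw_prod S1 S2)) => [[s t]|[s t] _] //.
  by rewrite ioE ffunE.
split.
- apply: bij_eq1 (fsym alE).
  have [g1 g1K Kg1] := model_bij mX; have [g2 g2K Kg2] := model_bij mY.
  by exists (fun s => (g1 s.1, g2 s.2)) => -[s t] /=; rewrite ?g1K ?g2K ?Kg1 ?Kg2.
- by rewrite /xy [x _](model1 mX) [y _](model1 mY) pure1.
- move=> [s1 s2] [t1 t2]; rewrite [LHS]pureM (modelM mX) (modelM mY) /=.
  by rewrite pureZl pureZr scalerA -signr_addb.
- by move=> b [s t]; rewrite [LHS]pureM [RHS]pureM mulr1 mul1r (modelC mX).
- move=> [s t] a; rewrite alE /=; split; last first.
    move=> [b ->]; rewrite ioE mem_tensv //.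
      by apply/(model_comp mX); exists b.
    by apply/(model_comp mY); exists 1; rewrite rmorph1 mul1r.
  pose h b : tens (gr_alg X) (gr_alg Y) := pure (io1 b * x s) (y t).
  have hlin : linear h.
    by move=> k b c; rewrite /h linearP mulrDl -scalerAl pureDl pureZl.
  pose hl : {linear B -> tens (gr_alg X) (gr_alg Y)} :=
    HB.pack h (GRing.isLinear.Build _ _ _ _ h hlin).
  have hE b : linfun hl b = h b by exact: (lfunE hl).
  move=> at_; have : a \in limg (linfun hl).
    move: a at_; apply/subvP/span_subvP => _ /allpairsP[[u v] /= [uU vV ->]].
    have /(model_comp mX)[b ->] := vbasis_mem uU.
    have /(model_comp mY)[k ->] := vbasis_mem vV.
    apply/memv_imgP; exists (k *: b); first exact: memvf.
    by rewrite hE /h linearZ /= -scalerAl pureZl io2E -scalerAl mul1r pureZr.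
  by case/memv_imgP => b _ ->; exists b; rewrite hE ioE.
- move=> a; elim/tens_ind: a => [a b|M N [f ->] [g ->]].
    have [f ->] := model_onto mX a; have [g ->] := model_onto mY b.
    exists [ffun s : tw_prod S1 S2 => g s.2 *: f s.1]; rewrite combE {2}/comb pure_sumr.
    apply: eq_bigr => t _; rewrite io2E -scalerAl mul1r pureZr -pureZl; congr pure.
    rewrite /comb scaler_sumr; apply: eq_bigr => s _.
    by rewrite !ffunE /= linearZ /= scalerAl.
  by exists (f + g); have := comb_linear io xy 1 f g;
    rewrite !scale1r.
- move=> f; rewrite combE => /(pure_indep yfree) E; apply/ffunP => -[s t].
  have /(model_inj mX)/ffunP/(_ s) := E t; rewrite !ffunE; exact.
Qed.

Lemma in_alg_lrmorphism (A : falgType F) :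
  exists io : {lrmorphism F^o -> A}, forall k : F, io k = k%:A.
Proof.
pose i0 (k : F^o) : A := (k : F)%:A.
have lin : linear i0 by move=> a b c; rewrite /i0 scalerDl scalerA.
have mul : monoid_morphism i0.
  by split=> [|b c]; rewrite /i0 ?scale1r // -scalerAl mul1r scalerA.
by exists (HB.pack i0 (GRing.isLinear.Build _ _ _ _ i0 lin)
  (GRing.isMonoidMorphism.Build _ _ i0 mul) : {lrmorphism F^o -> A}).
Qed.

Lemma twisted_model (S : twist) (d : cocycle F S) :
    (forall s t, d s t = (-1) ^+ tw_sgn s t) ->
  has_model F^o (gr_twisted d) S.
Proof.
move=> dE; have [io ioE] := in_alg_lrmorphism (twisted d).
exists (idfun : {additive S -> S}), io, (tbasis d).
have combE (f : {ffun S -> F^o}) :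
    comb io (tbasis d) f = \sum_t f t *: tbasis d t.
  by apply: eq_bigr => t _; rewrite ioE -scalerAl mul1r.
split.
- by exists id.
- exact: tbasis0.
- by move=> s t; rewrite tbasisM dE.
- by move=> b t; rewrite ioE -scalerAr -scalerAl mulr1 mul1r.
- move=> t a; split; first by move=> /vlineP[k ->]; exists k; rewrite ioE -scalerAl mul1r.
  by move=> [k ->]; rewrite ioE -scalerAl mul1r; apply/vlineP; exists k.
- by move=> a; exists a; rewrite combE; exact: twisted_sum.
- move=> f; rewrite combE => E; rewrite -[RHS]E; exact: (twisted_sum (f : twisted d)).
Qed.

Lemma trivial_model (B : falgType F) : has_model B (gr_trivial B) tw1.
Proof.
exists (idfun : {additive 'I_1 -> 'I_1}), (idfun : {lrmorphism B -> B}), (fun=> 1).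
have combE (f : {ffun tw1 -> B}) : comb idfun (fun=> 1) f = f 0.
  rewrite /comb (big_pred1 0) ?mulr1 // => t.
  by rewrite [t]ord1.
split=> //=.
- by exists id.
- by move=> s t; rewrite mulr1 scale1r.
- by move=> b t; rewrite mulr1 mul1r.
- by move=> t a; rewrite memvf; split=> // _; exists a; rewrite mulr1.
- by move=> a; exists [ffun=> a]; rewrite combE ffunE.
- by move=> f; rewrite combE => f0; apply/ffunP => t; rewrite [t]ord1 f0 ffunE.
Qed.

Lemma quadruple_model q : has_model F^o (gr_quadruple F q) (tw_quad q).
Proof.
case: q => [[[k l] b] b']; apply: twisted_model => s t; exact: D_sgnE.
Qed.

Lemma chi_model chi : has_model F^o (gr_chi F chi) (tw_chi chi).
Proof.
elim: chi => [|q [|q' chi] IH]; first exact: trivial_model.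
  exact: quadruple_model.
exact: tens_model (quadruple_model q) IH.
Qed.

Definition quaternions : falgType F := gr_alg (gr_D 1 1 (-1 : F) (-1)).

Lemma item_model p : has_model quaternions (item_alg F p) (tw_item p).
Proof.
have H := trivial_model quaternions.
have G (G : finZmodType) : has_model F^o (gr_grpalg F G) (tw_triv G).
  exact: twisted_model.
case: p => [chi K|m chi K|chi K] /=; apply: tens_model (G K); apply: tens_model (chi_model _).
- exact: H.
- by apply: tens_model H _; apply: twisted_model.
- by apply: tens_model H _; exact: (quadruple_model (1, 1, true, true)%N).
Qed.

End TensorModel.

(** * The centre of the quaternions *)

Lemma tbasis_coef (F : fieldType) (T : finZmodType) (c : cocycle F T)
    (a : twisted c) s t :
  (tbasis c s * a) (s + t) = a t * c s t /\ (a * tbasis c s) (s + t) = a t * c t s.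
Proof.
split; rewrite ffunE.
  rewrite (bigD1 s) //= big1 => [|r rs]; rewrite ffunE ?eqxx ?(negPf rs) ?mul0r //.
  by rewrite addr0 mul1r addrC addKr.
rewrite (bigD1 t) //= big1 => [|r rt]; rewrite ffunE; last first.
  by rewrite subr_eq (inj_eq (addrI _)) eq_sym (negPf rt) mulr0 mul0r.
by rewrite addrK eqxx mulr1 addr0.
Qed.

(** Comparing coefficients of u b = b u and v b = b v kills the coordinates of b
    at u, v and u v. *)
Lemma quaternion_center (F : numFieldType) (b : quaternions F) :
  (forall c, b * c = c * b) -> exists k, b = k%:A.
Proof.
move=> bc; pose c := D_cocycle 1 1 (-1 : F) (-1).
have cE s t : c s t = (-1) ^+ D_sgn true true s t by exact: (@D_sgnE 1 1 true true F s t).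
have b0 s t : D_sgn true true s t = ~~ D_sgn true true t s -> (b : twisted c) t = 0.
  move=> cst; have [e1 e2] := tbasis_coef (b : twisted c) s t.
  have := bc (tbasis c s); move/(congr1 (fun f : twisted c => f (s + t))).
  rewrite e1 e2 !cE cst signrN mulrN => /eqP; rewrite -addr_eq0 -mulr2n -mulr_natr.
  by rewrite !mulf_eq0 pnatr_eq0 orbF signr_eq0 orbF => /eqP.
exists ((b : twisted c) 0); apply/ffunP => t; rewrite [RHS]ffunE ffunE.
have [->|t0] := eqVneq t 0; first by rewrite /GRing.scale /= mulr1.
rewrite /GRing.scale /= mulr0.
case: t t0 => -[[|[|//]] i1] [[|[|//]] i2] t0 //.
- exact: (b0 (1, 0)).
- exact: (b0 (0, 1)).
- exact: (b0 (1, 0)).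
Qed.

(** * Quadratic elements over a real closed field *)

(** There are more coefficient vectors of length dim A + 1 than dimensions in A.
    *)
Lemma annihilating_poly (F : fieldType) (A : falgType F) (x : A) :
  exists2 p : {poly F}, p != 0 & horner_alg x p = 0.
Proof.
pose n := \dim {:A}.
pose f0 (v : 'rV[F]_n.+1) : A := horner_alg x (rVpoly v).
have flin : linear f0 by move=> k u v; rewrite /f0 raddfD /= linearZ /= raddfD /= -mul_polyC rmorphM /= horner_algC -scalerAl mul1r.
pose f : {linear 'rV[F]_n.+1 -> A} := HB.pack f0 (GRing.isLinear.Build _ _ _ _ f0 flin).
have k0 : (lker (linfun f) != 0)%VS.
  have := limg_ker_dim (linfun f) fullv; rewrite capfv dimvf /dim /= mul1n.
  have := dimvS (subvf (limg (linfun f))); rewrite -/n => le E.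
  by rewrite -dimv_eq0; apply/eqP => d0; move: E; rewrite d0 add0n => E;
    move: le; rewrite E ltnn.
exists (rVpoly (vpick (lker (linfun f)))).
  apply/eqP => /(congr1 (@poly_rV _ n.+1)); rewrite rVpolyK raddf0 => /eqP.
  by rewrite vpick0 (negPf k0).
by have := memv_pick (lker (linfun f)); rewrite memv_ker lfunE /= => /eqP.
Qed.

Section Quadratic.
Variables (R : rcfType) (A : falgType R) (x : A).
Hypothesis xdiv : forall p, horner_alg x p != 0 -> horner_alg x p \is a GRing.unit.

(** Divide an annihilating polynomial by real factors of degree one or two as
    long as they do not vanish at x; a complex root provides such a factor, and
    in a division algebra the process ends with a factor that vanishes at x. *)
Lemma quadratic_element : exists a b : R, (x - a%:A) ^+ 2 = - (b ^+ 2)%:A.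
Proof.
have [p p0 px] := annihilating_poly x.
have [n] := ubnP (size p); elim: n p p0 px => // n IH p p0 px.
rewrite ltnS => sp.
have zfactor (q d : {poly R}) : p = q * d -> horner_alg x d != 0 ->
    horner_alg x q = 0.
  move=> pE /xdiv ud; move: px; rewrite pE rmorphM => /(congr1 ( *%R^~ (horner_alg x d)^-1)).
  by rewrite mul0r mulrK.
have smaller (q d : {poly R}) : p = q * d -> (1 < size d)%N -> (size q < n)%N /\ q != 0.
  move=> pE sd; have q0 : q != 0 by apply: contraNneq p0 => q0; rewrite pE q0 mul0r.
  have d0 : d != 0 by rewrite -size_poly_gt0 ltnW.
  split=> //; apply: leq_trans sp; rewrite pE size_mul //.
  have : (0 < size q)%N by rewrite size_poly_gt0.
  by case: (size q) => // m _; case: (size d) sd => [|[|m']] // _; rewrite addnS /= addnS ltnS leq_addr.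
pose toC := (real_complex R).
have sC : size (map_poly toC p) != 1%N.
  rewrite size_map_poly; apply/negP => /size_poly1P[c c0 pE].
  by move: px; rewrite pE horner_algC => /eqP; rewrite scaler_eq0 (negPf c0) oner_eq0.
have [z rz] := closed_rootP _ sC.
case: z rz => a b rz.
have [b0|b0] := eqVneq b 0.
  have ra : root p a.
    move: rz; rewrite b0 (_ : Complex a 0 = toC a) // /root horner_map.
    by rewrite fmorph_eq0.
  have [q pE] := factor_theorem p a ra.
  have dE : horner_alg x ('X - a%:P) = x - a%:A.
    by rewrite rmorphB /= horner_algX horner_algC.
  have [d0|d0] := eqVneq (horner_alg x ('X - a%:P)) 0.
    by exists a, 0; rewrite -dE d0 !expr0n /= scale0r oppr0.
  have [sq q0] := smaller _ _ pE (eq_leq (esym (size_XsubC a))).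
  exact: IH q0 (zfactor _ _ pE d0) sq.
pose d : {poly R} := ('X - a%:P) ^+ 2 + (b ^+ 2)%:P.
have sd : size d = 3%N.
  rewrite /d size_polyDl ?size_exp_XsubC // size_polyC.
  by case: (_ == _).
have dz : (map_poly toC d).[Complex a b] = 0.
  rewrite /d rmorphD rmorphXn rmorphB /= map_polyX !map_polyC /= !hornerE.
  apply/eqP; rewrite eq_complex /= ?expr2 /=.
  by apply/andP; split; apply/eqP; rewrite /= ?subrr; ring.
have dx : horner_alg x d = (x - a%:A) ^+ 2 + (b ^+ 2)%:A.
  by rewrite /d rmorphD rmorphXn rmorphB /= horner_algX !horner_algC.
have r0 : p %% d = 0.
  have d0 : d != 0 by rewrite -size_poly_gt0 sd.
  have sr : (size (p %% d)%R <= 2)%N by have := ltn_modp p d; rewrite d0 sd ltnS.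
  have := rz; rewrite /root {1}(divp_eq p d) rmorphD rmorphM !hornerE dz mulr0 add0r.
  rewrite (@horner_coef_wide _ 2) ?size_map_poly //.
  rewrite !big_ord_recl big_ord0 !coef_map /= eq_complex /=.
  rewrite /= => /andP[/eqP e1 /eqP e2].
  have r1 : (p %% d)`_1 = 0.
    apply/eqP; rewrite -(mulIr_eq0 _ (mulIf b0)) -[X in _ == X]e2 /bump /=.
    by apply/eqP; ring.
  have r0 : (p %% d)`_0 = 0 by rewrite -[RHS]e1 /bump /= r1; ring.
  apply/polyP => -[|[|i]]; rewrite coef0 //.
  by rewrite nth_default // (leq_trans sr).
have pE : p = p %/ d * d by rewrite {1}(divp_eq p d) r0 addr0.
have [hd0|hd0] := eqVneq (horner_alg x d) 0.
  by exists a, b; apply/eqP; rewrite -addr_eq0 -dx hd0.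
have [|sq q0] := smaller _ _ pE; first by rewrite sd.
exact: IH q0 (zfactor _ _ pE hd0) sq.
Qed.
End Quadratic.

(** * Division algebras of dimension at least three *)

Lemma quaternion_image (F : fieldType) (A : falgType F)
    (f : {lrmorphism quaternions F -> A}) (h : quaternions F) :
  exists a b c d : F,
    f h = a%:A + b *: f (D_u 1 1 (-1) (-1)) +
          (c%:A + d *: f (D_u 1 1 (-1) (-1))) * f (D_v 1 1 (-1) (-1)) /\
    (a = 0 -> b = 0 -> c = 0 -> d = 0 -> h = 0).
Proof.
pose h' : twisted (D_cocycle 1 1 (-1 : F) (-1)) := h.
have hE : h' = \sum_t (h' t : F) *: tbasis (D_cocycle 1 1 (-1 : F) (-1)) t.
  exact: twisted_sum.
set u := D_u _ _ _ _; set v := D_v _ _ _ _.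
exists (h' (0, 0)), (h' (1, 0)), (h' (0, 1)), (h' (1, 1)); split.
  have sE (P : 'Z_(2 ^ 1) * 'Z_(2 ^ 1) -> A) :
      \sum_t P t = P (0, 0) + P (0, 1) + (P (1, 0) + P (1, 1)).
    transitivity (\sum_(p : 'Z_(2 ^ 1)) \sum_(q : 'Z_(2 ^ 1)) P (p, q)).
      by rewrite pair_bigA; apply: eq_bigr => -[].
    rewrite !big_ord_recl !big_ord0 !addr0.
    by congr (P _ + P _ + (P _ + P _)); congr pair; apply: val_inj.
  transitivity (\sum_(t : 'Z_(2 ^ 1) * 'Z_(2 ^ 1)) h' t *: (f u ^+ t.1 * f v ^+ t.2)).
    rewrite -[h in LHS]/h' [in LHS]hE linear_sum; apply: eq_bigr => -[p q] _.
    rewrite linearZ /= -D_uvX; congr (_ *: _).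
    by rewrite [LHS]rmorphM; congr (_ * _); exact: rmorphXn.
  rewrite sE /= !expr0 !expr1 !mulr1 !mul1r mulrDl -!scalerAl mul1r.
  by rewrite addrACA.
move=> h0 h1 h2 h3; rewrite -[h]/h' hE big1 // => -[p q] _.
suff -> : h' (p, q) = 0 by rewrite scale0r.
by case: p q => -[|[|//]] ? [[|[|//]] ?]; [rewrite -h0 | rewrite -h2 | rewrite -h1 | rewrite -h3];
  congr (h' (_, _)); apply: val_inj.
Qed.

Lemma comm_diff_squares (A : nzRingType) (z w : A) :
  z * w = w * z -> z * z = w * w -> (z - w) * (z + w) = 0.
Proof. by move=> zw zz; rewrite mulrBl !mulrDr zw opprD addrA addrK zz subrr. Qed.

Lemma shift_square (A : nzRingType) (z w : A) : z * w = w * z ->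
  z * z = (z - w) * (z - w) + (z * w) *+ 2 - w * w.
Proof.
move=> zw; rewrite mulrBl !mulrBr zw opprB mulr2n [X in X + _ - _]addrACA.
by rewrite -[X in X - _]addrA -opprD addNr addr0 addrK.
Qed.

Section Frobenius.
Variables (R : rcfType) (A : falgType R) (W : {vspace A}).
Hypothesis W1 : 1 \in W.
Hypothesis WM : forall x y, x \in W -> y \in W -> x * y \in W.
Hypothesis Wunit : forall x, x \in W -> x != 0 -> x \is a GRing.unit.
Hypothesis dimW : (2 < \dim W)%N.

Lemma division_horner x p : x \in W -> horner_alg x p \in W.
Proof.
move=> xW; elim/poly_ind: p => [|p c IH]; first by rewrite rmorph0 mem0v.
rewrite rmorphD rmorphM /= horner_algX horner_algC.
by rewrite memvD ?WM ?memvZ.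
Qed.

Lemma division_quadratic x : x \in W -> exists a b : R, (x - a%:A) ^+ 2 = - (b ^+ 2)%:A.
Proof.
by move=> xW; apply: quadratic_element => p; apply: Wunit; apply: division_horner.
Qed.

Lemma division_mul0 x y : x \in W -> x * y = 0 -> x != 0 -> y = 0.
Proof.
move=> xW xy x0; have ux := Wunit xW x0.
by rewrite -[y](mulKr ux) xy mulr0.
Qed.

Lemma scalarP (x : A) : reflect (exists a : R, x = a%:A) (x \in 1%VS).
Proof. exact: vlineP. Qed.

Lemma division_normalize x a b : x \in W -> x != 0 -> x ^+ 2 = - (b ^+ 2)%:A -> a = b^-1 ->
  (a *: x) * (a *: x) = -1 /\ b != 0.
Proof.
move=> xW x0 x2 ->; have b0 : b != 0.
  apply: contraNneq x0 => b0; apply/eqP.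
  move: x2; rewrite b0 expr0n /= scale0r oppr0 expr2 => xx.
  by apply/eqP/negPn/negP => x0; have := division_mul0 xW xx x0; apply/eqP.
split=> //; rewrite -scalerAl -scalerAr scalerA -(expr2 x) x2 scalerN scalerA.
by rewrite -expr2 exprVn mulVf ?scale1r // expf_neq0.
Qed.

(** A nonscalar element satisfies (x - a)^2 = - b^2 with b nonzero. *)
Lemma division_sqrtN1 : exists2 i, i \in W & i * i = -1.
Proof.
have : ~~ (W <= 1%VS)%VS.
  by apply/negP => /dimvS; rewrite dimv1 leqNgt (ltn_trans _ dimW).
move=> /subvPn[x xW x1]; have [a [b E]] := division_quadratic xW.
have y0 : x - a%:A != 0.
  by rewrite subr_eq0; apply: contraNneq x1 => ->; apply/scalarP; exists a.
have yW : x - a%:A \in W by rewrite memvB // memvZ.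
exists (b^-1 *: (x - a%:A)); first exact: memvZ.
by have [] := division_normalize yW y0 E erefl.
Qed.

Section Centralizer.
Variable i : A.
Hypotheses (iW : i \in W) (i2 : i * i = -1).

(** If y commutes with i, then (y - a)^2 = (b i)^2 factors as a difference of
    squares. *)
Lemma centraliser_sqrtN1 y : y \in W -> y * i = i * y -> exists a b : R, y = a%:A + b *: i.
Proof.
move=> yW yi; have [a [b E]] := division_quadratic yW.
have aC : a%:A * i = i * a%:A by rewrite -scalerAl -scalerAr mulr1 mul1r.
pose z := y - a%:A; have zi : z * i = i * z by rewrite mulrBl mulrBr yi aC.
have zW : z \in W by rewrite memvB // memvZ.
have zz : (z - b *: i) * (z + b *: i) = 0.
  have zw : z * (b *: i) = b *: i * z by rewrite -scalerAr -scalerAl zi.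
  have ww : b *: i * (b *: i) = - (b ^+ 2)%:A.
    by rewrite -scalerAr -scalerAl scalerA i2 scalerN expr2.
  by apply: comm_diff_squares => //; rewrite ww -expr2 E.
have [z0|z0] := eqVneq (z - b *: i) 0.
  by exists a, b; move/eqP: z0; rewrite subr_eq0 => /eqP <-; rewrite addrC subrK.
exists a, (- b); have z'W : z - b *: i \in W by rewrite memvB // memvZ.
have /eqP := division_mul0 z'W zz z0; rewrite addr_eq0 => /eqP zE.
by rewrite scaleNr -zE addrC subrK.
Qed.

Lemma anticomm_of y : i * (y + i * y * i) = - ((y + i * y * i) * i).
Proof.
rewrite mulrDr mulrDl !mulrA i2 -[_ * i * i]mulrA i2 mulrN1 mulN1r mulNr.
by rewrite opprD opprK addrC.
Qed.

Lemma comm_of y : i * (y - i * y * i) = (y - i * y * i) * i.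
Proof.
rewrite mulrBr mulrBl !mulrA i2 -[_ * i * i]mulrA i2 mulrN1 mulN1r mulNr.
by rewrite !opprK addrC.
Qed.

(** For y outside R + R i the element z = y + i y i is nonzero and anticommutes
    with i. Since z z commutes with i, no multiple of z enters z z, which is
    thus the scalar - b^2. *)
Lemma division_anticommuting : exists j, [/\ j \in W, j * j = -1 & i * j = - (j * i)].
Proof.
have : ~~ (W <= <[1]> + <[i]>)%VS.
  apply/negP => /dimvS; rewrite leqNgt (leq_ltn_trans _ dimW) //.
  apply: leq_trans (dimv_add_leqif _ _) _; rewrite !dim_vline.
  by case: (_ != 0); case: (_ != 0).
move=> /subvPn[y yW y1].
pose z := y + i * y * i; have iz := anticomm_of y; rewrite -/z in iz.
have zW : z \in W by rewrite memvD // !WM.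
have z0 : z != 0.
  apply: contraNneq y1 => z0.
  have yi : y * i = i * y.
    have yE : y = - (i * y * i) by apply/eqP; rewrite -addr_eq0 -/z z0.
    by rewrite {2}yE mulrN !mulrA i2 mulN1r mulNr opprK.
  have [a [b ->]] := centraliser_sqrtN1 yW yi.
  by apply/memv_addP; exists a%:A; [apply/vlineP; exists a |
    exists (b *: i) => //; apply/vlineP; exists b].
clearbody z; have [a [b E]] := division_quadratic zW.
have z2 : z * z = - (b ^+ 2)%:A + (a *: z) *+ 2 - (a ^+ 2)%:A.
  have az : z * a%:A = a *: z by rewrite -scalerAr mulr1.
  have za : a%:A * z = a *: z by rewrite -scalerAl mul1r.
  have aa : a%:A * a%:A = (a ^+ 2)%:A :> A by rewrite -scalerAl mul1r scalerA expr2.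
  by rewrite (shift_square (etrans az (esym za))) -(expr2 (z - a%:A)) E az aa.
have zz : i * (z * z) = z * z * i by rewrite mulrA iz mulNr -[z * i * z]mulrA iz mulrN opprK mulrA.
have a0 : a = 0.
  have zi0 : z * i != 0.
    apply/eqP => /(division_mul0 zW)/(_ z0) i0; move: i2; rewrite i0 mul0r => /esym/eqP.
    by rewrite oppr_eq0 oner_eq0.
  have wE : (a *: z) *+ 2 = z * z + (b ^+ 2)%:A + (a ^+ 2)%:A.
    by rewrite z2 addrAC subrK addrAC addNr add0r.
  have : i * ((a *: z) *+ 2) = (a *: z) *+ 2 * i.
    by rewrite wE !mulrDr !mulrDl zz -!scalerAr -!scalerAl mulr1 mul1r.
  rewrite mulrnAr mulrnAl -scalerAr -scalerAl iz scalerN mulNrn => /eqP.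
  rewrite eq_sym -addr_eq0 -mulrnDr -scaler_nat scalerA scaler_eq0 (negPf zi0).
  by rewrite orbF mulf_eq0 pnatr_eq0 /= => /eqP.
have z2' : z ^+ 2 = - (b ^+ 2)%:A by rewrite expr2 z2 a0 scale0r mul0rn addr0 expr0n /= scale0r subr0.
have [jj b0] := division_normalize zW z0 z2' erefl.
exists (b^-1 *: z); split=> //; first exact: memvZ.
by rewrite -scalerAr -scalerAl iz scalerN.
Qed.

Lemma comm_anticomm_decomposition y : y \in W -> exists y1 y2,
  [/\ y = y1 + y2, y1 \in W /\ y2 \in W, i * y1 = y1 * i & i * y2 = - (y2 * i)].
Proof.
move=> yW; have iyi : i * y * i \in W by rewrite !WM.
exists (2^-1 *: (y - i * y * i)), (2^-1 *: (y + i * y * i)); split.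
- rewrite -scalerDr addrACA addNr addr0 -mulr2n -scaler_nat scalerA mulVf ?scale1r //.
  by rewrite pnatr_eq0.
- by rewrite !memvZ ?memvB ?memvD.
- by rewrite -scalerAr -scalerAl comm_of.
- by rewrite -scalerAr -scalerAl anticomm_of scalerN.
Qed.

End Centralizer.

(** Frobenius theorem. Injectivity: conjugation by i separates P and Q j in P +
    Q j. Surjectivity: the part of y that commutes with i is in R + R i, and the
    part that anticommutes with i is so after multiplication by j. *)
Lemma division_quaternions : exists io : {lrmorphism quaternions R -> A},
  (forall h, io h = 0 -> h = 0) /\ (forall y, y \in W <-> exists h, y = io h).
Proof.
have [i iW i2] := division_sqrtN1; have [j [jW j2 ij]] := division_anticommuting iW i2.
have isq : i ^+ (2 ^ 1) = (-1)%:A by rewrite scaleN1r -i2.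
have jsq : j ^+ (2 ^ 1) = (-1)%:A by rewrite scaleN1r -j2.
have [io [ui vj _]] := D_universal (isT : (0 < 1)%N) (isT : (0 < 1)%N) isq jsq ij.
exists (io : {lrmorphism quaternions R -> A}).
have one0 : (1 : A) != 0 := oner_neq0 _.
have sep (a b : R) : a%:A + b *: i = 0 -> a = 0 /\ b = 0.
  move=> E; have b0 : b = 0.
    apply/eqP/negPn/negP => b0.
    have iE : i = (- (b^-1 * a))%:A.
      move/eqP: E; rewrite addrC addr_eq0 => /eqP/(congr1 (fun y => b^-1 *: y)).
      by rewrite scalerA mulVf // scale1r => ->; rewrite scalerN scalerA scaleNr.
    move: ij; rewrite iE -scalerAl -scalerAr mul1r mulr1 => /eqP.
    rewrite -addr_eq0 -mulr2n -scaler_nat !scaler_eq0 pnatr_eq0 /= oppr_eq0.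
    move=> /orP[ba|/eqP j0]; last by move: j2; rewrite j0 mul0r => /esym/eqP; rewrite oppr_eq0 (negPf one0).
    by move: i2; rewrite iE (eqP ba) oppr0 scale0r mul0r => /esym/eqP; rewrite oppr_eq0 (negPf one0).
  by move: E; rewrite b0 scale0r addr0 => /eqP; rewrite scaler_eq0 (negPf one0) orbF => /eqP.
have j0 : j != 0 by apply: contra_eq_neq j2 => ->; rewrite mul0r eq_sym oppr_eq0.
have WR (a b : R) : a%:A + b *: i \in W by rewrite memvD ?memvZ.
split=> [h h0|y].
  have [a [b [c [d [E nul]]]]] := quaternion_image io h.
  move: E; rewrite [io h]h0 ui vj => E.
  have conj (a' b' : R) : i * (a'%:A + b' *: i) = (a'%:A + b' *: i) * i.
    by rewrite mulrDr mulrDl -!scalerAr -!scalerAl mulr1 mul1r.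
  move: (a%:A + b *: i) (c%:A + d *: i) (conj a b) (conj c d) (sep a b) (sep c d) E.
  move=> P Q Pi Qi P0 Q0 /esym E.
  have : (P - Q * j) * i * i = 0.
    rewrite -[X in X * i](_ : i * (P + Q * j) = _); first by rewrite E mulr0 mul0r.
    by rewrite mulrDr mulrBl Pi mulrA Qi -!mulrA ij mulrN.
  rewrite -mulrA i2 mulrN1 => /eqP; rewrite oppr_eq0 subr_eq0 => /eqP PQ.
  have Qj : Q * j = 0.
    move: E; rewrite PQ -mulr2n -scaler_nat => /eqP.
    by rewrite scaler_eq0 pnatr_eq0 /= => /eqP.
  have QQ : Q = 0.
    by move/(congr1 ( *%R^~ j)): Qj; rewrite mul0r -mulrA j2 mulrN1 => /eqP;
      rewrite oppr_eq0 => /eqP.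
  have [a0 b0] := P0 (etrans PQ Qj); have [c0 d0] := Q0 QQ.
  exact: nul.
split=> [yW|[h ->]]; last first.
  have [a [b [c [d [-> _]]]]] := quaternion_image io h.
  by rewrite ui vj memvD ?WM.
have [y1 [y2 [yE [y1W y2W] y1i y2i]]] := comm_anticomm_decomposition iW i2 yW.
have [a [b y1E]] := centraliser_sqrtN1 iW i2 y1W (esym y1i).
have [|c [d y2E]] := centraliser_sqrtN1 iW i2 (WM y2W jW).
  by rewrite mulrA y2i mulNr -!mulrA ij mulrN opprK.
pose u := D_u 1 1 (-1 : R) (-1); pose v := D_v 1 1 (-1 : R) (-1).
exists (a%:A + b *: u - (c%:A + d *: u) * v).
have ioM (p q : quaternions R) : io (p * q) = io p * io q by exact: rmorphM.
have io1 : io (1 : quaternions R) = 1 by exact: rmorph1.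
have ioB (p q : quaternions R) : io (p - q) = io p - io q by exact: raddfB.
have ioD (p q : quaternions R) : io (p + q) = io p + io q by exact: raddfD.
have ioZ k (p : quaternions R) : io (k *: p) = k *: io p by exact: linearZ.
rewrite ioB ioM !ioD !ioZ io1 ui vj -y1E -y2E -mulrA j2 mulrN1 opprK.
exact: yE.
Qed.

End Frobenius.

(** * A model of a graded division algebra *)

Lemma real_power1 (R : realDomainType) n (k : R) b : (0 < n)%N -> k ^+ n = (-1) ^+ nat_of_bool b ->
  exists c : bool, k = (-1) ^+ c.
Proof.
move=> n0 kn; have : `|k| ^+ n = 1 by rewrite -normrX kn normr_sign.
move=> /eqP; rewrite pexpr_eq1 // => /eqP k1.
have : k ^+ 2 == 1 by rewrite -real_normK ?num_real // k1 expr1n.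
rewrite sqrf_eq1 => /orP[]/eqP->; [by exists false | by exists true].
Qed.

Lemma real_root (R : rcfType) (c : R) n : 0 < c -> (0 < n)%N ->
  exists2 x : R, 0 < x & x ^+ n = c.
Proof.
move=> c0 n0.
have [||x /andP[x0 _] rx] := @poly_ivt R ('X^n - c%:P) 0 (1 + c).
- by rewrite addr_ge0 // ltW.
- rewrite !hornerD !hornerN !hornerC !hornerXn expr0n gtn_eqF //=.
  rewrite sub0r oppr_le0 (ltW c0) subr_ge0 /=.
  apply: le_trans (_ : 1 + c <= _); first by rewrite lerDr.
  by apply: ler_eXnr; rewrite ?lerDl ?ltW.
move: rx; rewrite /root hornerD hornerN hornerC hornerXn subr_eq0 => /eqP xn.
exists x => //; rewrite lt_neqAle x0 andbT; apply/eqP => x00; move: c0.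
by rewrite -xn -x00 expr0n gtn_eqF // ltxx.
Qed.

Lemma img_full (K : fieldType) (A : falgType K) (f : 'End(A)) (U W : {vspace A}) :
    (forall x, f x = 0 -> x = 0) -> (forall x, x \in U -> f x \in W) ->
  (\dim U <= \dim W)%N /\ ((\dim W <= \dim U)%N -> forall w, w \in W -> exists2 u, u \in U & w = f u).
Proof.
move=> finj fUW.
have fU : (f @: U <= W)%VS by apply/subvP => _ /memv_imgP[x xU ->]; apply: fUW.
have dimf : \dim (f @: U) = \dim U.
  apply/limg_dim_eq/eqP; rewrite -subv0; apply/subvP => x /memv_capP[_].
  by rewrite memv_ker => /eqP/finj->; exact: mem0v.
split; first by rewrite -dimf dimvS.
move=> dW w wW; have /eqP E : (f @: U == W)%VS by rewrite eqEdim fU dimf.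
by move: wW; rewrite -E => /memv_imgP[u uU ->]; exists u.
Qed.

Section GradedDivision.
Variables (R : rcfType) (G : zmodType) (A : falgType R) (V : G -> {vspace A}).
Variables (T : finZmodType) (al : {additive T -> G}).
Hypotheses (albij : bijective al).
Hypothesis VM : forall g h : G, (V g * V h <= V (g + h)%R)%VS.
Hypothesis Vunit : forall (g : G) (x : A), x \in V g -> x != 0 -> x \is a GRing.unit.
Hypothesis Vnz : forall g : G, V g != 0%VS.
Hypothesis Vfull : (\sum_(t : T) V (al t))%VS = fullv.
Hypothesis Vdir : directv (\sum_(t : T) V (al t)).
Hypothesis dimV0 : \dim (V 0) = 4%N.

Lemma VM_mem g h x y : x \in V g -> y \in V h -> x * y \in V (g + h).
Proof. by move=> xg yh; apply: (subvP (VM g h)); exact: memv_mul. Qed.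

Lemma V_pick g : exists2 x, x \in V g & x != 0.
Proof. by exists (vpick (V g)); [exact: memv_pick | rewrite vpick0]. Qed.

(** Multiplication by a nonzero x of V 0 is onto V 0, so x itself is x e with e
    in V 0, and e = 1. *)
Lemma V0_1 : 1 \in V 0.
Proof.
have [x x0 xn0] := V_pick 0; have ux := Vunit x0 xn0.
have [||_ h] := @img_full R A (amull x) (V 0) (V 0).
- by move=> y; rewrite lfunE /= => xy; rewrite -[y](mulKr ux) xy mulr0.
- by move=> y y0; rewrite lfunE /= -[0](addr0 (0 : G)) VM_mem.
have [u u0] := h (leqnn _) _ x0; rewrite lfunE /= => /eqP.
by rewrite -{1}[x]mulr1 (inj_eq (mulrI ux)) => /eqP->.
Qed.

Lemma V_right g x w : x \in V g -> x != 0 -> w \in V g ->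
  exists2 u, u \in V 0 & w = u * x.
Proof.
move=> xg x0 wg; have ux := Vunit xg x0.
have [y yg y0] := V_pick (- g); have uy := Vunit yg y0.
have [||dg _] := @img_full R A (amull y) (V g) (V 0).
- by move=> z; rewrite lfunE /= => yz; rewrite -[z](mulKr uy) yz mulr0.
- by move=> z zg; rewrite lfunE /= -(addNr g) VM_mem.
have [||_ h] := @img_full R A (amulr x) (V 0) (V g).
- by move=> z; rewrite lfunE /= => zx; rewrite -[z](mulrK ux) zx mul0r.
- by move=> z zg; rewrite lfunE /= -[g]add0r VM_mem.
by have [u u0] := h dg w wg; rewrite lfunE /=; exists u.
Qed.

Lemma V0M x y : x \in V 0 -> y \in V 0 -> x * y \in V 0.
Proof. by move=> x0 y0; rewrite -[0](addr0 (0 : G)) VM_mem. Qed.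

Lemma V0l g x y : x \in V 0 -> y \in V g -> x * y \in V g.
Proof. by move=> x0 yg; rewrite -[g]add0r VM_mem. Qed.

Lemma V0r g x y : x \in V g -> y \in V 0 -> x * y \in V g.
Proof. by move=> xg y0; rewrite -[g]addr0 VM_mem. Qed.

Variable io : {lrmorphism quaternions R -> A}.
Hypothesis ioinj : forall h, io h = 0 -> h = 0.
Hypothesis io_onto : forall y, y \in V 0 <-> exists h, y = io h.

Definition central x := forall h, x * io h = io h * x.

Lemma ioV h : io h \in V 0.
Proof. by apply/io_onto; exists h. Qed.

(** The element y - i y i commutes with i; if it vanishes, y anticommutes with i
    and y j commutes with i. The same step with j, and with i as the corrector,
    keeps the commutation with i. *)
Lemma exists_central g : exists x, [/\ x \in V g, x != 0 & central x].
Proof.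
pose u := D_u 1 1 (-1 : R) (-1); pose v := D_v 1 1 (-1 : R) (-1).
have [u2 v2 uv] := D_rel (-1 : R) (-1) (isT : (0 < 1)%N) (isT : (0 < 1)%N).
pose i := io (u : quaternions R); pose j := io (v : quaternions R).
have ioM (p q : quaternions R) : io (p * q) = io p * io q by exact: rmorphM.
have ioN1 : io ((-1)%:A : quaternions R) = -1.
  by have h := linearZ_LR io (-1) 1; rewrite h rmorph1 scaleN1r.
have i2 : i * i = -1 by rewrite -ioM -ioN1; congr (io _); rewrite -u2.
have j2 : j * j = -1 by rewrite -ioM -ioN1; congr (io _); rewrite -v2.
have ij : i * j = - (j * i).
  by rewrite -!ioM -(raddfN io); congr (io _); exact: uv.
have iV : i \in V 0 := ioV _; have jV : j \in V 0 := ioV _.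
have ui : i \is a GRing.unit.
  by apply/unitrP; exists (- i); rewrite mulNr mulrN i2 opprK.
have uj : j \is a GRing.unit.
  by apply/unitrP; exists (- j); rewrite mulNr mulrN j2 opprK.
have unit_neq0 (y z : A) : z \is a GRing.unit -> y != 0 -> y * z != 0.
  by move=> uz; apply: contraNneq => yz; rewrite -[y](mulrK uz) yz mul0r.
have [y yg y0] := V_pick g.
have [y1 [y1g y10 y1i]] : exists y1, [/\ y1 \in V g, y1 != 0 & i * y1 = y1 * i].
  have [z0|z0] := eqVneq (y - i * y * i) 0; last first.
    exists (y - i * y * i); split=> //; first by rewrite memvB // V0r // V0l.
    exact: comm_of.
  exists (y * j); split; [exact: V0r | exact: unit_neq0 |].
  have iy : i * y = - (y * i).
    have yE : y = i * y * i by apply/eqP; rewrite -subr_eq0 z0.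
    by rewrite {1}yE !mulrA i2 mulN1r mulNr.
  by rewrite mulrA iy mulNr -!mulrA ij mulrN opprK.
have [y2 [y2g y20 y2i y2j]] : exists y2, [/\ y2 \in V g, y2 != 0, i * y2 = y2 * i & j * y2 = y2 * j].
  have [z0|z0] := eqVneq (y1 - j * y1 * j) 0; last first.
    exists (y1 - j * y1 * j); split=> //; first by rewrite memvB // V0r // V0l.
      rewrite mulrBr mulrBl y1i; congr (_ - _).
      rewrite !mulrA ij !mulNr -[j * i * y1]mulrA y1i -!mulrA ij !mulrN opprK.
      by [].
    exact: comm_of.
  exists (y1 * i); split; [exact: V0r | exact: unit_neq0 | by rewrite mulrA y1i |].
  have jy : j * y1 = - (y1 * j).
    have yE : y1 = j * y1 * j by apply/eqP; rewrite -subr_eq0 z0.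
    by rewrite {1}yE !mulrA j2 mulN1r mulNr.
  by rewrite mulrA jy mulNr -!mulrA ij mulrN.
exists y2; split=> // h; have [a [b [c [d [-> _]]]]] := quaternion_image io h.
rewrite -/u -/v -/i -/j.
have key (p q : R) : y2 * (p%:A + q *: i) = (p%:A + q *: i) * y2.
  by rewrite mulrDr mulrDl -!scalerAr -!scalerAl mulr1 mul1r y2i.
rewrite mulrDr [RHS]mulrDl key; congr (_ + _).
by rewrite mulrA key -!mulrA y2j.
Qed.

Lemma central_scalar g x y : x \in V g -> x != 0 -> central x -> y \in V g ->
  central y -> exists k, y = k *: x.
Proof.
move=> xg x0 xc yg yc; have ux := Vunit xg x0.
have [w /io_onto[b ->] yE] := V_right xg x0 yg.
have [k kE] : exists k, b = k%:A.
  apply: quaternion_center => c; apply/eqP; rewrite -subr_eq0; apply/eqP.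
  apply: ioinj; rewrite rmorphB !rmorphM; apply/eqP; rewrite subr_eq0; apply/eqP.
  by apply: (mulIr ux); rewrite -!mulrA -yE -yc yE -!mulrA xc.
by exists k; rewrite yE kE linearZ /= rmorph1 -scalerAl mul1r.
Qed.

Lemma centralM x y : central x -> central y -> central (x * y).
Proof. by move=> xc yc h; rewrite -mulrA yc mulrA xc mulrA. Qed.

Lemma centralX x n : central x -> central (x ^+ n).
Proof.
move=> xc; elim: n => [|n IH]; first by move=> h; rewrite expr0 mulr1 mul1r.
by rewrite exprS; exact: centralM.
Qed.

Lemma central1 : central 1.
Proof. by move=> h; rewrite mulr1 mul1r. Qed.

Lemma VX g x n : x \in V g -> x ^+ n \in V (g *+ n).
Proof.
move=> xg; elim: n => [|n IH]; first by rewrite expr0 mulr0n V0_1.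
by rewrite exprS mulrS VM_mem.
Qed.

Lemma V_unit_neq0 g h x y : x \in V g -> x != 0 -> y \in V h -> y != 0 -> x * y != 0.
Proof.
move=> xg x0 yh; have ux := Vunit xg x0; apply: contraNneq => xy.
by rewrite -[y](mulKr ux) xy mulr0.
Qed.

Notation N := #|T|.

(** The power x ^ N is a nonzero scalar, whose absolute value is made 1 by a
    scalar factor of x. *)
Lemma exists_normalized t : exists x, [/\ x \in V (al t), central x,
  exists b : bool, x ^+ N = (-1) ^+ b *: 1, x != 0 & t = 0 -> x = 1].
Proof.
have [->|t0] := eqVneq t 0.
  exists 1; rewrite raddf0 V0_1 oner_neq0; split=> //; first exact: central1.
  by exists false; rewrite expr1n scale1r.
have [x [xt x0 xc]] := exists_central (al t).
have N0 : (0 < N)%N by apply/card_gt0P; exists 0.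
have xN : x ^+ N \in V 0 by rewrite -(raddf0 al) -(mulrn_card t) raddfMn VX.
have [k kE] := central_scalar V0_1 (oner_neq0 _) central1 xN (centralX N xc).
have k0 : k != 0.
  have ux := Vunit xt x0; apply/eqP => k0.
  have := unitrX N ux; rewrite kE k0 scale0r unitr0.
  by [].
have [|l l0 lN] := @real_root R (`|k|^-1) N _ N0; first by rewrite invr_gt0 normr_gt0.
exists (l *: x); split; first exact: memvZ.
- by move=> h; rewrite -scalerAl -scalerAr xc.
- exists (k < 0); rewrite exprZn kE scalerA lN; congr (_ *: _).
  by rewrite {2}(realEsign (num_real k)) mulrCA mulVf ?normr_eq0 // mulr1.
- by rewrite scaler_eq0 negb_or x0 gt_eqF.
- by move=> t00; rewrite t00 eqxx in t0.
Qed.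

(** If x s x t = k x (s + t), then raising to the power N turns all the basis
    elements into signs, and the commutation of x s and x t costs signs only, as
    its factor is a real number with N-th power 1. So k^N is a sign, and hence k
    is one. *)
Lemma graded_model : exists S, has_model (quaternions R) (Gralg V) S.
Proof.
have [x xP] := fin_all_exists exists_normalized.
have xV t : x t \in V (al t) by have [] := xP t.
have xC t : central (x t) by have [] := xP t.
have xN t : exists b : bool, x t ^+ N = (-1) ^+ b *: 1 by have [] := xP t.
have x0 t : x t != 0 by have [] := xP t.
have x1 : x 0 = 1 by have [_ _ _ _ ->] := xP 0.
have xu t := Vunit (xV t) (x0 t).
have N0 : (0 < N)%N by apply/card_gt0P; exists 0.
have xst s t : x s * x t \in V (al (s + t)) by rewrite raddfD VM_mem.
have xst0 s t : x s * x t != 0 := V_unit_neq0 (xV s) (x0 s) (xV t) (x0 t).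
have scale_inj (y : A) (k l : R) : y != 0 -> k *: y = l *: y -> k = l.
  move=> y0 /eqP; rewrite -subr_eq0 -scalerBl scaler_eq0 (negPf y0) orbF subr_eq0.
  by move/eqP.
have xcomm s t : exists b : bool, x t * x s = (-1) ^+ b *: (x s * x t).
  have ts : x t * x s \in V (al (s + t)) by rewrite addrC.
  have [k kE] := central_scalar (xst s t) (xst0 s t) (centralM (xC s) (xC t)) ts (centralM (xC t) (xC s)).
  have kn n : x t * x s ^+ n = k ^+ n *: (x s ^+ n * x t).
    elim: n => [|n IH]; first by rewrite !expr0 mulr1 mul1r scale1r.
    rewrite exprSr mulrA IH -scalerAl -[_ * x t * x s]mulrA kE -scalerAr scalerA -exprSr.
    by rewrite ?exprSr !mulrA.
  have [b bE] := xN s; have := kn N; rewrite bE -scalerAl -scalerAr mulr1 mul1r scalerA.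
  move=> /(scale_inj _ _ _ (x0 t)) kb.
  have [|c kc] := @real_power1 R N k false N0.
    by apply: (mulIf (_ : (-1) ^+ b != 0)); rewrite ?signr_eq0 // -kb mul1r.
  by exists c; rewrite kE kc.
have xpow s t n : exists b : bool, (x s * x t) ^+ n = (-1) ^+ b *: (x s ^+ n * x t ^+ n).
  have [c cE] := xcomm s t.
  have tn m : x t ^+ m * x s = (-1) ^+ (c && odd m) *: (x s * x t ^+ m).
    elim: m => [|m IH]; first by rewrite !expr0 mulr1 mul1r andbF scale1r.
    rewrite exprS -mulrA IH -scalerAr [x t * (x s * _)]mulrA cE -scalerAl scalerA -signr_addb -mulrA.
    by congr (_ ^+ nat_of_bool _ *: _); rewrite /=; case: (c); case: odd.
  elim: n => [|n [b IH]]; first by exists false; rewrite !expr0 mulr1 scale1r.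
  exists (b (+) (c && odd n)); rewrite exprSr IH -scalerAl mulrA -[_ * x t ^+ n * x s]mulrA.
  rewrite tn -scalerAr -scalerAl scalerA -signr_addb; congr (_ *: _).
  by rewrite mulrA -exprSr -mulrA -exprSr.
pose sgn s t := x s * x t != x (s + t).
have xM s t : x s * x t = (-1) ^+ sgn s t *: x (s + t).
  have [k kE] := central_scalar (xV (s + t)) (x0 (s + t)) (xC (s + t)) (xst s t)
    (centralM (xC s) (xC t)).
  have [b bE] := xpow s t N; have [b1 e1] := xN s; have [b2 e2] := xN t.
  have [b3 e3] := xN (s + t).
  have : k ^+ N = (-1) ^+ nat_of_bool (b (+) b1 (+) b2 (+) b3).
    move: bE; rewrite kE exprZn e1 e2 e3 -scalerAl -scalerAr mulr1 !scalerA -!signr_addb ?addbA.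
    move=> /(scale_inj _ _ _ (oner_neq0 _)) E.
    apply: (mulIf (_ : (-1) ^+ b3 != 0)); rewrite ?signr_eq0 // E -signr_addb.
    by congr (_ ^+ nat_of_bool _); rewrite -[RHS]addbA addbb addbF.
  move=> /(real_power1 N0)[c kc]; rewrite /sgn; have [|ne] := eqVneq (x s * x t) (x (s + t)).
    by rewrite scale1r.
  by move: ne; rewrite kE kc; case: c {kc}; rewrite ?scale1r ?eqxx.
have sgn00 : sgn 0 0 = false by rewrite /sgn addr0 x1 mulr1 eqxx.
have sgnA r s t : sgn r s (+) sgn (r + s) t = sgn s t (+) sgn r (s + t).
  apply: (@sign_scaleI R A _ _ (x (r + s + t))) => //.
  transitivity (x r * x s * x t).
    by rewrite (xM r s) -scalerAl xM scalerA -signr_addb.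
  by rewrite -mulrA (xM s t) -scalerAr (xM r) addrA scalerA -signr_addb.
exists (Twist sgn00 sgnA).
exists al, io, x.
have combE (f : {ffun T -> quaternions R}) t : io (f t) * x t \in V (al t).
  by apply: V0l => //; exact: ioV.
split=> //.
- by move=> h t; rewrite xC.
- move=> t a; split; first by move=> /(V_right (xV t) (x0 t))[w /io_onto[b ->] ->]; exists b.
  by move=> [b ->]; apply: V0l => //; exact: ioV.
- move=> a; have : a \in (\sum_(t : T) V (al t))%VS by rewrite Vfull memvf.
  move=> /memv_sumP[w wV ->].
  have [f fE] : exists f : T -> quaternions R, forall t, w t = io (f t) * x t.
    apply: (@fin_all_exists T (fun=> quaternions R : Type)
      (fun t h => w t = io h * x t)) => t.
    by have [v /io_onto[b ->] ->] := V_right (xV t) (x0 t) (wV t isT); exists b.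
  by exists [ffun t => f t]; apply: eq_bigr => t _; rewrite ffunE.
- move=> f f0; apply/ffunP => t; rewrite ffunE.
  have := directv_sum_independent Vdir (fun t => io (f t) * x t) (fun t _ => combE f t) f0 t isT.
  by move=> E; apply: ioinj; rewrite -[io (f t)](mulrK (xu t)) E mul0r.
Qed.

End GradedDivision.

(** * The classification *)

Lemma finite_zmod (G : zmodType) (e : seq G) : (forall g, g \in e) ->
  exists (T : finZmodType) (al : {additive T -> G}), bijective al.
Proof.
move=> eT; pose s := undup e.
have sP g : count_mem g s = 1%N by rewrite count_uniq_mem ?undup_uniq // mem_undup eT.
have pc : pcancel (fun g => index g s) (fun n => nth None (map Some s) n).
  by move=> g; rewrite (nth_map 0) ?nth_index ?index_mem // mem_undup eT.
pose cnt := @PCanIsCountable nat G _ _ pc.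
pose fin := @isFinite.Build G s sP.
pose T : finZmodType := HB.pack (GRing.Zmodule.sort G) cnt fin.
have [al alE] := @additive_of T G (fun x => x) (fun _ _ => erefl).
exists T, al; apply: bij_eq1 (fsym alE); by exists id.
Qed.

(** A component outside the finitely many that add up to A would be contained in
    their sum, against directness. *)
Lemma finite_support (F : fieldType) (G : zmodType) (A : falgType F)
    (V : G -> {vspace A}) : graded_division V ->
  exists (T : finZmodType) (al : {additive T -> G}), [/\ bijective al,
    (\sum_(t : T) V (al t))%VS = fullv & directv (\sum_(t : T) V (al t))].
Proof.
move=> [[[s sV] dV VM] _ Vnz].
have sE : (\sum_(g <- undup s) V g)%VS = fullv.
  by rewrite big_undup //; exact: addvv.
have sall g : g \in s.
  apply/negPn/negP => gs; case/negP: (Vnz g).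
  have us : uniq (g :: undup s) by rewrite /= mem_undup gs undup_uniq.
  have /directvP/= := dV _ us.
  have /directvP/= E' := dV _ (undup_uniq s).
  rewrite !big_cons -E' sE addvf => /eqP.
  by rewrite -[X in X == _]add0n eqn_add2r eq_sym dimv_eq0.
have [T [al albij]] := finite_zmod sall; exists T, al; split=> //.
  apply/eqP; rewrite eqEsubv subvf -sV /=.
  have [be _ beK] := albij.
  elim: s {sV sE sall} => [|g s IH]; first by rewrite big_nil sub0v.
  by rewrite big_cons subv_add IH andbT -{1}[g]beK (sumv_sup (be g)).
have us : uniq [seq al t | t <- index_enum T].
  by rewrite map_inj_uniq ?index_enum_uniq //; exact: bij_inj.
have /directvP/= E := dV _ us; apply/directvP; move: E.
by rewrite !big_map.
Qed.

Theorem theorem11p1 (R : realType) (G : zmodType) (A : falgType R)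
    (V : G -> {vspace A}) (divV : graded_division V) (dimVe : \dim (V 0) = 4%N) :
  exists p : item,
    [/\ item_ok p,
        gr_equiv (Gralg V) (item_alg R p)
      & forall p' : item, item_ok p' -> gr_equiv (Gralg V) (item_alg R p') ->
          same_item p p'].
Proof.
have [T [al [albij Vfull Vdir]]] := finite_support divV.
have [[_ _ VM] Vunit Vnz] := divV.
have dimV2 : (2 < \dim (V 0%R))%N by rewrite dimVe.
have [io [ioinj io_onto]] :=
  division_quaternions (V0_1 VM Vunit Vnz) (V0M VM) (@Vunit 0%R) dimV2.
have [S mS] := graded_model albij VM Vunit Vnz Vfull Vdir ioinj io_onto.
have [p [okp pS]] := twist_normalizable S.
have mp := model_qiso pS mS.
exists p; split=> //.
  exact: model_equiv mp (item_model R p).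
move=> p' okp' Ap'; apply: tw_item_inj => //.
apply: model_unique (@quaternion_center R) (model_push Ap' mp) (item_model R p').
Qed.
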